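(* Let $F$ be a contracting automorphism of $(\mathbb{C}^d,0)$ and let $\mathcal{I}\subseteq\mathcal{O}_{\mathbb{C}^d,0}$ be an ideal of germs of holomorphic functions which is invariant under the action of $F$. Then there exist holomorphic coordinates of $(\mathbb{C}^d,0)$ (centred at $0$) and weights $(n_1,\dots,n_d)$ such that, in these coordinates, $\mathcal{I}$ is generated by polynomials $P^{(1)},\dots,P^{(r)}$, each weighted homogeneous for the weights $(n_1,\dots,n_d)$, such that for all $i\in\{1,\dots,r\}$ the ideal $\langle P^{(1)},\dots,P^{(i)}\rangle$ is invariant under the action of $F$.
   Context: $\mathcal{O}_{\mathbb{C}^d,0}$ is the ring of germs at $0$ of holomorphic functions on $\mathbb{C}^d$. An automorphism $F$ of $(\mathbb{C}^d,0)$ (a germ of biholomorphism fixing $0$) is contracting if for every open neighbourhood $W$ of $0$ there exists an open neighbourhood $U$ of $0$ in $W$ such that $F(U)\Subset U$ and $\bigcap_{n\ge0}F^n(U)=\{0\}$. An ideal $\mathcal{I}\subseteq\mathcal{O}_{\mathbb{C}^d,0}$ is invariant under the action of $F$ if $\phi\circ F\in\mathcal{I}$ for all $\phi\in\mathcal{I}$. Weights are positive integers $(n_1,\dots,n_d)$. A polynomial $P\in\mathbb{C}[X_1,\dots,X_d]$ is weighted homogeneous for the weights $(n_1,\dots,n_d)$ if there exists $n\in\mathbb{N}$ such that $P(t^{n_1}x_1,\dots,t^{n_d}x_d)=t^nP(x_1,\dots,x_d)$ for all $t\in\mathbb{C}$ and $(x_1,\dots,x_d)\in\mathbb{C}^d$.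 *)

(* Defs.v *)
From HB Require Import structures.
From mathcomp Require Import all_boot all_order all_algebra.
From mathcomp Require Import all_classical all_reals all_analysis.
From mathcomp Require Import complex ring_quotient generic_quotient.
(* Not imported: its notations clash with those of mathcomp-analysis. *)
From mathcomp Require mpoly.

Set Implicit Arguments.
Unset Strict Implicit.
Unset Printing Implicit Defensive.

Import Order.TTheory GRing.Theory Num.Theory.
Import numFieldNormedType.Exports.

Local Open Scope classical_set_scope.
Local Open Scope ring_scope.

(* The alias makes 'rV[CC R]_d and CC R inherit the normed module structures
   attached to a numFieldType, over the scalars CC R itself, so that
   [differentiable] below means complex (Frechet) differentiable. *)
Definition CC (R : realType) : numClosedFieldType := R[i].

Section Germs.
Variables (R : realType) (d : nat).
Local Notation C := (CC R).
Local Notation E := 'rV[C]_d.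

Definition holomorphic_near0 (W : normedModType C) (f : E -> W) : Prop :=
  \forall x \near (0 : E), differentiable f x.

Definition holo_pred : {pred E -> C} :=
  fun f => `[< holomorphic_near0 (f : E -> C) >].

Lemma holo_predP (f : E -> C) : reflect (holomorphic_near0 f) (f \in holo_pred).
Proof. exact: asboolP. Qed.

Lemma holo_subring : subring_closed holo_pred.
Proof.
split.
- apply/holo_predP; near=> x; exact: differentiable_cst.
- move=> f g /holo_predP hf /holo_predP hg; apply/holo_predP.
  by near=> x; apply: differentiableB; near: x.
- move=> f g /holo_predP hf /holo_predP hg; apply/holo_predP.
  by near=> x; apply: differentiableM; near: x.
Unshelve. all: by end_near. Qed.

HB.instance Definition _ :=
  GRing.isSubringClosed.Build (E -> C) holo_pred holo_subring.

(* Functions on C^d that are holomorphic on some neighbourhood of 0. *)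
Record holo := Holo { holo_fun :> E -> C ; _ : holo_fun \in holo_pred }.

HB.instance Definition _ := [isSub for holo_fun].
HB.instance Definition _ := [Choice of holo by <:].
HB.instance Definition _ := [SubChoice_isSubComNzRing of holo by <:].

Lemma holoP (f : holo) : holomorphic_near0 f.
Proof. by case: f => f /= /holo_predP. Qed.

Definition vanish_near0 : {pred holo} :=
  fun f => `[< \forall x \near (0 : E), f x = 0 >].

Lemma vanish_near0_ideal : idealr_closed vanish_near0.
Proof.
split.
- by apply/asboolP; near=> x.
- apply/asboolP => /nbhs_singleton /= /eqP; by rewrite oner_eq0.
- move=> a f g /asboolP hf /asboolP hg; apply/asboolP.
  near=> x.
  have fx : f x = 0 by near: x.
  have gx : g x = 0 by near: x.
  by change (a x * f x + g x = 0); rewrite fx gx mulr0 addr0.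
Unshelve. all: by end_near. Qed.

HB.instance Definition _ :=
  isIdealr.Build holo vanish_near0 vanish_near0_ideal.

(* The ring of germs at 0 of holomorphic functions on C^d. *)
Definition germ := {ideal_quot vanish_near0}.

Definition germ_of (f : holo) : germ := (\pi_({ideal_quot vanish_near0}) f)%qT.

Lemma germ_ofP (f g : holo) :
  germ_of f = germ_of g <-> \forall x \near (0 : E), f x = g x.
Proof.
split=> [/eqP|h]; rewrite /germ_of.
  rewrite -Quotient.idealrBE => /asboolP; apply: filterS => x /eqP.
  by change ((f x - g x == 0) -> f x = g x); rewrite subr_eq0 => /eqP.
apply/eqP; rewrite -Quotient.idealrBE; apply/asboolP; apply: filterS h => x fg.
by change (f x - g x = 0); rewrite fg subrr.
Qed.

(* A germ of biholomorphism of C^d at 0 fixing 0, given by a representative: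
   a total map whose values away from 0 are irrelevant. It serves both as an
   automorphism of (C^d, 0) and as a system of holomorphic coordinates
   centred at 0. *)
Record automorphism := Automorphism {
  aut_fun :> E -> E ;
  aut0 : aut_fun 0 = 0 ;
  aut_holo : holomorphic_near0 aut_fun ;
  aut_inv : exists G : E -> E, [/\ G 0 = 0, holomorphic_near0 G,
    \forall x \near (0 : E), G (aut_fun x) = x
    & \forall x \near (0 : E), aut_fun (G x) = x]
}.

Lemma aut_cvg0 (F : automorphism) : F x @[x --> (0 : E)] --> (0 : E).
Proof.
rewrite -[X in _ --> X](aut0 F).
apply: differentiable_continuous; exact: nbhs_singleton (aut_holo F).
Qed.

Lemma aut_near (F : automorphism) (P : E -> Prop) :
  (\forall x \near (0 : E), P x) -> \forall x \near (0 : E), P (F x).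
Proof. exact: aut_cvg0. Qed.

Lemma holo_comp_subproof (f : holo) (F : automorphism) :
  (fun x => f (F x)) \in holo_pred.
Proof.
apply/holo_predP.
have := @aut_near F (fun y => differentiable f y) (holoP f).
have := aut_holo F; rewrite /holomorphic_near0.
apply: filterS2 => x; exact: differentiable_comp.
Unshelve. all: by end_near. Qed.

Definition holo_comp (f : holo) (F : automorphism) : holo :=
  Holo (holo_comp_subproof f F).

(* The germ of phi o F, computed on a chosen representative of phi. *)
Definition pullback (phi : germ) (F : automorphism) : germ :=
  germ_of (holo_comp (repr phi) F).

Lemma pullback_germ_of (f : holo) (F : automorphism) :
  pullback (germ_of f) F = germ_of (holo_comp f F).
Proof.
apply/germ_ofP; apply: (@aut_near F (fun y => repr (germ_of f) y = f y)).
by apply/germ_ofP; rewrite {1}/germ_of reprK.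
Qed.

Definition relatively_compact_in (A U : set E) : Prop :=
  compact (closure A) /\ closure A `<=` U.

(* This depends only on the germ of F: U may be taken inside any given W, and
   F maps U to itself, so no value of F outside W is involved. *)
Definition contracting (F : automorphism) : Prop :=
  forall W : set E, open_nbhs (0 : E) W ->
  exists U : set E, [/\ open_nbhs (0 : E) U, U `<=` W,
    relatively_compact_in (F @` U) U
    & \bigcap_(n in [set: nat]) (iter n F @` U) = [set 0]].

(* Unlike ring_quotient's [idealr], an ideal may be the whole ring. *)
Definition is_ideal (I : set germ) : Prop :=
  [/\ I 0, forall u v, I u -> I v -> I (u + v) & forall a u, I u -> I (a * u)].

Definition ideal_gen (S : set germ) : set germ := smallest is_ideal S.

Definition invariant_under (F : automorphism) (I : set germ) : Prop :=
  forall phi, I phi -> I (pullback phi F).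

Definition mpoly_fun (P : mpoly.mpoly d C) : E -> C :=
  fun x => mpoly.meval (fun i => x 0 i) P.

Lemma mpoly_holo (P : mpoly.mpoly d C) : mpoly_fun P \in holo_pred.
Proof.
have prodD (I : Type) (s : seq I) (f : I -> E -> C) x :
    (forall i, differentiable (f i) x) ->
    differentiable (fun y => \prod_(i <- s) f i y) x.
  move=> df; elim: s => [|i s IHs].
    under eq_fun do rewrite big_nil; exact: differentiable_cst.
  by under eq_fun do rewrite big_cons; apply: differentiableM.
have sumD (I : Type) (s : seq I) (f : I -> E -> C) x :
    (forall i, differentiable (f i) x) ->
    differentiable (fun y => \sum_(i <- s) f i y) x.
  move=> df; elim: s => [|i s IHs].
    under eq_fun do rewrite big_nil; exact: differentiable_cst.
  by under eq_fun do rewrite big_cons; apply: differentiableD.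
apply/holo_predP; near=> x; rewrite /mpoly_fun.
under eq_fun do rewrite mpoly.mevalE.
apply: (sumD) => m; apply: differentiableM; first exact: differentiable_cst.
apply: prodD => i.
elim: (mpoly.fun_of_multinom m i) => [|n IHn]; first exact: differentiable_cst.
under eq_fun do rewrite exprS.
by apply: differentiableM => //; exact: differentiable_coord.
Unshelve. all: by end_near. Qed.

Definition germ_mpoly (P : mpoly.mpoly d C) : germ :=
  germ_of (Holo (mpoly_holo P)).

Definition weighted_homogeneous (w : 'I_d -> nat) (P : mpoly.mpoly d C) : Prop :=
  exists n : nat, forall (t : C) (x : 'I_d -> C),
    mpoly.meval (fun i => t ^+ w i * x i) P = t ^+ n * mpoly.meval x P.

End Germs.

(* Main.v *)
(* Iterating F until it halves distances (compactness and the Schwarz lemma), we get G = F^N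
   whose pull-back operator T maps O(|x|^k) into itself with norm at most 2^-k there. Hence
   T - b is onto on O(|x|^k) when |b| >= 2^(1-k), by a Neumann series, while T acts on the
   finite-dimensional quotient by O(|x|^k); so each coordinate is, modulo O(|x|^2), a sum of
   generalised eigenfunctions of T, and d of them form a coordinate system phi with
   eigenvalues nu, 0 < |nu_i| < 1. The monomial phi^a is a generalised eigenfunction for nu^a,
   and only finitely many of them share the same eigenvalue.

   Ideals of convergent power series are Noetherian and closed (division with remainder), and
   polynomials in T isolate, modulo O(|x|^k), the part of a germ carried by the monomials with
   nu^a = mu. So an invariant ideal contains the isotypic parts of its elements, which are
   polynomials in phi, and is generated by finitely many of them. The isotypic elements of the
   ideal for a given mu form a finite-dimensional space preserved by F, in which F can be made
   triangular. Finally the relations nu^a = mu between the finitely many exponents involved,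
   read as linear relations between the numbers - ln |nu_i|, persist for integer weights
   obtained by simultaneous Diophantine approximation. *)
Require Import Defs.
From mathcomp Require Import all_boot all_order all_algebra.
From mathcomp Require Import all_classical all_reals all_analysis.
From mathcomp Require Import complex ring_quotient generic_quotient ring lra zify.
From mathcomp Require mpoly.
Import -(notations) mpoly.

Set Implicit Arguments.
Unset Strict Implicit.
Unset Printing Implicit Defensive.

Import Order.TTheory GRing.Theory Num.Theory.
Import numFieldNormedType.Exports.

Local Open Scope classical_set_scope.
Local Open Scope ring_scope.


(** * Complex differentiable functions of one variable *)

Section Modulus.
Variable R : realType.
Local Notation C := (CC R).

(** The map F is never brought to a normal form: resonances are harmless because only generalised
    eigenfunctions of the pull-back are used, and products of these are again such. Passing to the
    iterate G costs nothing, since F commutes with G and so preserves its generalised eigenspaces;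
    triangularity is then obtained for F itself. The obstacle is that the Neumann series only treats
    values b with |b| >= 2^(1-k), whereas a polynomial annihilating a coordinate modulo O(|x|^k) may
    have smaller roots. The linear part of G is invertible, hence has no eigenvalue of modulus below
    some c > 0, so components belonging to |b| < c have no linear part; k is chosen so that every
    root falls under one argument or the other. Isotypic expansions are never summed: the work is
    done modulo O(|x|^k) for each k, and closedness of ideals removes the error. A germ is handled
    as its family of Taylor coefficients, characterised by geometric growth; this rests on Cauchy's
    formula, proved on squares with a constant in place of 2 pi i of which only a lower bound is
    used. *)

Definition rc : {rmorphism R -> C} := @real_complex_def R (Phant R).
Definition ii : C := 'i%C.
Definition cRe (z : C) : R := complex.Re z.
Definition cIm (z : C) : R := complex.Im z.
(** The norm of [CC R] takes its values in [CC R]; this is the same modulus as an element of [R], to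
    which suprema, integrals and real arithmetic apply. *)
Definition cabs (z : C) : R := complex.Re `|z|.

Lemma normE (z : C) : `|z| = rc (cabs z).
Proof. by rewrite /cabs; case: z. Qed.

Lemma rc_inj : injective rc.
Proof. exact: complexI. Qed.

Lemma ler_rc (x y : R) : (rc x <= rc y) = (x <= y).
Proof. exact: lecR. Qed.

Lemma ltr_rc (x y : R) : (rc x < rc y) = (x < y).
Proof. exact: ltcR. Qed.

Lemma cabs_le (z : C) (r : R) : (`|z| <= rc r) = (cabs z <= r).
Proof. by rewrite normE ler_rc. Qed.

Lemma gt0_rc (e : C) : 0 < e -> exists2 r : R, 0 < r & e = rc r.
Proof.
move=> e0; exists (complex.Re e); last by rewrite -[LHS]RRe_real // gtr0_real.
by rewrite -ltr_rc rmorph0 [rc _]RRe_real // gtr0_real.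
Qed.

Lemma cabs_ge0 z : 0 <= cabs z.
Proof. by rewrite -ler_rc -normE rmorph0 normr_ge0. Qed.

Lemma cabs0 : cabs 0 = 0.
Proof. by apply: rc_inj; rewrite -normE normr0 rmorph0. Qed.

Lemma cabs1 : cabs 1 = 1.
Proof. by apply: rc_inj; rewrite -normE normr1 rmorph1. Qed.

Lemma cabs_eq0 z : (cabs z == 0) = (z == 0).
Proof. by rewrite -(inj_eq rc_inj) -normE rmorph0 normr_eq0. Qed.

Lemma cabs_gt0 z : (0 < cabs z) = (z != 0).
Proof. by rewrite lt_def cabs_ge0 andbT cabs_eq0. Qed.

Lemma cabsM x y : cabs (x * y) = cabs x * cabs y.
Proof. by apply: rc_inj; rewrite rmorphM -!normE normrM. Qed.

Lemma cabsD x y : cabs (x + y) <= cabs x + cabs y.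
Proof. by rewrite -ler_rc rmorphD -!normE ler_normD. Qed.

Lemma cabsN x : cabs (- x) = cabs x.
Proof. by apply: rc_inj; rewrite -!normE normrN. Qed.

Lemma cabsB x y : cabs (x - y) <= cabs x + cabs y.
Proof. by rewrite -[cabs y]cabsN cabsD. Qed.

Lemma cabsBC x y : cabs (x - y) = cabs (y - x).
Proof. by rewrite -cabsN opprB. Qed.

Lemma cabsV x : cabs x^-1 = (cabs x)^-1.
Proof. by apply: rc_inj; rewrite -normE normfV normE fmorphV. Qed.

Lemma cabsX x n : cabs (x ^+ n) = cabs x ^+ n.
Proof. by apply: rc_inj; rewrite rmorphXn -!normE normrX. Qed.

Lemma cabs_sum (I : Type) (s : seq I) (P : pred I) (F : I -> C) :
  cabs (\sum_(i <- s | P i) F i) <= \sum_(i <- s | P i) cabs (F i).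
Proof.
elim/big_rec2: _ => [|i y x _ le]; first by rewrite cabs0.
by apply: le_trans (cabsD _ _) _; rewrite lerD2l.
Qed.

Lemma cabs_prod (I : Type) (s : seq I) (P : pred I) (F : I -> C) :
  cabs (\prod_(i <- s | P i) F i) = \prod_(i <- s | P i) cabs (F i).
Proof. by elim/big_rec2: _ => [|i y x _ <-]; rewrite ?cabs1 ?cabsM. Qed.

Lemma cabs_rc (x : R) : cabs (rc x) = `|x|.
Proof. by rewrite /cabs normc_def /= expr0n addr0 sqrtr_sqr. Qed.

Lemma cabs_ii : cabs ii = 1.
Proof. by rewrite /cabs /ii normc_def /= expr0n add0r expr1n sqrtr1. Qed.

Lemma ii2 : ii * ii = -1.
Proof. by rewrite /ii -expr2 sqr_i. Qed.

Lemma cReIm z : z = rc (cRe z) + ii * rc (cIm z).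
Proof. by rewrite [LHS]complexE. Qed.

Lemma cRe_rc (x y : R) : cRe (rc x + ii * rc y) = x.
Proof. by rewrite /cRe /= mul0r !mul1r sub0r oppr0 addr0. Qed.

Lemma cIm_rc (x y : R) : cIm (rc x + ii * rc y) = y.
Proof. by rewrite /cIm /= mul0r !mul1r !add0r. Qed.

Lemma cReD x y : cRe (x + y) = cRe x + cRe y.
Proof. by case: x y => [a b] [c e]. Qed.
Lemma cImD x y : cIm (x + y) = cIm x + cIm y.
Proof. by case: x y => [a b] [c e]. Qed.
Lemma cReN x : cRe (- x) = - cRe x. Proof. by case: x. Qed.
Lemma cImN x : cIm (- x) = - cIm x. Proof. by case: x. Qed.
Lemma cReM x y : cRe (x * y) = cRe x * cRe y - cIm x * cIm y.
Proof. by case: x y => [a b] [c e]. Qed.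
Lemma cImM x y : cIm (x * y) = cRe x * cIm y + cIm x * cRe y.
Proof. by case: x y => [a b] [c e] /=; rewrite /cIm /= [b * c]mulrC addrC [c*b]mulrC addrC. Qed.

Lemma normr_cRe z : `|cRe z| <= cabs z.
Proof.
rewrite /cabs normc_def /= -sqrtr_sqr ler_sqrt ?addr_ge0 ?sqr_ge0 //.
by rewrite lerDl sqr_ge0.
Qed.

Lemma normr_cIm z : `|cIm z| <= cabs z.
Proof.
rewrite /cabs normc_def /= -sqrtr_sqr ler_sqrt ?addr_ge0 ?sqr_ge0 //.
by rewrite lerDr sqr_ge0.
Qed.

Lemma cabs_ReIm z : cabs z <= `|cRe z| + `|cIm z|.
Proof.
rewrite {1}[z]cReIm; apply: le_trans (cabsD _ _) _.
by rewrite cabsM cabs_ii mul1r !cabs_rc.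
Qed.

Lemma cabs_le_abs x y : cabs x <= cabs y + cabs (x - y).
Proof. by rewrite -[X in cabs X](subrK y) addrC addrC (le_trans (cabsD _ _)) // addrC. Qed.

(** The limit is the supremum of the lower bounds [u t - e t]. Errors are attached to an arbitrary
    index set rather than to a sequence, so that the lemma serves both for sequences and for
    difference quotients indexed by the increment. *)
Lemma real_complete (T : Type) (P : T -> Prop) (u e : T -> R) : (exists t, P t) ->
  (forall s t, P s -> P t -> `|u s - u t| <= e s + e t) ->
  exists l, forall t, P t -> `|u t - l| <= e t.
Proof.
move=> [t0 Pt0] H; pose A := [set u t - e t | t in [set t | P t]].
have ubA t : P t -> ubound A (u t + e t).
  move=> Pt _ [s Ps <-]; have := H s t Ps Pt; rewrite ler_norml => /andP[_].
  by move: (u s) (u t) (e s) (e t) => a b c d; lra.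
have A0 : A !=set0 by exists (u t0 - e t0), t0.
have supA : has_sup A by split => //; exists (u t0 + e t0); exact: ubA.
exists (sup A) => t Pt.
have h1 : sup A <= u t + e t by apply: ge_sup => //; exact: ubA.
have h2 : u t - e t <= sup A by apply: ub_le_sup; [case: supA | exists t].
by rewrite ler_norml; lra.
Qed.

(* The factor 2 comes from treating real and imaginary parts separately. *)
Lemma complex_complete (T : Type) (P : T -> Prop) (u : T -> C) (e : T -> R) :
  (exists t, P t) ->
  (forall s t, P s -> P t -> cabs (u s - u t) <= e s + e t) ->
  exists l, forall t, P t -> cabs (u t - l) <= 2 * e t.
Proof.
move=> P0 H.
have [|a Ha] := @real_complete T P (cRe \o u) e P0.
  move=> s t Ps Pt /=; rewrite -cReN -cReD.
  exact: le_trans (normr_cRe _) (H _ _ Ps Pt).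
have [|b Hb] := @real_complete T P (cIm \o u) e P0.
  move=> s t Ps Pt /=; rewrite -cImN -cImD.
  exact: le_trans (normr_cIm _) (H _ _ Ps Pt).
exists (rc a + ii * rc b) => t Pt; apply: le_trans (cabs_ReIm _) _.
rewrite cReD cReN cRe_rc cImD cImN cIm_rc.
by have := Ha t Pt; have := Hb t Pt => /=; lra.
Qed.

End Modulus.

(** * The sup norm of C^d as a real number, and neighbourhoods as polydiscs *)

Section Coordinates.
Variables (R : realType) (d : nat).
Local Notation C := (CC R).
Local Notation E := 'rV[C]_d.

Definition vabs (x : E) : R := complex.Re `|x|.

Lemma vnormE (x : E) : `|x| = rc R (vabs x).
Proof. by rewrite -[LHS]RRe_real // ger0_real. Qed.

Lemma vabs_ge0 x : 0 <= vabs x.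
Proof. by rewrite -ler_rc -vnormE rmorph0. Qed.

Lemma vabs0 : vabs 0 = 0.
Proof. by apply: (@rc_inj R); rewrite -vnormE normr0 rmorph0. Qed.

Lemma vabs_eq0 x : (vabs x == 0) = (x == 0).
Proof. by rewrite -(inj_eq (@rc_inj R)) -vnormE rmorph0 normr_eq0. Qed.

Lemma vabsD x y : vabs (x + y) <= vabs x + vabs y.
Proof. by rewrite -ler_rc rmorphD -!vnormE ler_normD. Qed.

Lemma vabsN x : vabs (- x) = vabs x.
Proof. by apply: (@rc_inj R); rewrite -!vnormE normrN. Qed.

Lemma vabsZ a x : vabs (a *: x) = cabs a * vabs x.
Proof. by apply: (@rc_inj R); rewrite rmorphM -vnormE normrZ normE vnormE. Qed.

Lemma vabs_ltP (x : E) r : 0 < r -> reflect (forall i, cabs (x 0 i) < r) (vabs x < r).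
Proof.
move=> r0; have -> : vabs x < r = `[< ball (0 : E) (rc R r) x >].
  rewrite mx_norm_ball /ball_ /= sub0r normrN vnormE ltr_rc.
  by apply/idP/asboolP.
apply: (iffP (asboolP _)) => [[_ H] i | H].
  by have := H 0 i; rewrite -ball_normE /= mxE sub0r normrN normE ltr_rc.
split; first by rewrite -(rmorph0 (rc R)) ltr_rc.
by move=> i j; rewrite -ball_normE /= mxE sub0r normrN normE ltr_rc ord1; exact: H.
Qed.

Lemma vabs_lt (x : E) r : 0 < r -> (forall i, cabs (x 0 i) < r) -> vabs x < r.
Proof. by move=> r0 H; apply/vabs_ltP. Qed.

Lemma cabs_coord (x : E) i : cabs (x 0 i) <= vabs x.
Proof.
apply/ler_addgt0Pr => e e0; apply: ltW.
have h0 : 0 < vabs x + e by apply: ltr_wpDl => //; exact: vabs_ge0.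
by have /(vabs_ltP _ h0) : vabs x < vabs x + e by rewrite ltrDl.
Qed.

Lemma vabs_le (x : E) r : 0 <= r -> (forall i, cabs (x 0 i) <= r) -> vabs x <= r.
Proof.
move=> r0 H; apply/ler_addgt0Pr => e e0; apply: ltW; apply: vabs_lt.
  exact: ltr_wpDl.
by move=> i; apply: le_lt_trans (H i) _; rewrite ltrDl.
Qed.

Lemma near0P (P : E -> Prop) :
  (\forall x \near (0 : E), P x) <->
  exists2 r : R, 0 < r & forall x, vabs x < r -> P x.
Proof.
split.
  move=> /nbhs_ballP[e /= /gt0_rc[r r0 ->] H]; exists r => // x xr; apply: H.
  by rewrite -ball_normE /= sub0r normrN vnormE ltr_rc.
move=> [r r0 H]; apply/nbhs_ballP; exists (rc R r) => /=.
  by rewrite -(rmorph0 (rc R)) ltr_rc.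
by move=> x; rewrite -ball_normE /= sub0r normrN vnormE ltr_rc; exact: H.
Qed.

Lemma nearP (P : E -> Prop) (a : E) :
  (\forall x \near a, P x) <->
  exists2 r : R, 0 < r & forall x, vabs (x - a) < r -> P x.
Proof.
split.
  move=> /nbhs_ballP[e /= /gt0_rc[r r0 ->] H]; exists r => // x xr; apply: H.
  by rewrite -ball_normE /= -opprB normrN vnormE ltr_rc.
move=> [r r0 H]; apply/nbhs_ballP; exists (rc R r) => /=.
  by rewrite -(rmorph0 (rc R)) ltr_rc.
by move=> x; rewrite -ball_normE /= -opprB normrN vnormE ltr_rc; exact: H.
Qed.

End Coordinates.

(** * Integrals of continuous complex functions over real segments *)

Section SegmentIntegral.
Variable R : realType.
Local Notation C := (CC R).
Local Notation mu := (@lebesgue_measure R).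
Implicit Types (h k : R -> C) (a b c : R).

Definition ccont h a b := forall x, a <= x <= b -> forall e, 0 < e ->
  exists2 dl, 0 < dl & forall y, a <= y <= b -> `|y - x| < dl -> cabs (h y - h x) <= e.

(** The integral is not oriented: it is zero when b < a. Orientation is put in by explicit signs
    where contours are built. *)
Definition cint h a b : C :=
  rc R (\int[mu]_(x in `[a, b]) cRe (h x)) + ii R * rc R (\int[mu]_(x in `[a, b]) cIm (h x)).

Lemma ccont_sub h a b a' b' : a <= a' -> b' <= b -> ccont h a b -> ccont h a' b'.
Proof.
move=> aa bb H x /andP[xa xb] e e0.
have [|dl d0 Hd] := H x _ e e0; first by rewrite (le_trans aa) // (le_trans xb).
exists dl => // y /andP[ya yb]; apply: Hd.
by rewrite (le_trans aa) // (le_trans yb).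
Qed.

Lemma ccont_within (pr : C -> R) h a b : (forall z w, `|pr z - pr w| <= cabs (z - w)) ->
  ccont h a b -> {within `[a, b], continuous (pr \o h)}.
Proof.
move=> Hpr H; apply/subspace_continuousP => x /= xab.
apply/cvgrPdist_le => e e0.
have [|dl d0 Hd] := H x _ e e0; first by rewrite in_itv in xab.
rewrite near_withinE; near=> y => yab.
apply: le_trans (Hpr _ _) _; rewrite cabsBC; apply: Hd.
  by rewrite /= in_itv in yab.
near: y; apply/nbhs_ballP; exists dl => //= y.
by rewrite /ball /= distrC.
Unshelve. all: by end_near. Qed.

Lemma cRe_lip (z w : C) : `|cRe z - cRe w| <= cabs (z - w).
Proof. by rewrite -cReN -cReD normr_cRe. Qed.

Lemma cIm_lip (z w : C) : `|cIm z - cIm w| <= cabs (z - w).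
Proof. by rewrite -cImN -cImD normr_cIm. Qed.

Lemma ccont_int (pr : C -> R) h a b : (forall z w, `|pr z - pr w| <= cabs (z - w)) ->
  ccont h a b -> mu.-integrable `[a, b] (EFin \o (pr \o h)).
Proof.
move=> Hpr H; apply: continuous_compact_integrable; first exact: segment_compact.
exact: ccont_within H.
Qed.

Lemma ccont_intRe h a b : ccont h a b -> mu.-integrable `[a, b] (EFin \o (fun x => cRe (h x))).
Proof. exact/ccont_int/cRe_lip. Qed.

Lemma ccont_intIm h a b : ccont h a b -> mu.-integrable `[a, b] (EFin \o (fun x => cIm (h x))).
Proof. exact/ccont_int/cIm_lip. Qed.

Lemma eq_cint h k a b : (forall x, a <= x <= b -> h x = k x) -> cint h a b = cint k a b.
Proof.
move=> H; congr (rc R _ + _ * rc R _); apply: eq_Rintegral => x;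
  by rewrite inE /= in_itv /= => /H ->.
Qed.

Lemma eq_ccont h k a b : (forall x, a <= x <= b -> h x = k x) -> ccont h a b -> ccont k a b.
Proof.
move=> E H x xab e e0; have [dl d0 Hd] := H x xab e e0; exists dl => // y yab.
by rewrite -!E //; exact: Hd.
Qed.

Lemma ccont_cst z a b : ccont (fun=> z) a b.
Proof.
move=> x _ e e0; exists 1 => // y _ _; rewrite subrr cabs0; exact: ltW.
Qed.

Lemma ccont_rc a b : ccont (rc R) a b.
Proof.
move=> x _ e e0; exists e => // y _ h.
by rewrite -rmorphB cabs_rc ltW.
Qed.

Lemma ccontD h k a b : ccont h a b -> ccont k a b -> ccont (fun x => h x + k x) a b.
Proof.
move=> H1 H2 x xab e e0.
have e2 : 0 < e / 2 by rewrite divr_gt0.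
have [d1 d10 h1] := H1 x xab _ e2; have [d2 d20 h2] := H2 x xab _ e2.
exists (Num.min d1 d2) => [|y yab]; first by rewrite lt_min d10.
rewrite lt_min => /andP[y1 y2].
have -> : h y + k y - (h x + k x) = (h y - h x) + (k y - k x) by ring.
apply: le_trans (cabsD _ _) _; have := h1 y yab y1; have := h2 y yab y2; lra.
Qed.

Lemma ccontZ z h a b : ccont h a b -> ccont (fun x => z * h x) a b.
Proof.
move=> H x xab e e0.
have p : 0 < cabs z + 1 by apply: ltr_wpDl => //; exact: cabs_ge0.
have [dl d0 Hd] := H x xab (e / (cabs z + 1)) (divr_gt0 e0 p).
exists dl => // y yab yx; rewrite -mulrBr cabsM.
have := Hd y yab yx; rewrite ler_pdivlMr // mulrC; apply: le_trans.
by apply: ler_wpM2r; [exact: cabs_ge0 | rewrite lerDl].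
Qed.

Lemma cintD h k a b : ccont h a b -> ccont k a b ->
  cint (fun x => h x + k x) a b = cint h a b + cint k a b.
Proof.
move=> H1 H2; rewrite /cint.
under eq_Rintegral do rewrite cReD.
under [X in _ + _ * rc R X]eq_Rintegral do rewrite cImD.
rewrite !RintegralD //; try exact: ccont_intRe; try exact: ccont_intIm.
by rewrite !rmorphD /=; ring.
Qed.

Lemma cintZ z h a b : ccont h a b -> cint (fun x => z * h x) a b = z * cint h a b.
Proof.
move=> H; rewrite /cint.
under eq_Rintegral do rewrite cReM -mulNr.
under [X in _ + _ * rc R X]eq_Rintegral do rewrite cImM.
have IR := ccont_intRe H; have II := ccont_intIm H.
have ZR (r : R) : mu.-integrable `[a, b] (EFin \o (fun x => r * cRe (h x))).
  have := ccont_intRe (ccontZ (rc R r) H); congr (integrable _ _ _).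
  by apply/funext => x /=; rewrite cReM /cRe /cIm /= mul0r subr0.
have ZI (r : R) : mu.-integrable `[a, b] (EFin \o (fun x => r * cIm (h x))).
  have := ccont_intIm (ccontZ (rc R r) H); congr (integrable _ _ _).
  by apply/funext => x /=; rewrite cImM /cRe /cIm /= mul0r addr0.
rewrite !RintegralD ?RintegralZl //; try exact: ZR; try exact: ZI.
rewrite [in RHS](cReIm z); move: (cRe z) (cIm z) => p q.
have := ii2 R; set i := ii R => i2.
rewrite !rmorphD !rmorphM rmorphN /=; move: (rc R _) (rc R _) (rc R p) (rc R q) => u v p' q'.
have -> : (p' + i * q') * (v + i * u) = p' * v + i * i * (q' * u) + i * (p' * u + q' * v) by ring.
by rewrite i2; ring.
Qed.

Lemma cint_split h a b c : a <= c <= b -> ccont h a b ->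
  cint h a b = cint h a c + cint h c b.
Proof.
move=> /andP[ac cb] H.
have S f : mu.-integrable `[a, b] (EFin \o f) ->
    \int[mu]_(x in `[a, b]) f x = \int[mu]_(x in `[a, c]) f x + \int[mu]_(x in `[c, b]) f x.
  move=> If; have := @Rintegral_itvB R f (BLeft a) (BRight b) c If.
  rewrite !bnd_simp => /(_ ac cb) E.
  rewrite -[LHS](subrK (\int[mu]_(t in `[a, c]) f t)) E addrC; congr (_ + _).
  rewrite Rintegral_itv_obnd_cbnd //.
  apply: integrableS If => //; apply: subset_itv; rewrite bnd_simp //.
rewrite /cint (S (fun x => cRe (h x))) ?(S (fun x => cIm (h x))) ?rmorphD /=;
  [ring | exact: ccont_intIm | exact: ccont_intRe].
Qed.

Lemma Rintegral_itv_cst (r a b : R) : a <= b -> \int[mu]_(x in `[a, b]) r = r * (b - a).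
Proof.
move=> ab; rewrite Rintegral_cst //; congr (_ * _).
transitivity (fine (if a%:E < b%:E then b%:E - a%:E else 0)%E).
  by congr fine; exact: (lebesgue_measure_itv `[a, b]).
by rewrite lte_fin; case: ltP => //= h; apply/eqP; rewrite eq_sym subr_eq0 eq_le ab h.
Qed.

Lemma cint_cst z a b : a <= b -> cint (fun=> z) a b = z * rc R (b - a).
Proof.
move=> ab; rewrite /cint !Rintegral_itv_cst // [in RHS](cReIm z) !rmorphM /=; ring.
Qed.

(** The factor 2 is the price of bounding real and imaginary parts separately; all constants of the
    Cauchy estimates inherit it. *)
Lemma cint_bound h a b (M : R) : a <= b -> ccont h a b ->
  (forall x, a <= x <= b -> cabs (h x) <= M) -> cabs (cint h a b) <= 2 * (M * (b - a)).
Proof.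
move=> ab H HM.
have M0 : 0 <= M by apply: le_trans (cabs_ge0 (h a)) _; apply: HM; rewrite lexx.
have B (pr : C -> R) : (forall z w, `|pr z - pr w| <= cabs (z - w)) ->
    (forall z, `|pr z| <= cabs z) -> `|\int[mu]_(x in `[a, b]) pr (h x)| <= M * (b - a).
  move=> H1 H2; have Ih := ccont_int H1 H.
  apply: le_trans (le_normr_Rintegral _ Ih) _ => //.
  apply: (@le_trans _ _ (\int[mu]_(x in `[a, b]) M)).
    apply: le_Rintegral => //.
    - exact: (integrable_norm Ih).
    - have := ccont_intRe (@ccont_cst (rc R M) a b); rewrite /comp.
      by rewrite (_ : cRe (rc R M) = M) //; have := cRe_rc M 0; rewrite rmorph0 mulr0 addr0.
    - by move=> x; rewrite /= in_itv /= => /HM; exact: le_trans.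
  by rewrite Rintegral_itv_cst.
apply: le_trans (cabs_ReIm _) _; rewrite /cint cRe_rc cIm_rc.
rewrite mulr_natl mulr2n.
by apply: lerD; apply: B; [exact: cRe_lip|exact: normr_cRe|exact: cIm_lip|exact: normr_cIm].
Qed.

(** Serves to transport the integral of 1 / (z - w) from a square of any size and centre to the unit
    square. *)
Lemma cint_affine h (u v a b : R) : 0 < u -> a <= b -> ccont h (u * a + v) (u * b + v) ->
  cint h (u * a + v) (u * b + v) = rc R u * cint (fun t => h (u * t + v)) a b.
Proof.
move=> u0 ab H; pose F : R -> R := fun t => u * t + v.
have dF (t : R) : is_derive t (1 : R) F u.
  rewrite /F; apply: is_derive_eq; by rewrite addr0 ?mulr1 /GRing.scale /= ?mulr1 ?mul1r.
have F' : derive1 F = cst u by apply/funext => t; rewrite derive1E; exact: derive_val.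
have cF : continuous F.
  by move=> t; apply: differentiable_continuous; apply/derivable1_diffP; exact: ex_derive.
have S (pr : C -> R) : (forall z w, `|pr z - pr w| <= cabs (z - w)) ->
    \int[mu]_(x in `[F a, F b]) pr (h x) = u * \int[mu]_(t in `[a, b]) pr (h (F t)).
  move=> Hpr; rewrite /Rintegral (@integration_by_substitution_increasing R F (pr \o h)) //.
  - rewrite F'; rewrite -RintegralZl //.
      by congr fine; apply: eq_integral => x _ /=; rewrite mulrC.
    have cc : ccont (fun t => h (F t)) a b.
      move=> x xab e e0; have Fx y : a <= y <= b -> F a <= F y <= F b.
        by rewrite /F !lerD2r !(ler_pM2l u0).
      have [dl d0 Hd] := H (F x) (Fx x xab) e e0.
      exists (dl / u) => [|y yab yx]; first exact: divr_gt0.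
      apply: Hd; first exact: Fx.
      have -> : F y - F x = u * (y - x) by rewrite /F; ring.
      by rewrite normrM gtr0_norm // mulrC -ltr_pdivlMr.
    exact: (ccont_int Hpr cc).
  - by move=> x y _ _ xy; rewrite /F ltrD2r ltr_pM2l.
  - by rewrite F' => ? _; exact: cvg_cst.
  - by rewrite F'; exact: is_cvg_cst.
  - by rewrite F'; exact: is_cvg_cst.
  - split; first by move=> x _; exact: ex_derive.
      by apply: cvg_at_right_filter; exact: cF.
    by apply: cvg_at_left_filter; exact: cF.
  - exact: ccont_within H.
rewrite /cint (S _ cRe_lip) (S _ cIm_lip) !rmorphM /=; ring.
Qed.

Lemma cint_id a b : a <= b -> cint (rc R) a b = rc R ((b ^+ 2 - a ^+ 2) / 2).
Proof.
rewrite le_eqVlt => /predU1P[->|ab].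
  by rewrite /cint set_itv1 !Rintegral_set1 subrr mul0r !rmorph0 mulr0 addr0.
have E x : rc R x = rc R x + ii R * rc R 0 by rewrite rmorph0 mulr0 addr0.
rewrite /cint; under eq_Rintegral do rewrite E cRe_rc.
under [X in _ + _ * rc R X]eq_Rintegral do rewrite E cIm_rc.
rewrite Rintegral_itv_cst ?ltW // mul0r rmorph0 mulr0 addr0; congr (rc R _).
pose F : R -> R := fun t => t ^+ 2 / 2.
have dF (t : R) : is_derive t (1 : R) F t.
  rewrite /F; apply: is_derive_eq; by rewrite /GRing.scale /=; field.
have := @continuous_FTC2 R id F a b ab.
rewrite /Rintegral => ->; first by rewrite /= /F mulrBl.
- by apply: continuous_subspaceT => x; exact: cvg_id.
- have cF : continuous F.
    by move=> t; apply: differentiable_continuous; apply/derivable1_diffP; exact: ex_derive.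
  split; first by move=> x _; exact: ex_derive.
    by apply: cvg_at_right_filter; exact: cF.
  by apply: cvg_at_left_filter; exact: cF.
- by move=> x _; rewrite derive1E; apply: derive_val.
Qed.

End SegmentIntegral.

Lemma le_sum4 (R : realFieldType) (q u1 u2 u3 u4 : R) : q <= u1 + u2 + (u3 + u4) ->
  [\/ q <= 4 * u1, q <= 4 * u2, q <= 4 * u3 | q <= 4 * u4].
Proof.
move=> h; have [h1|h1] := leP q (4 * u1); first by constructor 1.
have [h2|h2] := leP q (4 * u2); first by constructor 2.
have [h3|h3] := leP q (4 * u3); first by constructor 3.
by constructor 4; lra.
Qed.

(** * Goursat's theorem for rectangles *)

Section Goursat.
Variable R : realType.
Local Notation C := (CC R).
Local Notation rc := (rc R).
Local Notation ii := (ii R).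
Implicit Types (g k : C -> C) (a b c d x y : R).

Definition cdiff g (z : C) := exists l : C, forall e : R, 0 < e ->
  exists2 dl : R, 0 < dl & forall h, cabs h < dl -> cabs (g (z + h) - g z - l * h) <= e * cabs h.

Definition pt x y : C := rc x + ii * rc y.

Lemma ptE z : pt (cRe z) (cIm z) = z. Proof. by rewrite /pt -cReIm. Qed.

Lemma cabs_pt_sub x y x' y' : cabs (pt x y - pt x' y') <= `|x - x'| + `|y - y'|.
Proof.
have -> : pt x y - pt x' y' = rc (x - x') + ii * rc (y - y').
  by rewrite /pt !rmorphB; ring.
by apply: le_trans (cabsD _ _) _; rewrite cabsM cabs_ii mul1r !cabs_rc.
Qed.

Lemma cdiff_cont g z : cdiff g z -> forall e : R, 0 < e ->
  exists2 dl : R, 0 < dl & forall w, cabs (w - z) < dl -> cabs (g w - g z) <= e.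
Proof.
move=> [l H] e e0; have [dl d0 Hd] := H 1 ltr01.
have p : 0 < 1 + cabs l by apply: ltr_pwDl => //; exact: cabs_ge0.
exists (Num.min dl (e / (1 + cabs l))); first by rewrite lt_min d0 divr_gt0.
move=> w; rewrite lt_min => /andP[wd we].
have := Hd _ wd; rewrite mul1r [z + _]addrC subrK => H1.
have -> : g w - g z = (g w - g z - l * (w - z)) + l * (w - z) by ring.
apply: le_trans (cabsD _ _) _; rewrite cabsM.
apply: (@le_trans _ _ ((1 + cabs l) * cabs (w - z))); last first.
  by rewrite mulrC -ler_pdivlMr // ltW.
by rewrite mulrDl mul1r lerD2r.
Qed.

Lemma ccont_hor g a b y : (forall x, a <= x <= b -> cdiff g (pt x y)) ->
  ccont (fun x => g (pt x y)) a b.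
Proof.
move=> H x xab e e0; have [dl d0 Hd] := cdiff_cont (H x xab) e0.
exists dl => // x' _ xx; apply: Hd; apply: le_lt_trans (cabs_pt_sub _ _ _ _) _.
by rewrite subrr normr0 addr0.
Qed.

Lemma ccont_ver g c d x : (forall y, c <= y <= d -> cdiff g (pt x y)) ->
  ccont (fun y => g (pt x y)) c d.
Proof.
move=> H y ycd e e0; have [dl d0 Hd] := cdiff_cont (H y ycd) e0.
exists dl => // y' _ yy; apply: Hd; apply: le_lt_trans (cabs_pt_sub _ _ _ _) _.
by rewrite subrr normr0 add0r.
Qed.

(** The contour integral of g along the boundary of [a, b] x [c, d], counterclockwise; the factor
    [ii] is dz = i dy on the vertical sides. *)
Definition rect_int g a b c d : C :=
  cint (fun x => g (pt x c)) a b + ii * cint (fun y => g (pt b y)) c d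
  - cint (fun x => g (pt x d)) a b - ii * cint (fun y => g (pt a y)) c d.

Definition edge_cont g a b c d := [/\ ccont (fun x => g (pt x c)) a b,
  ccont (fun y => g (pt b y)) c d, ccont (fun x => g (pt x d)) a b
  & ccont (fun y => g (pt a y)) c d].

Lemma rect_intD g k a b c d : edge_cont g a b c d -> edge_cont k a b c d ->
  rect_int (fun z => g z + k z) a b c d = rect_int g a b c d + rect_int k a b c d.
Proof. by move=> [g1 g2 g3 g4] [k1 k2 k3 k4]; rewrite /rect_int !cintD //; repeat move: (cint _ _ _) => ?; ring. Qed.

Lemma rect_intZ w g a b c d : edge_cont g a b c d ->
  rect_int (fun z => w * g z) a b c d = w * rect_int g a b c d.
Proof. by move=> [g1 g2 g3 g4]; rewrite /rect_int !cintZ //; repeat move: (cint _ _ _) => ?; ring. Qed.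

Lemma edge_contD g k a b c d : edge_cont g a b c d -> edge_cont k a b c d ->
  edge_cont (fun z => g z + k z) a b c d.
Proof. by move=> [? ? ? ?] [? ? ? ?]; split; exact: ccontD. Qed.

Lemma edge_contZ w g a b c d : edge_cont g a b c d -> edge_cont (fun z => w * g z) a b c d.
Proof. by move=> [? ? ? ?]; split; exact: ccontZ. Qed.

Lemma edge_cont_cst w a b c d : edge_cont (fun=> w) a b c d.
Proof. by split; exact: ccont_cst. Qed.

Lemma edge_cont_id a b c d : edge_cont id a b c d.
Proof.
have H (w w' : C) p q : ccont (fun x => w * rc x + w') p q.
  by apply: ccontD; [apply: ccontZ; exact: ccont_rc | exact: ccont_cst].
split; [apply: eq_ccont (H 1 (ii * rc c) a b) | apply: eq_ccont (H ii (rc b) c d)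
  | apply: eq_ccont (H 1 (ii * rc d) a b) | apply: eq_ccont (H ii (rc a) c d)] => x _;
  by rewrite /pt ?mul1r // addrC.
Qed.

Lemma rect_int_cst w a b c d : a <= b -> c <= d -> rect_int (fun=> w) a b c d = 0.
Proof. by move=> ab cd; rewrite /rect_int !cint_cst //; ring. Qed.

Lemma rect_int_id a b c d : a <= b -> c <= d -> rect_int id a b c d = 0.
Proof.
move=> ab cd.
have H (w w' : C) p q : p <= q -> cint (fun x => w * rc x + w') p q =
    w * rc ((q ^+ 2 - p ^+ 2) / 2) + w' * rc (q - p).
  move=> pq; rewrite cintD ?cintZ ?cint_id ?cint_cst //.
  - exact: ccont_rc.
  - by apply: ccontZ; exact: ccont_rc.
  - exact: ccont_cst.
rewrite /rect_int.
have E1 y : (fun x => id (pt x y)) = (fun x => 1 * rc x + ii * rc y).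
  by apply/funext => x; rewrite mul1r.
have E2 x : (fun y => id (pt x y)) = (fun y => ii * rc y + rc x).
  by apply/funext => y; rewrite addrC.
rewrite !E1 !E2 !H // !(rmorphB, rmorphM) /=; ring.
Qed.

Lemma rect_int_vsplit g a b c d m : a <= m <= b ->
  ccont (fun x => g (pt x c)) a b -> ccont (fun x => g (pt x d)) a b ->
  rect_int g a b c d = rect_int g a m c d + rect_int g m b c d.
Proof. by move=> H1 H2 H3; rewrite /rect_int !(cint_split H1) //; repeat move: (cint _ _ _) => ?; ring. Qed.

Lemma rect_int_hsplit g a b c d m : c <= m <= d ->
  ccont (fun y => g (pt a y)) c d -> ccont (fun y => g (pt b y)) c d ->
  rect_int g a b c d = rect_int g a b c m + rect_int g a b m d.
Proof. by move=> H1 H2 H3; rewrite /rect_int !(cint_split H1) //; repeat move: (cint _ _ _) => ?; ring. Qed.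

Lemma rect_int_bound g a b c d (M : R) : a <= b -> c <= d -> edge_cont g a b c d ->
  (forall x, a <= x <= b -> cabs (g (pt x c)) <= M /\ cabs (g (pt x d)) <= M) ->
  (forall y, c <= y <= d -> cabs (g (pt a y)) <= M /\ cabs (g (pt b y)) <= M) ->
  cabs (rect_int g a b c d) <= 4 * (M * ((b - a) + (d - c))).
Proof.
move=> ab cd [g1 g2 g3 g4] Hx Hy; rewrite /rect_int.
have h1 := @cint_bound _ _ a b M ab g1 (fun x hx => proj1 (Hx x hx)).
have h3 := @cint_bound _ _ a b M ab g3 (fun x hx => proj2 (Hx x hx)).
have h2 := @cint_bound _ _ c d M cd g2 (fun x hx => proj2 (Hy x hx)).
have h4 := @cint_bound _ _ c d M cd g4 (fun x hx => proj1 (Hy x hx)).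
apply: le_trans (cabsB _ _) _; rewrite cabsM cabs_ii mul1r.
apply: le_trans (lerD (cabsB _ _) (lexx _)) _.
apply: le_trans (lerD (lerD (cabsD _ _) (lexx _)) (lexx _)) _.
rewrite cabsM cabs_ii mul1r; move: h1 h2 h3 h4.
move: (cabs _) (cabs _) (cabs _) (cabs _) => u1 u2 u3 u4; clear; nra.
Qed.

Definition rdiff g a b c d := forall x y, a <= x <= b -> c <= y <= d -> cdiff g (pt x y).

Lemma rdiff_edge g a b c d : a <= b -> c <= d -> rdiff g a b c d -> edge_cont g a b c d.
Proof.
move=> ab cd H.
by split; (apply: ccont_hor || apply: ccont_ver) => x hx; apply: H; rewrite ?lexx ?ab ?cd.
Qed.

Lemma rdiff_sub g a b c d a' b' c' d' : a <= a' -> b' <= b -> c <= c' -> d' <= d ->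
  rdiff g a b c d -> rdiff g a' b' c' d'.
Proof.
move=> h1 h2 h3 h4 H x y /andP[x1 x2] /andP[y1 y2]; apply: H.
  by rewrite (le_trans h1) // (le_trans x2).
by rewrite (le_trans h3) // (le_trans y2).
Qed.

(** The integrals over the four quarters add up to the whole, the inner sides cancelling, so one of
    them has at least a quarter of the modulus. *)
Lemma rect_int_quarter g a b c d : a <= b -> c <= d -> rdiff g a b c d ->
  exists a' b' c' d', [/\ [/\ a <= a', a' <= b', b' <= b & b' - a' = (b - a) / 2],
    [/\ c <= c', c' <= d', d' <= d & d' - c' = (d - c) / 2] &
    cabs (rect_int g a b c d) <= 4 * cabs (rect_int g a' b' c' d')].
Proof.
move=> ab cd H.
pose m := (a + b) / 2; pose n := (c + d) / 2.
have am : a <= m by rewrite /m; lra.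
have mb : m <= b by rewrite /m; lra.
have cn : c <= n by rewrite /n; lra.
have nd : n <= d by rewrite /n; lra.
have Hs p q r s : a <= p -> p <= q -> q <= b -> c <= r -> r <= s -> s <= d ->
    edge_cont g p q r s.
  by move=> ? pq ? ? rs ?; apply: rdiff_edge => //; apply: rdiff_sub H.
have E : rect_int g a b c d = rect_int g a m c n + rect_int g a m n d
    + (rect_int g m b c n + rect_int g m b n d).
  have [e1 _ e3 _] := Hs a b c d (lexx _) ab (lexx _) (lexx _) cd (lexx _).
  rewrite (@rect_int_vsplit g a b c d m) ?am //.
  have [_ f2 _ f4] := Hs a m c d (lexx _) am mb (lexx _) cd (lexx _).
  have [_ f2' _ f4'] := Hs m b c d am mb (lexx _) (lexx _) cd (lexx _).
  by rewrite (@rect_int_hsplit g a m c d n) ?cn // (@rect_int_hsplit g m b c d n) ?cn.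
have mE : m - a = (b - a) / 2 by rewrite /m; lra.
have mE' : b - m = (b - a) / 2 by rewrite /m; lra.
have nE : n - c = (d - c) / 2 by rewrite /n; lra.
have nE' : d - n = (d - c) / 2 by rewrite /n; lra.
have B : cabs (rect_int g a b c d) <= cabs (rect_int g a m c n) + cabs (rect_int g a m n d)
    + (cabs (rect_int g m b c n) + cabs (rect_int g m b n d)).
  rewrite E; apply: le_trans (cabsD _ _) _.
  by apply: lerD; exact: cabsD.
case: (le_sum4 B) => h.
- by exists a, m, c, n; split.
- by exists a, m, n, d; split.
- by exists m, b, c, n; split.
- by exists m, b, n, d; split.
Qed.

(** The midpoints, with the half-lengths as errors, satisfy the hypothesis of [real_complete]. *)
Lemma nested_point (a b : nat -> R) : (forall n, a n <= b n) ->
  (forall n, a n <= a n.+1) -> (forall n, b n.+1 <= b n) ->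
  exists x, forall n, a n <= x <= b n.
Proof.
move=> ab a_ b_.
have am m n : (m <= n)%N -> a m <= a n by apply: (homo_leq (@lexx _ _) (@le_trans _ _)).
have bm m n : (m <= n)%N -> b n <= b m.
  by apply: (homo_leq (r := fun x y => y <= x)) => // x y z h1 h2; exact: le_trans h2 h1.
have abmn m n : a m <= b n.
  apply: le_trans (am _ _ (leq_maxl m n)) _; apply: le_trans (ab _) _.
  by apply: bm; exact: leq_maxr.
have [||l Hl] := @real_complete R nat (fun=> True) (fun n => (a n + b n) / 2)
  (fun n => (b n - a n) / 2).
- by exists 0%N.
- move=> m n _ _; have := abmn m n; have := abmn n m; have := ab m; have := ab n.
  rewrite ler_norml; move: (a m) (a n) (b m) (b n); clear => *; lra.
exists l => n; have := Hl n I; rewrite ler_norml.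
by move: (a n) (b n); clear => *; lra.
Qed.

Lemma goursat g a b c d : a <= b -> c <= d -> rdiff g a b c d -> rect_int g a b c d = 0.
Proof.
move=> ab cd H; apply/eqP; rewrite -cabs_eq0; apply/negP => /negP q0.
set q := cabs (rect_int g a b c d) in q0.
have {}q0 : 0 < q by rewrite lt_def q0 cabs_ge0.
(* A rectangle is the quadruple (a, b, c, d): [r.1.1.1] is a, [r.1.1.2] is b, [r.1.2] is c and [r.2]
   is d. *)
pose inv (r : R * R * R * R) := [/\ r.1.1.1 <= r.1.1.2, r.1.2 <= r.2 &
  rdiff g r.1.1.1 r.1.1.2 r.1.2 r.2].
pose rel (r r' : R * R * R * R) :=
  [/\ [/\ r.1.1.1 <= r'.1.1.1, r'.1.1.1 <= r'.1.1.2, r'.1.1.2 <= r.1.1.2 &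
        r'.1.1.2 - r'.1.1.1 = (r.1.1.2 - r.1.1.1) / 2],
    [/\ r.1.2 <= r'.1.2, r'.1.2 <= r'.2, r'.2 <= r.2 & r'.2 - r'.1.2 = (r.2 - r.1.2) / 2] &
    cabs (rect_int g r.1.1.1 r.1.1.2 r.1.2 r.2)
      <= 4 * cabs (rect_int g r'.1.1.1 r'.1.1.2 r'.1.2 r'.2)].
have [|f Hf] := @choice _ _ (fun r r' => inv r -> rel r r').
  move=> r.
  have [[h1 h2 h3]|h] := pselect (inv r); last by exists r.
  have [a' [b' [c' [d' K]]]] := rect_int_quarter h1 h2 h3.
  by exists (a', b', c', d').
pose r n := iter n f (a, b, c, d).
have inv_r n : inv (r n).
  elim: n => [|n IH]; first by split.
  have [[h1 h2 h3 h4] [k1 k2 k3 k4] _] := Hf _ IH; case: (IH) => _ _ h.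
  by split => //; apply: rdiff_sub h.
have rel_r n : rel (r n) (r n.+1) by exact: Hf.
have [||| x Hx] := @nested_point (fun n => (r n).1.1.1) (fun n => (r n).1.1.2).
- by move=> n; case: (inv_r n).
- by move=> n; case: (rel_r n) => -[].
- by move=> n; case: (rel_r n) => -[].
have [||| y Hy] := @nested_point (fun n => (r n).1.2) (fun n => (r n).2).
- by move=> n; case: (inv_r n).
- by move=> n; case: (rel_r n) => _ [].
- by move=> n; case: (rel_r n) => _ [].
pose D := (b - a) + (d - c).
have D0 : 0 <= D by rewrite /D addr_ge0 // subr_ge0.
have Dr n : ((r n).1.1.2 - (r n).1.1.1) + ((r n).2 - (r n).1.2) = D / 2 ^+ n.
  elim: n => [|n IH]; first by rewrite expr0 divr1.
  case: (rel_r n) => -[_ _ _ ->] [_ _ _ ->] _.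
  by rewrite -mulrDl IH exprS invfM [_^-1 * _^-1]mulrC mulrA.
have qr n : q <= 4 ^+ n * cabs (rect_int g (r n).1.1.1 (r n).1.1.2 (r n).1.2 (r n).2).
  elim: n => [|n IH]; first by rewrite mul1r.
  case: (rel_r n) => _ _ h; apply: le_trans IH _.
  by rewrite exprSr -mulrA ler_wpM2l // exprn_ge0.
have [l Hl] : cdiff g (pt x y) by apply: H; [exact: (Hx 0%N) | exact: (Hy 0%N)].
(* The factor D / 2^n occurs twice, once from the length of the contour and once from the distance
   to the limit point, and cancels the 4^n of the subdivision. What remains is q <= 4 D^2 e, which
   this choice of [e] contradicts. *)
pose e := q / (4 * D ^+ 2 + 1).
have p0 : 0 < 4 * D ^+ 2 + 1 by rewrite ltr_wpDl // mulr_ge0 // sqr_ge0.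
have e0 : 0 < e by rewrite divr_gt0.
have [dl dl0 Hdl] := Hl e e0.
have [n Hn] : exists n, D / 2 ^+ n < dl.
  have [n Hn] : exists n : nat, D / dl < n%:R.
    by exists (Num.truncn (D / dl)).+1; rewrite truncnS_gt.
  exists n; rewrite ltr_pdivrMr ?exprn_gt0 // -ltr_pdivrMl // mulrC.
  by apply: lt_trans Hn _; rewrite -natrX ltr_nat ltn_expl.
move: (qr n) (Dr n) (Hx n) (Hy n) (inv_r n) => {qr Dr Hx Hy}.
case: (r n) => [[[a' b'] c'] d'] /= Hq HD Hx Hy [/= ab' cd' Hr].
have Er := rdiff_edge ab' cd' Hr.
(* The affine approximation of g at the limit point. Its contour integral vanishes, so only the
   error g - A has to be estimated. *)
pose A z := g (pt x y) - l * pt x y + l * z.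
have EA : edge_cont A a' b' c' d'.
  by apply: edge_contD; [exact: edge_cont_cst | apply: edge_contZ; exact: edge_cont_id].
have QA : rect_int A a' b' c' d' = 0.
  rewrite rect_intD ?rect_intZ ?rect_int_cst ?rect_int_id ?mulr0 ?addr0 //;
    by [exact: edge_cont_id | exact: edge_cont_cst | apply: edge_contZ; exact: edge_cont_id].
have EN : edge_cont (fun z => -1 * A z) a' b' c' d' by exact: edge_contZ.
have QE : rect_int (fun z => g z + -1 * A z) a' b' c' d' = rect_int g a' b' c' d'.
  by rewrite rect_intD // rect_intZ // QA mulr0 addr0.
have Hb x' y' : a' <= x' <= b' -> c' <= y' <= d' ->
    cabs (g (pt x' y') + -1 * A (pt x' y')) <= e * (D / 2 ^+ n).
  move=> hx hy; have cz : cabs (pt x' y' - pt x y) <= D / 2 ^+ n.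
    apply: le_trans (cabs_pt_sub _ _ _ _) _; rewrite -HD; apply: lerD;
      by rewrite ler_norml; move: hx hy Hx Hy; clear; lra.
  have := Hdl _ (le_lt_trans cz Hn); rewrite [pt x y + _]addrC subrK.
  rewrite (_ : _ - _ - _ = g (pt x' y') + -1 * A (pt x' y')); last by rewrite /A; ring.
  by move=> h; apply: le_trans h _; rewrite ler_pM2l.
have : cabs (rect_int g a' b' c' d') <= 4 * (e * (D / 2 ^+ n) * (D / 2 ^+ n)).
  rewrite -QE -{2}HD; apply: rect_int_bound => //; first exact: edge_contD.
    by move=> x' hx; split; apply: Hb; rewrite // ?lexx ?cd'.
  by move=> y' hy; split; apply: Hb; rewrite // ?lexx ?ab'.
move=> hh; have : q <= 4 ^+ n * (4 * (e * (D / 2 ^+ n) * (D / 2 ^+ n))).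
  by apply: le_trans Hq _; rewrite ler_wpM2l // exprn_ge0.
have -> : 4 ^+ n * (4 * (e * (D / 2 ^+ n) * (D / 2 ^+ n))) = 4 * D ^+ 2 * e.
  have -> : (4 : R) ^+ n = 2 ^+ n * 2 ^+ n by rewrite -exprMn -natrM.
  have : (2 : R) ^+ n != 0 by rewrite expf_neq0.
  by move: (2 ^+ n) => t t0; field.
rewrite leNgt => /negP; apply.
rewrite /e mulrA ltr_pdivrMr // mulrC mulrDr mulr1 ltrDl //.
Qed.

End Goursat.

(** * Rules of calculus for complex derivatives *)

Section ComplexDifferentiability.
Variable R : realType.
Local Notation C := (CC R).
Implicit Types (g k : C -> C).

Lemma near_dnbhs0 (P : C -> Prop) : (\forall h \near (0 : C)^', P h) <->
  exists2 r : R, 0 < r & forall h, h != 0 -> cabs h < r -> P h.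
Proof.
rewrite /dnbhs near_withinE; split.
  move=> /nbhs_ballP[e /= /gt0_rc[r r0 ->] H]; exists r => // x x0 xr; apply: H => //.
  by rewrite -ball_normE /= sub0r normrN normE ltr_rc.
move=> [r r0 H]; apply/nbhs_ballP; exists (rc R r) => /=.
  by rewrite -(rmorph0 (rc R)) ltr_rc.
by move=> x; rewrite -ball_normE /= sub0r normrN normE ltr_rc => ? ?; exact: H.
Qed.

Lemma cdiffP g z : cdiff g z <-> derivable g z 1.
Proof.
split=> [[l H]|].
  apply/cvg_ex; exists l; apply/cvgrPdist_le => e /gt0_rc[r r0 ->].
  apply/near_dnbhs0; have [dl d0 Hd] := H r r0; exists dl => // h h0 hd.
  rewrite cabs_le /= /GRing.scale /= mulr1.
  have := Hd h hd; rewrite -ler_pdivrMr ?cabs_gt0 // => {}Hd.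
  apply: le_trans Hd; rewrite -cabsV -cabsM cabsBC le_eqVlt; apply/orP; left; apply/eqP.
  by congr cabs; rewrite [h + z]addrC; field.
move=> /cvg_ex[l /cvgrPdist_le H]; exists l => e e0.
have /H : 0 < rc R e by rewrite -(rmorph0 (rc R)) ltr_rc.
move=> /near_dnbhs0[r r0 Hr]; exists r => // h hr.
have [->|h0] := eqVneq h 0; first by rewrite addr0 subrr mulr0 subr0 cabs0 mulr0.
have := Hr h h0 hr; rewrite cabs_le /= /GRing.scale /= mulr1 => {}Hr.
rewrite -ler_pdivrMr ?cabs_gt0 //; apply: le_trans Hr.
rewrite -cabsV -cabsM cabsBC le_eqVlt; apply/orP; left; apply/eqP.
by congr cabs; rewrite [h + z]addrC; field.
Qed.

Lemma cdiff_cst (w z : C) : cdiff (fun=> w) z.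
Proof. by apply/cdiffP; exact: derivable_cst. Qed.

Lemma cdiff_id (z : C) : cdiff id z.
Proof. by apply/cdiffP; exact: derivable_id. Qed.

Lemma cdiffD g k z : cdiff g z -> cdiff k z -> cdiff (fun x => g x + k x) z.
Proof. by move=> /cdiffP ? /cdiffP ?; apply/cdiffP; exact: derivableD. Qed.

Lemma cdiffM g k z : cdiff g z -> cdiff k z -> cdiff (fun x => g x * k x) z.
Proof.
move=> /cdiffP H1 /cdiffP H2; apply/cdiffP.
have := @derivableM C C g k z 1 H1 H2; exact.
Qed.

Lemma cdiffB g k z : cdiff g z -> cdiff k z -> cdiff (fun x => g x - k x) z.
Proof. by move=> /cdiffP ? /cdiffP ?; apply/cdiffP; exact: derivableB. Qed.

Lemma cdiffV g z : g z != 0 -> cdiff g z -> cdiff (fun x => (g x)^-1) z.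
Proof. by move=> ? /cdiffP ?; apply/cdiffP; exact: derivableV. Qed.

Lemma cdiffX g n z : cdiff g z -> cdiff (fun x => g x ^+ n) z.
Proof.
move=> H; elim: n => [|n IH]; first exact: cdiff_cst.
by under eq_fun do rewrite exprS; exact: cdiffM.
Qed.

Lemma cdiff_sum (I : Type) (s : seq I) (P : pred I) (F : I -> C -> C) z :
  (forall i, P i -> cdiff (F i) z) -> cdiff (fun x => \sum_(i <- s | P i) F i x) z.
Proof.
move=> H; elim: s => [|i s IH].
  by under eq_fun do rewrite big_nil; exact: cdiff_cst.
under eq_fun do rewrite big_cons.
by case: (P i) (H i) => // Hi; apply: cdiffD => //; exact: Hi.
Qed.

End ComplexDifferentiability.

(** * Cauchy's formula on a square and Taylor expansion in one variable *)

Section CauchyTaylor.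
Variable R : realType.
Local Notation C := (CC R).
Local Notation rc := (rc R).
Local Notation ii := (ii R).
Implicit Types (g k : C -> C) (x y t : R).

Lemma pt_inj x y x' y' : pt x y = pt x' y' -> x = x' /\ y = y'.
Proof.
by move=> H; split; [have := congr1 (@cRe R) H | have := congr1 (@cIm R) H];
  rewrite /pt ?cRe_rc ?cIm_rc.
Qed.

(** Goursat's theorem on the rectangles to the left, to the right, below and above the small square;
    none of them contains the singular point (p, q). *)
Lemma rect_int_annulus k (p q e r : R) : 0 < e -> - r <= p - e -> p + e <= r ->
  - r <= q - e -> q + e <= r ->
  (forall x y, - r <= x <= r -> - r <= y <= r -> (x, y) != (p, q) -> cdiff k (pt x y)) ->
  rect_int k (- r) r (- r) r = rect_int k (p - e) (p + e) (q - e) (q + e).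
Proof.
move=> e0 h1 h2 h3 h4 H.
have pe : p - e <= p + e by lra.
have qe : q - e <= q + e by lra.
have rr : - r <= r by lra.
have K x y : - r <= x <= r -> - r <= y <= r -> x != p \/ y != q -> cdiff k (pt x y).
  by move=> hx hy h; apply: H => //; rewrite xpair_eqE negb_and; apply/orP.
have Hh y : - r <= y <= r -> y != q -> ccont (fun x => k (pt x y)) (- r) r.
  by move=> hy yq; apply: ccont_hor => x hx; apply: K => //; right.
have Hv x : - r <= x <= r -> x != p -> ccont (fun y => k (pt x y)) (- r) r.
  by move=> hy yq; apply: ccont_ver => y hx; apply: K => //; left.
have n1 : - r != q by apply/eqP; lra.
have n2 : r != q by apply/eqP; lra.
have n3 : p - e != p by apply/eqP; lra.
have n4 : p + e != p by apply/eqP; lra.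
have i1 : - r <= r <= r by lra.
have i2 : - r <= - r <= r by lra.
have i3 : - r <= p - e <= r by lra.
have i4 : - r <= p + e <= r by lra.
rewrite (@rect_int_vsplit R k _ _ _ _ (p - e)) //; try by apply: Hh.
rewrite goursat; [|lra|lra|]; last first.
  by move=> x y hx hy; apply: K; [lra | lra | left; apply/eqP; lra].
rewrite add0r (@rect_int_vsplit R k _ _ _ _ (p + e)) //; last first.
- by apply: ccont_sub (Hh r i1 n2) => //; lra.
- by apply: ccont_sub (Hh (- r) i2 n1) => //; lra.
- by rewrite pe.
rewrite addrC goursat; [|lra|lra|]; last first.
  by move=> x y hx hy; apply: K; [lra | lra | left; apply/eqP; lra].
rewrite add0r (@rect_int_hsplit R k _ _ _ _ (q - e)); last first.
- exact: Hv.
- exact: Hv.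
- by lra.
rewrite goursat; [|lra|lra|]; last first.
  by move=> x y hx hy; apply: K; [lra | lra | right; apply/eqP; lra].
rewrite add0r (@rect_int_hsplit R k _ _ _ _ (q + e)); last first.
- by apply: ccont_sub (Hv _ i4 n4) => //; lra.
- by apply: ccont_sub (Hv _ i3 n3) => //; lra.
- by lra.
rewrite addrC goursat ?add0r //; try lra.
by move=> x y hx hy; apply: K; [lra | lra | right; apply/eqP; lra].
Qed.

Lemma inv_pt x y : x ^+ 2 + y ^+ 2 != 0 -> (pt x y)^-1 = rc (x ^+ 2 + y ^+ 2)^-1 * pt x (- y).
Proof.
move=> h; have E : pt x y * pt x (- y) = rc (x ^+ 2 + y ^+ 2).
  rewrite /pt rmorphN rmorphD !rmorphXn /=; have := ii2 R; move: (rc x) (rc y) => u v i2.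
  have -> : (u + ii * v) * (u + ii * - v) = u ^+ 2 - ii * ii * v ^+ 2 by ring.
  by rewrite i2 mulN1r opprK.
have n : rc (x ^+ 2 + y ^+ 2) != 0 by rewrite fmorph_eq0.
have n1 : pt x y != 0 by apply: contra_neq n => h0; rewrite -E h0 mul0r.
by apply: (mulfI n1); rewrite mulrCA E fmorphV mulfV ?mulVf.
Qed.

(** This number is 2 pi i; only the lower bound of the next lemma is ever used. *)
Definition kappa : C := rect_int (fun z => z^-1) (-1) 1 (-1) 1.

(** Adding the four sides at the same parameter t gives the integrand 4 i / (1 + t^2), whose
    imaginary part is at least 2 on [-1, 1], an interval of length 2. *)
Lemma kappa_ge : 4 <= cabs kappa.
Proof.
have n1 : (-1 : R) <= 1 by lra.
have nz1 t s : s ^+ 2 = 1 -> t ^+ 2 + s ^+ 2 != 0.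
  by move=> ->; rewrite gt_eqF // ltr_wpDl // sqr_ge0.
have nz2 t s : s ^+ 2 = 1 -> s ^+ 2 + t ^+ 2 != 0 by rewrite addrC; exact: nz1.
have sN : (-1 : R) ^+ 2 = 1 by rewrite sqrrN expr1n.
have s1 : (1 : R) ^+ 2 = 1 by rewrite expr1n.
have nn0 x y : x ^+ 2 + y ^+ 2 != 0 -> pt x y != 0.
  apply: contra_neq => h; have [|-> ->] := @pt_inj x y 0 0; last by rewrite !expr0n addr0.
  by rewrite h /pt !rmorph0 mulr0 addr0.
have dV x y : x ^+ 2 + y ^+ 2 != 0 -> cdiff (fun z => z^-1) (pt x y).
  by move=> h; apply: cdiffV; [exact: nn0 | exact: cdiff_id].
have Hh s : s ^+ 2 = 1 -> ccont (fun x => (pt x s)^-1) (-1) 1.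
  by move=> hs; apply: ccont_hor => x _; apply: dV; exact: nz1.
have Hv s : s ^+ 2 = 1 -> ccont (fun y => (pt s y)^-1) (-1) 1.
  by move=> hs; apply: ccont_ver => x _; apply: dV; exact: nz2.
pose h t : C := ((pt t (-1))^-1 + ii * (pt 1 t)^-1) + (-1 * (pt t 1)^-1 + - ii * (pt (-1) t)^-1).
have c1 : ccont (fun t => (pt t (-1))^-1 + ii * (pt 1 t)^-1) (-1) 1.
  by apply: ccontD; [exact: Hh | apply: ccontZ; exact: Hv].
have c2 : ccont (fun t => -1 * (pt t 1)^-1 + - ii * (pt (-1) t)^-1) (-1) 1.
  by apply: ccontD; apply: ccontZ; [exact: Hh | exact: Hv].
have ch : ccont h (-1) 1 by exact: ccontD.
have hE t : h t = ii * rc (4 / (1 + t ^+ 2)).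
  have v1 s : s ^+ 2 = 1 -> (pt t s)^-1 = rc (1 + t ^+ 2)^-1 * pt t (- s).
    by move=> hs; rewrite inv_pt ?nz1 // hs [t ^+ 2 + 1]addrC.
  have v2 s : s ^+ 2 = 1 -> (pt s t)^-1 = rc (1 + t ^+ 2)^-1 * pt s (- t).
    by move=> hs; rewrite inv_pt ?nz2 // hs.
  rewrite /h !v1 ?v2 //.
  rewrite (rmorphM _ 4) /= /pt !rmorphN rmorph1 opprK rmorph_nat.
  move: (rc (1 + t ^+ 2)^-1) (rc t) => u v.
  have -> : u * (v + ii * 1) + ii * (u * (1 + ii * - v)) +
    (-1 * (u * (v + ii * -1)) + - ii * (u * (-1 + ii * - v))) = ii * (4 * u) + (ii * ii - ii * ii) * (u * v) by ring.
  by rewrite subrr mul0r addr0.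
have -> : kappa = cint h (-1) 1.
  rewrite /h (cintD c1 c2) (cintD (Hh _ sN) (ccontZ ii (Hv _ s1))).
  rewrite (cintD (ccontZ (-1) (Hh _ s1)) (ccontZ (- ii) (Hv _ sN))).
  rewrite (cintZ ii (Hv _ s1)) (cintZ (-1) (Hh _ s1)) (cintZ (- ii) (Hv _ sN)).
  by rewrite mulN1r mulNr addrA.
apply: le_trans (normr_cIm _); apply: le_trans (ler_norm _).
rewrite /cint cIm_rc.
have -> : (4 : R) = \int[@lebesgue_measure R]_(x in `[-1, 1]) (2 : R).
  by rewrite Rintegral_itv_cst //; lra.
apply: le_Rintegral => //.
- have := ccont_intRe (@ccont_cst R (rc 2) (-1) 1).
  by rewrite (_ : cRe (rc 2) = 2) //; have := cRe_rc (2 : R) 0; rewrite rmorph0 mulr0 addr0.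
- exact: ccont_intIm.
- move=> t ht; have {}ht : -1 <= (t : R) <= 1 by move: ht; rewrite /= in_itv.
  rewrite hE -[ii * _]add0r -(rmorph0 rc) cIm_rc.
  have t2 : t ^+ 2 <= 1 by rewrite -[1]mulr1 -expr2 -ler_sqrt ?ltr01 // sqrtr_sqr expr1n sqrtr1 ler_norml.
  rewrite ler_pdivlMr; [|by rewrite ltr_pwDl // sqr_ge0]; lra.
Qed.

(** Translation and scaling: dz / (z - w) is unchanged by both. *)
Lemma rect_int_inv (p q e : R) : 0 < e ->
  rect_int (fun z => (z - pt p q)^-1) (p - e) (p + e) (q - e) (q + e) = kappa.
Proof.
move=> e0; have e1 : rc e != 0 by rewrite fmorph_eq0 gt_eqF.
have A (h : R -> C) x : ccont h (x - e) (x + e) ->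
    cint h (x - e) (x + e) = rc e * cint (fun t => h (e * t + x)) (-1) 1.
  move=> H; have := @cint_affine R h e x (-1) 1 e0.
  rewrite mulrN mulr1 [- e + x]addrC [e + x]addrC; apply => //; lra.
have Pe x y x' y' : (x', y') != (p, q) -> cdiff (fun z => (z - pt p q)^-1) (pt x' y').
  move=> h; apply: cdiffV; last by apply: cdiffB; [exact: cdiff_id | exact: cdiff_cst].
  rewrite subr_eq0; apply: contra_neq h => h.
  by have [-> ->] := pt_inj h.
have D x y (k : C) : k != 0 -> pt x y - pt p q = rc e * k -> (pt x y - pt p q)^-1 = rc e^-1 * k^-1.
  by move=> k0 ->; rewrite invfM fmorphV.
have ee : rc e * rc e^-1 = 1 by rewrite -rmorphM mulfV ?gt_eqF // rmorph1.
have one t : t ^+ 2 + 1 != 0 by rewrite gt_eqF // ltr_wpDl // sqr_ge0.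
have n0 x y : x ^+ 2 + y ^+ 2 != 0 -> pt x y != 0.
  apply: contra_neq => h; have [|-> ->] := @pt_inj x y 0 0; last by rewrite !expr0n addr0.
  by rewrite h /pt !rmorph0 mulr0 addr0.
have F1 (s : R) : s ^+ 2 = 1 ->
    cint (fun x => (pt x (q + e * s) - pt p q)^-1) (p - e) (p + e) = cint (fun t => (pt t s)^-1) (-1) 1.
  move=> s2; rewrite A; last first.
    apply: (@ccont_hor R (fun z => (z - pt p q)^-1)) => x _; apply: Pe => //; rewrite xpair_eqE negb_and; apply/orP; right.
    rewrite -subr_eq0 addrC addKr mulf_eq0 gt_eqF //=.
    by apply: contra_eq_neq s2 => ->; rewrite expr0n eq_sym oner_eq0.
  have H t : (pt (e * t + p) (q + e * s) - pt p q)^-1 = rc e^-1 * (pt t s)^-1.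
    apply: D; first by apply: n0; rewrite s2.
    by rewrite /pt !(rmorphD, rmorphM) /=; ring.
  rewrite (@eq_cint _ _ _ _ _ (fun t _ => H t)) cintZ ?mulrA ?ee ?mul1r //.
  apply: (@ccont_hor R (fun z => z^-1)) => t _; apply: cdiffV; last exact: cdiff_id.
  by apply: n0; rewrite s2.
have F2 (s : R) : s ^+ 2 = 1 ->
    cint (fun y => (pt (p + e * s) y - pt p q)^-1) (q - e) (q + e) = cint (fun t => (pt s t)^-1) (-1) 1.
  move=> s2; rewrite A; last first.
    apply: (@ccont_ver R (fun z => (z - pt p q)^-1)) => x _; apply: Pe => //; rewrite xpair_eqE negb_and; apply/orP; left.
    rewrite -subr_eq0 addrC addKr mulf_eq0 gt_eqF //=.
    by apply: contra_eq_neq s2 => ->; rewrite expr0n eq_sym oner_eq0.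
  have H t : (pt (p + e * s) (e * t + q) - pt p q)^-1 = rc e^-1 * (pt s t)^-1.
    apply: D; first by apply: n0; rewrite s2 addrC.
    by rewrite /pt !(rmorphD, rmorphM) /=; ring.
  rewrite (@eq_cint _ _ _ _ _ (fun t _ => H t)) cintZ ?mulrA ?ee ?mul1r //.
  apply: (@ccont_ver R (fun z => z^-1)) => t _; apply: cdiffV; last exact: cdiff_id.
  by apply: n0; rewrite s2 addrC.
have s1 : (1 : R) ^+ 2 = 1 by rewrite expr1n.
have sN : (-1 : R) ^+ 2 = 1 by rewrite sqrrN expr1n.
have := F1 1 s1; have := F1 (-1) sN; have := F2 1 s1; have := F2 (-1) sN.
by rewrite !mulrN !mulr1 /kappa /rect_int => -> -> -> ->.
Qed.

(** The contour is shrunk to a small square around w. There g z / (z - w) splits into g w / (z - w),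
    which contributes g w times [kappa], and (g z - g w) / (z - w), whose integral is small because
    g is continuous at w. *)
Lemma cauchy_square g (p q r : R) : - r < p < r -> - r < q < r ->
  (forall x y, - r <= x <= r -> - r <= y <= r -> cdiff g (pt x y)) ->
  rect_int (fun z => g z * (z - pt p q)^-1) (- r) r (- r) r = g (pt p q) * kappa.
Proof.
move=> hp hq H; set w := pt p q.
have dI z : z != w -> cdiff (fun z => (z - w)^-1) z.
  move=> zw; apply: cdiffV; first by rewrite subr_eq0.
  by apply: cdiffB; [exact: cdiff_id | exact: cdiff_cst].
have ptw x y : (x, y) != (p, q) -> pt x y != w.
  by apply: contra_neq => h; have [-> ->] := pt_inj h.
apply/eqP; rewrite -subr_eq0 -cabs_eq0; apply/eqP/le_anti; rewrite cabs_ge0 andbT.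
apply/ler_addgt0Pr => e0 e00; rewrite add0r.
(* On the square of half-side s the second part is at most e / s, so its contour integral is at most
   4 (e / s) (4 s) = 16 e. *)
pose e := e0 / 16; have ep : 0 < e by rewrite divr_gt0.
have [dl d0 Hd] : exists2 dl : R, 0 < dl & forall z, cabs (z - w) < dl -> cabs (g z - g w) <= e.
  by apply: cdiff_cont => //; apply: H; lra.
(* The square must stay inside the large one, and dl / 4 keeps the sum of the two coordinate
   offsets, at most 2 s, below dl. *)
pose s := Num.min (Num.min (r - p) (p + r)) (Num.min (Num.min (r - q) (q + r)) (dl / 4)).
have s0 : 0 < s by rewrite !lt_min divr_gt0 //; lra.
have : s <= Num.min (Num.min (r - p) (p + r)) (Num.min (Num.min (r - q) (q + r)) (dl / 4)) by [].
rewrite !le_min => /andP[/andP[sp1 sp2] /andP[/andP[sq1 sq2] sd]].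
rewrite (@rect_int_annulus _ p q s); try lra; last first.
  move=> x y hx hy hxy; apply: cdiffM; first exact: H.
  by apply: dI; exact: ptw.
have Sx x y : p - s <= x <= p + s -> q - s <= y <= q + s -> cdiff g (pt x y).
  by move=> hx hy; apply: H; lra.
have edge (f : C -> C) : (forall x y, p - s <= x <= p + s -> q - s <= y <= q + s ->
    (x, y) != (p, q) -> cdiff f (pt x y)) -> edge_cont f (p - s) (p + s) (q - s) (q + s).
  by move=> K; split; (apply: ccont_hor || apply: ccont_ver) => t ht; apply: K;
    rewrite ?xpair_eqE ?negb_and //; try lra; apply/orP;
    (left; apply/eqP; lra) || (right; apply/eqP; lra).
pose k1 z := (g z - g w) * (z - w)^-1.
have dk1 x y : p - s <= x <= p + s -> q - s <= y <= q + s -> (x, y) != (p, q) -> cdiff k1 (pt x y).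
  move=> hx hy hxy; apply: cdiffM; last by apply: dI; exact: ptw.
  by apply: cdiffB; [exact: Sx | exact: cdiff_cst].
have E2 : edge_cont (fun z => (z - w)^-1) (p - s) (p + s) (q - s) (q + s).
  by apply: edge => x y _ _ hxy; apply: dI; exact: ptw.
have -> : (fun z => g z * (z - w)^-1) = (fun z => k1 z + g w * (z - w)^-1).
  by apply/funext => z; rewrite /k1; ring.
rewrite rect_intD; [|exact: edge dk1 | exact: edge_contZ].
rewrite rect_intZ // rect_int_inv // addrK.
have Hn x y : s <= `|x - p| \/ s <= `|y - q| -> s <= cabs (pt x y - w).
  have -> : pt x y - w = rc (x - p) + ii * rc (y - q) by rewrite /w /pt !rmorphB; ring.
  case=> h; apply: (le_trans h).
    by rewrite -[X in `|X|](cRe_rc _ (y - q)) normr_cRe.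
  by rewrite -[X in `|X|](cIm_rc (x - p)) normr_cIm.
have bnd x y : p - s <= x <= p + s -> q - s <= y <= q + s ->
    s <= `|x - p| \/ s <= `|y - q| -> cabs (k1 (pt x y)) <= e / s.
  move=> hx hy /Hn h; rewrite /k1 cabsM cabsV ler_pM ?cabs_ge0 ?invr_ge0 ?cabs_ge0 //.
    apply: Hd; apply: le_lt_trans (cabs_pt_sub _ _ _ _) _.
    have hx' : `|x - p| <= s by rewrite ler_norml; lra.
    have hy' : `|y - q| <= s by rewrite ler_norml; lra.
    lra.
  by rewrite lef_pV2 // posrE (lt_le_trans s0).
have aN : `|p - s - p| = s by rewrite addrC addKr normrN gtr0_norm.
have aP : `|p + s - p| = s by rewrite addrC addKr gtr0_norm.
have bN : `|q - s - q| = s by rewrite addrC addKr normrN gtr0_norm.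
have bP : `|q + s - q| = s by rewrite addrC addKr gtr0_norm.
have ps : p - s <= p + s by lra.
have qs : q - s <= q + s by lra.
apply: le_trans (@rect_int_bound R k1 _ _ _ _ (e / s) ps qs (edge _ dk1) _ _) _.
- by move=> x hx; split; apply: bnd; rewrite ?bN ?bP ?lexx ?qs //; right.
- by move=> y hy; split; apply: bnd; rewrite ?aN ?aP ?lexx ?ps //; left.
have -> : p + s - (p - s) + (q + s - (q - s)) = 4 * s by ring.
have -> : 4 * (e / s * (4 * s)) = 16 * e by field; rewrite gt_eqF.
by rewrite /e; lra.
Qed.

(** Finite geometric expansion of 1 / (z - w) in powers of w / z under Cauchy's formula on the
    square of half-side r. A function bounded by B has contour integral at most 16 B r; dividing by
    |kappa| >= 4 and using |z - w| >= r / 2 for |w| <= r / 2 gives the 8 of the remainder. The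
    coefficients would do with 4; one constant is kept for both. *)
Lemma cauchy_taylor g (r M : R) : 0 < r ->
  (forall z, cabs z < 4 * r -> cdiff g z /\ cabs (g z) <= M) ->
  exists c : nat -> C, (forall n, cabs (c n) <= 8 * M * r^-1 ^+ n) /\
    forall N z, cabs z <= r / 2 ->
      cabs (g z - \sum_(n < N) c n * z ^+ n) <= 8 * M * (r^-1 * cabs z) ^+ N.
Proof.
move=> r0 H.
have M0 : 0 <= M.
  by apply: le_trans (cabs_ge0 (g 0)) _; apply: (H 0 _).2; rewrite cabs0 mulr_gt0.
have rr : - r <= r by lra.
have k4 := kappa_ge.
have k0 : kappa != 0 by rewrite -cabs_gt0; lra.
have Hsq x y : - r <= x <= r -> - r <= y <= r -> cabs (pt x y) < 4 * r.
  move=> hx hy; have := cabs_pt_sub x y 0 0; rewrite !subr0.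
  rewrite (_ : pt 0 0 = 0) ?subr0 => [h|]; last by rewrite /pt !rmorph0 mulr0 addr0.
  apply: le_lt_trans h _; have hx' : `|x| <= r by rewrite ler_norml.
  have hy' : `|y| <= r by rewrite ler_norml.
  lra.
pose onS x y := [/\ - r <= x <= r, - r <= y <= r & r <= cabs (pt x y)].
have on1 x y : - r <= x <= r -> `|y| = r -> onS x y.
  move=> hx hy; split => //; first by rewrite -ler_norml hy.
  by rewrite -{1}hy -[X in `|X|](cIm_rc x) normr_cIm.
have on2 x y : - r <= y <= r -> `|x| = r -> onS x y.
  move=> hx hy; split => //; first by rewrite -ler_norml hy.
  by rewrite -{1}hy -[X in `|X|](cRe_rc _ y) normr_cRe.
have nr : `|r| = r by rewrite gtr0_norm.
have nNr : `|- r| = r by rewrite normrN.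
have edge (f : C -> C) : (forall x y, onS x y -> cdiff f (pt x y)) -> edge_cont f (- r) r (- r) r.
  by move=> K; split; (apply: ccont_hor || apply: ccont_ver) => t ht; apply: K;
    (by apply: on1) || (by apply: on2).
have bound (f : C -> C) (B : R) : (forall x y, onS x y -> cdiff f (pt x y)) ->
    (forall x y, onS x y -> cabs (f (pt x y)) <= B) ->
    cabs (rect_int f (- r) r (- r) r) <= 16 * (B * r).
  move=> K KB; apply: le_trans (@rect_int_bound R f _ _ _ _ B rr rr (edge _ K) _ _) _.
  - by move=> x hx; split; apply: KB; apply: on1.
  - by move=> x hx; split; apply: KB; apply: on2.
  - by rewrite le_eqVlt; apply/orP; left; apply/eqP; ring.
have onS0 x y : onS x y -> pt x y != 0.
  by case=> _ _ h; rewrite -cabs_gt0 (lt_le_trans r0).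
have onSg x y : onS x y -> cdiff g (pt x y).
  by case=> hx hy _; apply: (H _ (Hsq _ _ hx hy)).1.
have onSM x y : onS x y -> cabs (g (pt x y)) <= M.
  by case=> hx hy _; apply: (H _ (Hsq _ _ hx hy)).2.
have onSV x y : onS x y -> cdiff (fun z => z^-1) (pt x y).
  by move=> h; apply: cdiffV; [exact: onS0 | exact: cdiff_id].
pose q n z := g z * (z^-1) ^+ n.+1.
have dq n x y : onS x y -> cdiff (q n) (pt x y).
  by move=> h; apply: cdiffM; [exact: onSg | apply: cdiffX; exact: onSV].
have Vle x y : onS x y -> cabs ((pt x y)^-1) <= r^-1.
  by move=> h; case: (h) => _ _ hr; rewrite cabsV lef_pV2 // posrE ?cabs_gt0 ?onS0.
pose c n := kappa^-1 * rect_int (q n) (- r) r (- r) r.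
exists c; split.
  move=> n; rewrite /c cabsM cabsV ler_pdivrMl; last by lra.
  apply: le_trans (bound _ (M * r^-1 ^+ n.+1) (dq n) _) _.
    move=> x y h; rewrite /q cabsM cabsX ler_pM ?cabs_ge0 ?exprn_ge0 ?cabs_ge0 //; first exact: onSM.
    by rewrite lerXn2r ?nnegrE ?cabs_ge0 ?invr_ge0 ?(ltW r0) // Vle.
  have -> : 16 * (M * r^-1 ^+ n.+1 * r) = 2 * (8 * M * r^-1 ^+ n).
    by rewrite exprS; field; rewrite gt_eqF.
  apply: ler_wpM2r; last by lra.
  by rewrite !mulr_ge0 // exprn_ge0 // invr_ge0 ltW.
move=> N w hw.
have hwr : cabs w < r by lra.
have wR : - r < cRe w < r by rewrite -ltr_norml; apply: le_lt_trans hwr; exact: normr_cRe.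
have wI : - r < cIm w < r by rewrite -ltr_norml; apply: le_lt_trans hwr; exact: normr_cIm.
have := cauchy_square wR wI (fun x y hx hy => (H _ (Hsq _ _ hx hy)).1).
rewrite ptE => CF.
have onSw x y : onS x y -> pt x y - w != 0.
  case=> _ _ h; rewrite subr_eq0; apply/eqP => e; move: h; rewrite e; lra.
pose rem z := g z * (w * z^-1) ^+ N * (z - w)^-1.
have drem x y : onS x y -> cdiff rem (pt x y).
  move=> h; apply: cdiffM; last first.
    apply: cdiffV; first exact: onSw.
    by apply: cdiffB; [exact: cdiff_id | exact: cdiff_cst].
  apply: cdiffM; first exact: onSg.
  by apply: cdiffX; apply: cdiffM; [exact: cdiff_cst | exact: onSV].
have geo n z : z != 0 -> z - w != 0 -> g z * (z - w)^-1 =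
    \sum_(i < n) w ^+ i * q i z + g z * (w * z^-1) ^+ n * (z - w)^-1.
  move=> z0 zw; rewrite /q; elim: n => [|n IH]; first by rewrite big_ord0 add0r expr0 mulr1.
  rewrite IH big_ord_recr /= -addrA; congr (_ + _).
  rewrite !exprS !exprMn; move: (w ^+ n) (z^-1 ^+ n) => a b; field.
  by rewrite z0 zw.
have QE : rect_int (fun z => g z * (z - w)^-1) (- r) r (- r) r =
    rect_int (fun z => \sum_(n < N) w ^+ n * q n z + rem z) (- r) r (- r) r.
  congr (_ + _ * _ - _ - _ * _); apply: eq_cint => t ht;
    (apply: geo; [apply: onS0 | apply: onSw]); (by apply: on1) || (by apply: on2).
have edge_sum n : edge_cont (fun z => \sum_(i < n) w ^+ i * q i z) (- r) r (- r) r.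
  apply: edge => x y h; apply: cdiff_sum => i _; apply: cdiffM; first exact: cdiff_cst.
  exact: dq.
have QS : rect_int (fun z => \sum_(n < N) w ^+ n * q n z) (- r) r (- r) r =
    \sum_(n < N) w ^+ n * rect_int (q n) (- r) r (- r) r.
  elim: (N) => [|n IH].
    have -> : (fun z => \sum_(n < 0) w ^+ n * q n z) = (fun=> 0).
      by apply/funext => z; rewrite big_ord0.
    by rewrite big_ord0 rect_int_cst.
  have -> : (fun z => \sum_(i < n.+1) w ^+ i * q i z) =
      (fun z => \sum_(i < n) w ^+ i * q i z + w ^+ n * q n z).
    by apply/funext => z; rewrite big_ord_recr.
  have eq : edge_cont (q n) (- r) r (- r) r by apply: edge; exact: dq.
  rewrite (rect_intD (edge_sum n) (edge_contZ (w ^+ n) eq)) IH.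
  by rewrite (rect_intZ (w ^+ n) eq) big_ord_recr.
have E : g w - \sum_(n < N) c n * w ^+ n = kappa^-1 * rect_int rem (- r) r (- r) r.
  have -> : rect_int rem (- r) r (- r) r = g w * kappa - \sum_(n < N) w ^+ n * rect_int (q n) (- r) r (- r) r.
    by rewrite -CF QE rect_intD ?QS; [rewrite addrC addKr | exact: edge_sum | exact: edge].
  rewrite mulrBr mulrCA mulVf // mulr1 mulr_sumr; congr (_ - _).
  by apply: eq_bigr => i _; rewrite /c mulrCA mulrC mulrA.
rewrite E cabsM cabsV ler_pdivrMl; last by lra.
have B0 : 0 <= M * (r^-1 * cabs w) ^+ N.
  by rewrite mulr_ge0 // exprn_ge0 // mulr_ge0 ?cabs_ge0 // invr_ge0 ltW.
apply: le_trans (bound _ (M * (r^-1 * cabs w) ^+ N * (2 / r)) drem _) _.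
  move=> x y h; rewrite /rem !cabsM cabsX cabsV cabsM.
  apply: ler_pM; rewrite ?mulr_ge0 ?cabs_ge0 ?exprn_ge0 ?invr_ge0 ?mulr_ge0 ?cabs_ge0 //.
    apply: ler_pM; rewrite ?cabs_ge0 ?exprn_ge0 ?mulr_ge0 ?cabs_ge0 //; first exact: onSM.
    rewrite lerXn2r ?nnegrE ?mulr_ge0 ?cabs_ge0 ?invr_ge0 ?(ltW r0) //.
    by rewrite mulrC ler_wpM2r ?cabs_ge0 // Vle.
  have rw : r / 2 <= cabs (pt x y - w).
    by have := cabs_le_abs (pt x y) w; case: h => _ _ h1 h2; lra.
  rewrite -[2 / r]invrK invf_div lef_pV2 ?posrE //; last by rewrite divr_gt0.
  by apply: lt_le_trans rw; rewrite divr_gt0.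
have -> : 16 * (M * (r^-1 * cabs w) ^+ N * (2 / r) * r) = 32 * (M * (r^-1 * cabs w) ^+ N).
  by move: (_ ^+ N) => t; field; rewrite gt_eqF.
rewrite -[8 * M * _]mulrA; move: (M * _) B0 => t t0; nra.
Qed.

End CauchyTaylor.

(** * Separately holomorphic functions *)

Section SeparatelyHolomorphic.
Variable R : realType.
Local Notation C := (CC R).

Lemma cdiff_shift (g : C -> C) a z : cdiff g (a + z) -> cdiff (fun w => g (a + w)) z.
Proof.
move=> [l H]; exists l => e e0; have [dl d0 Hd] := H e e0.
by exists dl => // h hh; rewrite addrA; exact: Hd.
Qed.

Lemma cdiff_quadratic (g : C -> C) a (K r : R) l : 0 < r ->
  (forall h, 0 < cabs h < r -> cabs (g (a + h) - g a - l * h) <= K * cabs h ^+ 2) -> cdiff g a.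
Proof.
move=> r0 H; exists l => e e0.
have K0 : 0 < `|K| + 1 by rewrite ltr_wpDl.
exists (Num.min r (e / (`|K| + 1))); first by rewrite lt_min r0 divr_gt0.
move=> h; rewrite lt_min => /andP[hr he].
have [->|h0] := eqVneq h 0; first by rewrite addr0 subrr mulr0 subr0 cabs0 mulr0.
apply: le_trans (H h _) _; first by rewrite cabs_gt0 h0.
rewrite expr2 mulrA ler_wpM2r ?cabs_ge0 //.
apply: (@le_trans _ _ ((`|K| + 1) * cabs h)).
  by rewrite ler_wpM2r ?cabs_ge0 // (le_trans (ler_norm _)) // lerDl.
by rewrite mulrC -ler_pdivlMr // ltW.
Qed.

(* By the Taylor estimate the difference quotients of the
   approximants satisfy a uniform Cauchy condition, which passes to the limit. *)
Lemma cdiff_approx (g : C -> C) (rho M : R) :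
  (forall z, cabs z < rho -> cabs (g z) <= M) ->
  (forall e : R, 0 < e -> exists g' : C -> C, forall z, cabs z < rho ->
    cdiff g' z /\ cabs (g z - g' z) <= e) ->
  forall a, cabs a < rho -> cdiff g a.
Proof.
move=> HM H a ha; pose r := (rho - cabs a) / 4.
have r0 : 0 < r by rewrite divr_gt0 // subr_gt0.
have M0 : 0 <= M by apply: le_trans (cabs_ge0 _) (HM a ha).
have ar h : cabs h < 4 * r -> cabs (a + h) < rho.
  move=> hh; apply: le_lt_trans (cabsD _ _) _; move: hh; rewrite /r; lra.
pose K := 8 * (M + 1) * (r^-1) ^+ 2.
have K0 : 0 <= K by rewrite mulr_ge0 ?sqr_ge0 // mulr_ge0 // addr_ge0.
pose D h := (g (a + h) - g a) / h.
have DC h k : 0 < cabs h < r / 2 -> 0 < cabs k < r / 2 ->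
    cabs (D h - D k) <= K * cabs h + K * cabs k.
  move=> /andP[h0 hr] /andP[k0 kr]; apply/ler_addgt0Pr => e e0.
  (* Approximation within t costs 2 t / |h| + 2 t / |k| in the difference quotients, hence at most
     e; t <= 1 keeps the approximant bounded by M + 1. *)
  pose t := Num.min 1 (e / (2 * ((cabs h)^-1 + (cabs k)^-1))).
  have hk0 : 0 < (cabs h)^-1 + (cabs k)^-1 by rewrite addr_gt0 ?invr_gt0.
  have t0 : 0 < t by rewrite lt_min ltr01 divr_gt0 // mulr_gt0.
  have [g' Hg'] := H t t0.
  have [|c [_ Hc]] := @cauchy_taylor R (fun w => g' (a + w)) r (M + 1) r0.
    move=> z hz; have [h1 h2] := Hg' _ (ar z hz); split; first exact: cdiff_shift.
    have := cabs_le_abs (g' (a + z)) (g (a + z)); rewrite [cabs (_ - g (a + z))]cabsBC.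
    have : t <= 1 by rewrite /t ge_min lexx.
    have := HM _ (ar z hz); lra.
  have c0 : c 0%N = g' a.
    apply/eqP; rewrite eq_sym -subr_eq0 -cabs_eq0; apply/eqP/le_anti; rewrite cabs_ge0 andbT.
    have := Hc 1%N 0; rewrite cabs0 big_ord1 expr0 mulr1 addr0 mulr0 expr1 mulr0.
    by apply; rewrite divr_ge0 // ltW.
  have Q w : 0 < cabs w < r / 2 -> cabs (D w - c 1%N) <= K * cabs w + 2 * t / cabs w.
    move=> /andP[w0 wr].
    have wn : w != 0 by rewrite -cabs_gt0.
    have := Hc 2%N w (ltW wr); rewrite !big_ord_recr big_ord0 /= add0r expr0 mulr1 expr1 c0.
    rewrite exprMn mulrA -/K => Hq.
    have E : D w - c 1%N = (g' (a + w) - (g' a + c 1%N * w) + ((g (a + w) - g' (a + w)) - (g a - g' a))) / w.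
      by rewrite /D; field.
    rewrite E cabsM cabsV ler_pdivrMr // mulrDl divfK ?gt_eqF // -mulrA -expr2.
    apply: le_trans (cabsD _ _) _; apply: lerD => //.
    apply: le_trans (cabsB _ _) _; rewrite mulr_natl mulr2n; apply: lerD.
      by apply: (Hg' _ (ar w _)).2; lra.
    by have := (Hg' _ (ar 0 _)).2; rewrite addr0; apply; rewrite cabs0 mulr_gt0.
  have -> : D h - D k = (D h - c 1%N) - (D k - c 1%N) by ring.
  apply: le_trans (cabsB _ _) _.
  have := Q h; have := Q k; rewrite h0 hr k0 kr => /(_ isT) Qk /(_ isT) Qh.
  apply: (le_trans (lerD Qh Qk)).
  have T : 2 * t * ((cabs h)^-1 + (cabs k)^-1) <= e.
    rewrite [2 * t]mulrC -mulrA -ler_pdivlMr ?mulr_gt0 //.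
    by rewrite /t ge_min lexx orbT.
  by rewrite addrACA lerD2l -mulrDr.
have [||l Hl] := @complex_complete R C (fun h => 0 < cabs h < r / 2) D (fun h => K * cabs h).
- exists (rc R (r / 4)); rewrite cabs_rc gtr0_norm ?divr_gt0 //; lra.
- by move=> s t hs ht; exact: DC.
apply: (@cdiff_quadratic _ _ (2 * K) (r / 2) l); first by rewrite divr_gt0.
move=> h hh; have := Hl h hh; case/andP: hh => h0 _.
have hn : h != 0 by rewrite -cabs_gt0.
have -> : g (a + h) - g a - l * h = (D h - l) * h by rewrite /D; field.
rewrite cabsM => Hq; rewrite expr2 mulrA ler_wpM2r ?cabs_ge0 // -mulrA; exact: Hq.
Qed.

Variable d : nat.
Local Notation E := 'rV[C]_d.
Implicit Types (f : E -> C) (x : E) (i j : 'I_d).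

Definition upd x i (z : C) : E := \row_j (if j == i then z else x 0 j).

Lemma updE x i z j : upd x i z 0 j = if j == i then z else x 0 j.
Proof. by rewrite mxE. Qed.

Lemma upd_upd x i z w : upd (upd x i z) i w = upd x i w.
Proof. by apply/rowP => j; rewrite !updE; case: eqP. Qed.

Lemma updC x i j z w : i != j -> upd (upd x i z) j w = upd (upd x j w) i z.
Proof.
move=> ij; apply/rowP => k; rewrite !updE.
by case: (eqVneq k j) => // ->; rewrite eq_sym (negbTE ij).
Qed.

Lemma upd_id x i : upd x i (x 0 i) = x.
Proof. by apply/rowP => j; rewrite updE; case: eqP => // ->. Qed.

Lemma vabs_upd x i z (r : R) : vabs x < r -> cabs z < r -> vabs (upd x i z) < r.
Proof.
move=> xr zr; have r0 : 0 < r by apply: le_lt_trans xr; exact: vabs_ge0.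
apply: vabs_lt => // j; rewrite updE; case: eqP => // _.
exact: le_lt_trans (cabs_coord _ _) xr.
Qed.

(** Boundedness is part of the notion so that the one-variable Cauchy estimates are uniform in the
    remaining variables. *)
Definition sep (rho M : R) f := forall x, vabs x < rho ->
  cabs (f x) <= M /\ forall i, cdiff (fun z => f (upd x i z)) (x 0 i).

Definition indep f j := forall x z, f (upd x j z) = f x.

Lemma sep_line rho M f x i z : sep rho M f -> vabs x < rho -> cabs z < rho ->
  cdiff (fun z => f (upd x i z)) z /\ cabs (f (upd x i z)) <= M.
Proof.
move=> H hx hz; have [h1 h2] := H _ (vabs_upd i hx hz); split => //.
by have := h2 i; rewrite updE eqxx; under eq_fun do rewrite upd_upd.
Qed.

(* Taylor coefficients in one variable are again separately holomorphic, as uniform limits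
   of the difference quotients (f - sum_(k < n) c_k z^k) / z^n for z -> 0. *)
Lemma sep_coef i (r M : R) f : 0 < r -> sep (4 * r) M f ->
  exists c : nat -> E -> C, [/\ forall n, sep (4 * r) (8 * M * r^-1 ^+ n) (c n),
    forall n, indep (c n) i,
    forall N x, vabs x < 4 * r -> cabs (x 0 i) <= r / 2 ->
      cabs (f x - \sum_(n < N) c n x * x 0 i ^+ n) <= 8 * M * (r^-1 * cabs (x 0 i)) ^+ N &
    forall j, indep f j -> forall n, indep (c n) j].
Proof.
move=> r0 Hf.
have r40 : 0 < 4 * r by rewrite mulr_gt0.
have M0 : 0 <= M.
  by apply: le_trans (cabs_ge0 (f 0)) _; apply: (Hf 0 _).1; rewrite vabs0.
pose ok (g : C -> C) := forall z, cabs z < 4 * r -> cdiff g z /\ cabs (g z) <= M.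
(* The coefficients are chosen as a function of the one-variable slice alone. Equal slices then have
   equal coefficients, which gives both independence statements at once. *)
have [|T HT] := @choice (C -> C) (nat -> C) (fun g c => ok g ->
    (forall n, cabs (c n) <= 8 * M * r^-1 ^+ n) /\
    forall N z, cabs z <= r / 2 ->
      cabs (g z - \sum_(n < N) c n * z ^+ n) <= 8 * M * (r^-1 * cabs z) ^+ N).
  move=> g; have [h|h] := pselect (ok g); last by exists (fun=> 0).
  by have [c Hc] := cauchy_taylor r0 h; exists c.
pose c n x := T (fun z => f (upd x i z)) n.
have okx x : vabs x < 4 * r -> ok (fun z => f (upd x i z)).
  by move=> hx z hz; exact: sep_line Hf _ _.
have ci n : indep (c n) i.
  by move=> x z; rewrite /c; congr (T _ n); apply/funext => w; rewrite upd_upd.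
have cT N x z : vabs x < 4 * r -> cabs z <= r / 2 ->
   cabs (f (upd x i z) - \sum_(n < N) c n x * z ^+ n) <= 8 * M * (r^-1 * cabs z) ^+ N.
  by move=> hx hz; apply: (HT _ (okx x hx)).2.
exists c; split => //.
- elim/ltn_ind => n IH x hx; split; first exact: (HT _ (okx x hx)).1.
  move=> j; have [->|ji] := eqVneq j i.
    have -> : (fun z => c n (upd x i z)) = (fun=> c n x) by apply/funext => z; rewrite ci.
    exact: cdiff_cst.
  have hxj w : cabs w < 4 * r -> vabs (upd x j w) < 4 * r by exact: vabs_upd.
  apply: (@cdiff_approx _ (4 * r) (8 * M * r^-1 ^+ n)).
  + by move=> w hw; apply: (HT _ (okx _ (hxj w hw))).1.
  (* At the point z0 = t the Taylor remainder of order n + 1, divided by z0^n, is at most K t <= e;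
     the summand 1 makes K positive. *)
  + move=> e e0; pose K := 8 * M * r^-1 ^+ n.+1 + 1.
    have K0 : 0 < K by rewrite ltr_wpDl // mulr_ge0 ?exprn_ge0 ?invr_ge0 ?mulr_ge0 // ltW.
    pose t := Num.min (r / 2) (e / K).
    have t0 : 0 < t by rewrite lt_min !divr_gt0.
    have tr : t <= r / 2 by rewrite /t ge_min lexx.
    pose z0 := rc R t.
    have z0t : cabs z0 = t by rewrite cabs_rc gtr0_norm.
    have z0n : z0 != 0 by rewrite -cabs_gt0 z0t.
    exists (fun w => (f (upd (upd x j w) i z0) - \sum_(k < n) c k (upd x j w) * z0 ^+ k) * (z0 ^+ n)^-1).
    move=> w hw; split.
      apply: cdiffM; last exact: cdiff_cst.
      apply: cdiffB.
        under eq_fun do rewrite updC //.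
        apply: (sep_line j Hf _ hw).1; apply: vabs_upd => //; rewrite z0t; lra.
      apply: cdiff_sum => k _; apply: cdiffM; last exact: cdiff_cst.
      by apply: (sep_line j (IH k _) _ hw).1.
    have := cT n.+1 _ z0 (hxj w hw); rewrite z0t => /(_ tr).
    rewrite big_ord_recr /=; set S := \sum_(k < n) _ => Hq.
    have -> : c n (upd x j w) - (f (upd (upd x j w) i z0) - S) * (z0 ^+ n)^-1 =
        - ((f (upd (upd x j w) i z0) - (S + c n (upd x j w) * z0 ^+ n)) * (z0 ^+ n)^-1).
      by field; rewrite expf_neq0.
    rewrite cabsN cabsM cabsV cabsX z0t ler_pdivrMr ?exprn_gt0 //.
    apply: le_trans Hq _; rewrite exprMn exprS [t ^+ n.+1]exprS mulrA [t * _]mulrC.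
    rewrite [e * _]mulrC !mulrA [_ * t ^+ n]mulrC -!mulrA ler_wpM2l ?exprn_ge0 // ?(ltW t0) //.
    apply: (@le_trans _ _ (K * t)).
      rewrite !mulrA ler_wpM2r ?(ltW t0) // /K exprS mulrA lerDl //.
    by rewrite mulrC -ler_pdivlMr // /t ge_min lexx orbT.
  + by apply: le_lt_trans (cabs_coord _ _) hx.
- by move=> N x hx hxi; have := cT N x (x 0 i) hx hxi; rewrite upd_id.
- move=> j fj n x z; have [<-|ij] := eqVneq i j; first exact: ci.
  rewrite /c; congr (T _ n); apply/funext => w.
  by rewrite updC 1?eq_sym // fj.
Qed.


Local Notation mpol := (mpoly.mpoly d C).

Lemma mcoeffMX_le (P : mpol) (m0 m : mpoly.multinom d) :
  mpoly.mcoeff m (P * mpoly.mpolyX C m0) =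
  if mpoly.lem m0 m then mpoly.mcoeff (mpoly.mnm_sub m m0) P else 0.
Proof.
case: ifP => [h|h].
  have := mcoeffMX P m0 (mpoly.mnm_sub m m0).
  by rewrite addmC submK.
rewrite mcoeffM big1 // => k /eqP mE; rewrite mcoeffX.
have [e|_] := eqVneq m0 k.2; last by rewrite mulr0.
case/negP: (negbT h); apply/mnm_lepP => i.
by rewrite [in leqRHS]mE e mnmDE leq_addl.
Qed.

Lemma mpoly_funD (P Q : mpol) : mpoly_fun (P + Q) = (fun x => mpoly_fun P x + mpoly_fun Q x).
Proof. by apply/funext => x; rewrite /mpoly_fun mevalD. Qed.

Lemma mpoly_funB (P Q : mpol) x : mpoly_fun (P - Q) x = mpoly_fun P x - mpoly_fun Q x.
Proof. by rewrite /mpoly_fun mevalB. Qed.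

Lemma mpoly_funM (P Q : mpol) x : mpoly_fun (P * Q) x = mpoly_fun P x * mpoly_fun Q x.
Proof. by rewrite /mpoly_fun mevalM. Qed.

Lemma mpoly_fun_sum (I : Type) (s : seq I) (P : pred I) (F : I -> mpol) x :
  mpoly_fun (\sum_(i <- s | P i) F i) x = \sum_(i <- s | P i) mpoly_fun (F i) x.
Proof. by rewrite /mpoly_fun raddf_sum. Qed.

Lemma mpoly_funX m x : mpoly_fun (mpoly.mpolyX C m) x = \prod_(i < d) x 0 i ^+ (m i).
Proof. by rewrite /mpoly_fun mevalX. Qed.

Lemma mpoly_funC (c : C) x : mpoly_fun (mpoly.mpolyC d c) x = c.
Proof. by rewrite /mpoly_fun mevalC. Qed.

Lemma indep_all f : (forall j, indep f j) -> forall x, f x = f 0.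
Proof.
move=> H x; pose y (s : seq 'I_d) : E := \row_j (if j \in s then 0 else x 0 j).
have Hy s : f (y s) = f x.
  elim: s => [|i s IH].
    by congr f; apply/rowP => j; rewrite mxE.
  rewrite -IH -(H i (y s) 0); congr f; apply/rowP => j; rewrite updE !mxE in_cons.
  by case: eqP.
rewrite -(Hy (enum 'I_d)); congr f; apply/rowP => j.
by rewrite !mxE mem_enum.
Qed.

Lemma expn2_ge n : n.+1%:R <= 2 ^+ n :> R.
Proof. by rewrite -natrX ler_nat ltn_expl. Qed.

(** Induction on the list of the variables on which f depends: f is expanded in one of them, and the
    coefficient of order n is expanded in the others up to degree N - n. A monomial of degree k
    receives at most k + 1 <= 2^k contributions, which is absorbed by doubling B. It is essential
    that K and B depend neither on f nor on M and N. *)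
Lemma sep_taylor_seq (r : R) (s : seq 'I_d) : 0 < r ->
  exists K B : R, [/\ 1 <= K, 2 / r <= B & forall f M N, sep (4 * r) M f ->
  (forall j, j \notin s -> indep f j) ->
  exists P : mpol, [/\ forall m, (N <= mpoly.mdeg m)%N -> mpoly.mcoeff m P = 0,
    forall m, cabs (mpoly.mcoeff m P) <= K * M * B ^+ mpoly.mdeg m &
    forall x, B * vabs x <= 1 -> cabs (f x - mpoly_fun P x) <= K * M * (B * vabs x) ^+ N]].
Proof.
move=> r0; elim: s => [|i s [K [B [K1 Br IH]]]].
  exists 1, (2 / r); split => // f M N Hf Hi.
  have M0 : cabs (f 0) <= M by apply: (Hf 0 _).1; rewrite vabs0 mulr_gt0.
  have MM : 0 <= M by apply: le_trans M0; exact: cabs_ge0.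
  have r2 : 0 <= 2 / r by rewrite divr_ge0 // ltW.
  have fc := indep_all (fun j => Hi j isT).
  case: N => [|N].
    exists 0; split => [m _|m|x _]; rewrite ?mcoeff0 ?cabs0 //.
      by rewrite mul1r mulr_ge0 // exprn_ge0.
    by rewrite mul1r expr0 mulr1 /mpoly_fun meval0 subr0 fc.
  exists (mpoly.mpolyC d (f 0)); split => [m hm|m|x _].
  - rewrite mcoeffC; case: eqP hm => [->|_ _]; last by rewrite mulr0.
    by rewrite mdeg0.
  - rewrite mcoeffC; case: eqP => [->|_]; last by rewrite mulr0 cabs0 mul1r mulr_ge0 // exprn_ge0.
    by rewrite mdeg0 mulr1 mul1r mulr1.
  - rewrite mpoly_funC fc subrr cabs0 mul1r mulr_ge0 // exprn_ge0 // mulr_ge0 //; exact: vabs_ge0.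
have B0 : 0 < B by apply: lt_le_trans Br; rewrite divr_gt0.
have K0 : 0 <= K by rewrite (le_trans ler01).
have rB : r^-1 <= B by apply: le_trans Br; rewrite ler_peMl ?invr_ge0 ?(ltW r0) // ler1n.
have K'1 : 1 <= 8 * (K + 1) by lra.
have B'r : 2 / r <= 2 * B by apply: (le_trans Br); rewrite ler_peMl ?(ltW B0) // ler1n.
exists (8 * (K + 1)), (2 * B); split => // {K'1 B'r}.
move=> f M N Hf Hi.
have MM : 0 <= M.
  by apply: le_trans (cabs_ge0 (f 0)) _; apply: (Hf 0 _).1; rewrite vabs0 mulr_gt0.
have [c [csep ci ct cj]] := sep_coef i r0 Hf.
have [|P HP] := @choice nat mpol (fun n P => [/\
    forall m, (N - n <= mpoly.mdeg m)%N -> mpoly.mcoeff m P = 0,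
    forall m, cabs (mpoly.mcoeff m P) <= K * (8 * M * r^-1 ^+ n) * B ^+ mpoly.mdeg m &
    forall x, B * vabs x <= 1 ->
      cabs (c n x - mpoly_fun P x) <= K * (8 * M * r^-1 ^+ n) * (B * vabs x) ^+ (N - n)]).
  move=> n; apply: IH; first exact: csep.
  move=> j js; have [->|ji] := eqVneq j i; first exact: ci.
  by apply: cj; apply: Hi; rewrite in_cons negb_or ji.
pose mi n := mpoly.mnm_muln (mpoly.mnm1 i) n.
have miE n j : (mi n) j = if j == i then n else 0%N.
  by rewrite /mi mulmnE mnm1E eq_sym; case: eqP => _; rewrite ?mul1n ?mul0n.
have mideg n : mpoly.mdeg (mi n) = n by rewrite /mi mdegMn mdeg1 mul1n.
have lemi n m : mpoly.lem (mi n) m = (n <= m i)%N.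
  apply/mnm_lepP/idP => [/(_ i)|h j]; rewrite miE ?eqxx //.
  by case: eqP => // ->.
exists (\sum_(n < N) P n * mpoly.mpolyX C (mi n)); split.
- move=> m hm; rewrite raddf_sum big1 // => n _ /=.
  rewrite mcoeffMX_le lemi; case: ifP => // nm.
  have [h _ _] := HP n; apply: h.
  have := submK (m := mi n) (m' := m); rewrite lemi => /(_ nm) e.
  by move: hm; rewrite -{1}e mdegD mideg; lia.
- move=> m; rewrite raddf_sum /=.
  apply: le_trans (cabs_sum _ _ _) _.
  apply: (@le_trans _ _ (\sum_(n < N | (n < (mpoly.mdeg m).+1)%N) 8 * K * M * B ^+ mpoly.mdeg m)).
    rewrite [leRHS]big_mkcond /=; apply: ler_sum => n _.
    rewrite mcoeffMX_le lemi; case: ifP => nm; last first.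
      by rewrite cabs0; case: ifP => // _; rewrite !mulr_ge0 // exprn_ge0 // ltW.
    have e := submK (m := mi n) (m' := m); rewrite lemi in e; have {}e := e nm.
    have dm : (mpoly.mdeg m = mpoly.mdeg (mpoly.mnm_sub m (mi n)) + n)%N by rewrite -{1}e mdegD mideg.
    rewrite dm ltnS leq_addl; have [_ h _] := HP n.
    apply: le_trans (h _) _; rewrite exprD; set b := B ^+ _.
    have -> : K * (8 * M * r^-1 ^+ n) * b = 8 * K * M * (b * r^-1 ^+ n) by ring.
    apply: ler_wpM2l; first by rewrite !mulr_ge0.
    apply: ler_wpM2l; first by rewrite exprn_ge0 // ltW.
    by rewrite lerXn2r // nnegrE ?invr_ge0 ltW.
  rewrite sumr_const -[_ *+ _]mulr_natr.
  have le1 : #|[pred n : 'I_N | (n < (mpoly.mdeg m).+1)%N]|%:R <= 2 ^+ mpoly.mdeg m :> R.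
    apply: le_trans (expn2_ge _); rewrite ler_nat.
    set A := [pred n : 'I_N | _]; set D := mpoly.mdeg m in A *.
    have inj : {in A &, injective (fun n : 'I_N => inord n : 'I_D.+1)}.
      move=> n n'; rewrite !inE => hn hn' /(congr1 val) /=; rewrite !inordK //.
      exact: val_inj.
    by rewrite -(card_in_imset inj) -[leqRHS](card_ord D.+1) max_card.
  move: le1; set t := (_%:R) => le1.
  rewrite exprMn; move: (2 ^+ _) le1 (exprn_ge0 (mpoly.mdeg m) (ltW B0)) => q le1.
  move: (B ^+ _) => y y0.
  have My : 0 <= M * y by rewrite mulr_ge0.
  have KMy : 0 <= K * (M * y) by rewrite mulr_ge0.
  have -> : 8 * K * M * y * t = 8 * (t * (K * (M * y))) by ring.
  have -> : 8 * (K + 1) * M * (q * y) = 8 * (q * (K * (M * y)) + q * (M * y)) by ring.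
  rewrite ler_pM2l // -[leLHS]addr0 lerD //; first by rewrite ler_wpM2r.
  by rewrite mulr_ge0 // (le_trans _ le1).
- move=> x hx.
  have hx1 : B * vabs x <= 1.
    by apply: le_trans hx; rewrite -mulrA ler_peMl ?ler1n // mulr_ge0 ?vabs_ge0 // ltW.
  have Bx0 : 0 <= B * vabs x by rewrite mulr_ge0 ?vabs_ge0 // ltW.
  have xr : vabs x <= r / 2.
    rewrite -[r / 2]invrK invf_div -[_^-1]mul1r ler_pdivlMr ?divr_gt0 // mulrC.
    by apply: le_trans hx1; rewrite ler_wpM2r ?vabs_ge0.
  have xi := cabs_coord x i.
  have cx : cabs (f x - \sum_(n < N) c n x * x 0 i ^+ n) <= 8 * M * (B * vabs x) ^+ N.
    apply: le_trans (ct N x _ _) _; [by lra | by lra |].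
    rewrite ler_wpM2l ?mulr_ge0 // lerXn2r ?nnegrE ?mulr_ge0 ?cabs_ge0 ?invr_ge0 ?vabs_ge0 //;
      rewrite ?(ltW r0) ?(ltW B0) //.
    by apply: ler_pM; rewrite ?cabs_ge0 ?invr_ge0 ?(ltW r0).
  have -> : f x - mpoly_fun (\sum_(n < N) P n * mpoly.mpolyX C (mi n)) x =
      (f x - \sum_(n < N) c n x * x 0 i ^+ n) + \sum_(n < N) (c n x - mpoly_fun (P n) x) * x 0 i ^+ n.
    have -> : \sum_(n < N) (c n x - mpoly_fun (P n) x) * x 0 i ^+ n =
        \sum_(n < N) c n x * x 0 i ^+ n - mpoly_fun (\sum_(n < N) P n * mpoly.mpolyX C (mi n)) x.
      rewrite mpoly_fun_sum -sumrB; apply: eq_bigr => n _.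
      rewrite mpoly_funM mpoly_funX mulrBl; congr (_ - _ * _).
      rewrite (bigD1 i) //= miE eqxx big1 ?mulr1 // => j ji.
      by rewrite miE (negbTE ji) expr0.
    by rewrite addrA subrK.
  apply: le_trans (cabsD _ _) _.
  have S : cabs (\sum_(n < N) (c n x - mpoly_fun (P n) x) * x 0 i ^+ n) <= N%:R * (8 * K * M * (B * vabs x) ^+ N).
    apply: le_trans (cabs_sum _ _ _) _.
    apply: (@le_trans _ _ (\sum_(n < N) 8 * K * M * (B * vabs x) ^+ N)); last first.
      by rewrite sumr_const card_ord -[leLHS]mulr_natl.
    apply: ler_sum => n _; rewrite cabsM cabsX; have [_ _ h] := HP n.
    apply: (@le_trans _ _ (K * (8 * M * r^-1 ^+ n) * (B * vabs x) ^+ (N - n) * vabs x ^+ n)).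
      by apply: ler_pM; rewrite ?cabs_ge0 ?exprn_ge0 ?cabs_ge0 ?h // lerXn2r ?nnegrE ?cabs_ge0 ?vabs_ge0.
    have -> : (B * vabs x) ^+ N = (B * vabs x) ^+ (N - n) * (B ^+ n * vabs x ^+ n).
      by rewrite -exprMn -exprD subnK // ltnW.
    have -> : K * (8 * M * r^-1 ^+ n) * (B * vabs x) ^+ (N - n) * vabs x ^+ n =
      8 * K * M * ((B * vabs x) ^+ (N - n) * (r^-1 ^+ n * vabs x ^+ n)) by ring.
    rewrite ler_wpM2l ?mulr_ge0 // ler_wpM2l ?exprn_ge0 // ler_wpM2r ?exprn_ge0 ?vabs_ge0 //.
    by rewrite lerXn2r // nnegrE ?invr_ge0 ltW.
  apply: le_trans (lerD cx S) _.
  have -> : 2 * B * vabs x = 2 * (B * vabs x) by rewrite mulrA.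
  rewrite [(2 * (B * vabs x)) ^+ N]exprMn; move: (expn2_ge N) (exprn_ge0 N Bx0).
  move: ((B * vabs x) ^+ N) (2 ^+ N) => y t; rewrite -natr1 => ht hy.
  have n0 : 0 <= N%:R :> R by [].
  have My : 0 <= M * y by rewrite mulr_ge0.
  have KMy : 0 <= K * (M * y) by rewrite mulr_ge0.
  have -> : 8 * M * y + N%:R * (8 * K * M * y) = 8 * (M * y + N%:R * (K * (M * y))) by ring.
  have -> : 8 * (K + 1) * M * (t * y) = 8 * (t * (M * y) + t * (K * (M * y))) by ring.
  have t1 : 1 <= t by apply: le_trans ht; rewrite lerDr.
  have tN : N%:R <= t by apply: le_trans ht; rewrite lerDl.
  rewrite ler_pM2l //; apply: lerD; last by rewrite ler_wpM2r.
  by rewrite -[leLHS]mul1r ler_wpM2r.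
Qed.

End SeparatelyHolomorphic.

(** * Separate holomorphy and Frechet differentiability *)

Section Frechet.
Variables (R : realType) (d : nat).
Local Notation C := (CC R).
Local Notation E := 'rV[C]_d.
Local Notation mpol := (mpoly.mpoly d C).
Implicit Types (f g : E -> C) (x a : E).

Lemma sep_taylor (r : R) : 0 < r ->
  exists K B : R, [/\ 1 <= K, 0 < B & forall f M N, sep (4 * r) M f ->
  exists P : mpol, [/\ forall m, (N <= mpoly.mdeg m)%N -> mpoly.mcoeff m P = 0,
    forall m, cabs (mpoly.mcoeff m P) <= K * M * B ^+ mpoly.mdeg m &
    forall x, B * vabs x <= 1 -> cabs (f x - mpoly_fun P x) <= K * M * (B * vabs x) ^+ N]].
Proof.
move=> r0; have [K [B [K1 Br H]]] := sep_taylor_seq (enum 'I_d) r0.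
exists K, B; split => // [|f M N Hf]; first by apply: lt_le_trans Br; rewrite divr_gt0.
by apply: H => // j; rewrite mem_enum.
Qed.

Lemma differentiable_quadratic g (K r : R) : 0 < r ->
  (forall x, vabs x < r -> cabs (g x) <= K * vabs x ^+ 2) -> differentiable g (0 : E).
Proof.
move=> r0 H.
have g0 : g 0 = 0.
  apply/eqP; rewrite -cabs_eq0; apply/eqP/le_anti; rewrite cabs_ge0 andbT.
  by have := H 0; rewrite vabs0 expr0n /= mulr0; apply.
have E0 : g \o shift 0 = cst (g 0) + (GRing.null_fun C : E -> C) +o_ (0 : E) id.
  apply/eqaddoP => _ /= /posnumP[e0].
  have [e e1 ee] := gt0_rc (gt0 e0); rewrite ee.
  have K1 : 0 < `|K| + 1 by rewrite ltr_wpDl.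
  apply/near0P; exists (Num.min r (e / (`|K| + 1))); first by rewrite lt_min r0 divr_gt0.
  move=> x; rewrite lt_min => /andP[xr xe] /=.
  have -> : (g \o shift 0 - (cst (g 0) + GRing.null_fun C)) x = g x.
    by rewrite -[LHS]/(g (x + 0) - (g 0 + 0)) g0 !addr0 subr0.
  rewrite vnormE normE -[_%:C%C]/(rc R e) -rmorphM ler_rc.
  apply: le_trans (H _ xr) _; rewrite expr2 mulrA ler_wpM2r ?vabs_ge0 //.
  apply: (@le_trans _ _ ((`|K| + 1) * vabs x)).
    by rewrite ler_wpM2r ?vabs_ge0 // (le_trans (ler_norm _)) // lerDl.
  by rewrite mulrC -ler_pdivlMr // ltW.
have dE : 'd g (0 : E) = GRing.null_fun C :> (E -> C).
  by apply: diff_unique E0 => x; exact: cst_continuous.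
apply/diff_locallyP; rewrite dE; split => //.
by move=> x; exact: cst_continuous.
Qed.

Lemma diff_id_holo a : differentiable (fun x : E => x) a.
Proof. exact: (@ex_diff _ _ _ _ _ _ _ (is_diff_id a)). Qed.

Lemma differentiable_shift (W : normedModType C) (f : E -> W) a :
  differentiable (fun x => f (a + x)) (0 : E) -> differentiable f a.
Proof.
move=> H; have -> : f = (fun x => f (a + x)) \o (fun x => x - a).
  by apply/funext => x /=; rewrite addrC subrK.
have H1 : differentiable (fun x : E => x - a) a.
  exact: (differentiableB (diff_id_holo a) (differentiable_cst a a)).
have H2 : differentiable (fun x : E => f (a + x)) (a - a).
  rewrite subrr; exact H.
exact: (differentiable_comp H1 H2).
Qed.

Lemma mpoly_fun_diff (P : mpol) : differentiable (mpoly_fun P) (0 : E).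
Proof. by have /holo_predP/nbhs_singleton := mpoly_holo P. Qed.

(** Osgood's lemma. The Taylor polynomial of degree at most 1 at a leaves an error O(|x - a|^2),
    which is differentiable at a with zero differential. *)
Lemma sep_differentiable (rho M : R) f a : sep rho M f -> vabs a < rho -> differentiable f a.
Proof.
move=> Hf ha; pose r := (rho - vabs a) / 4.
have r0 : 0 < r by rewrite divr_gt0 // subr_gt0.
have [K [B [K1 B0 H]]] := sep_taylor r0.
have [|P [_ _ HP]] := H (fun x => f (a + x)) M 2%N.
  move=> x hx; have hax : vabs (a + x) < rho.
    by apply: le_lt_trans (vabsD _ _) _; move: hx; rewrite /r; lra.
  have [h1 h2] := Hf _ hax; split => // i; have := h2 i; rewrite mxE => {}h2.
  have := cdiff_shift h2; congr (cdiff _ _); apply/funext => z; congr f.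
  by apply/rowP => j; rewrite !(mxE, updE); case: eqP => // ->.
apply: differentiable_shift.
have -> : (fun x => f (a + x)) = (fun x => f (a + x) - mpoly_fun P x) + mpoly_fun P.
  by apply/funext => x; rewrite fctE /= subrK.
apply: differentiableD; last exact: mpoly_fun_diff.
apply: (@differentiable_quadratic _ (K * M * B ^+ 2) B^-1); first by rewrite invr_gt0.
move=> x hx; rewrite -mulrA -exprMn; apply: HP.
by rewrite mulrC -ler_pdivlMr // mul1r ltW.
Qed.

Lemma cdiff_line f a (u : E) (z : C) : differentiable f (a + z *: u) -> cdiff (fun z => f (a + z *: u)) z.
Proof.
move=> H; apply/cdiffP/derivable1_diffP.
have H1 : differentiable (fun w : C => w *: u) z.
  exact: (@ex_diff _ _ _ _ _ _ _ (is_diff_scalel z u)).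
have H2 : differentiable (fun w : C => a + w *: u) z.
  exact: (differentiableD (differentiable_cst a z) H1).
exact: (differentiable_comp H2 H).
Qed.

Lemma upd_line x i z : upd x i z = upd x i 0 + z *: delta_mx 0 i.
Proof.
apply/rowP => j; rewrite !(mxE, updE) eqxx /=.
by case: eqP => _; rewrite ?mulr1 ?add0r // mulr0 addr0.
Qed.

Lemma differentiable_bounded (W : normedModType C) (f : E -> W) : differentiable f (0 : E) ->
  exists2 r : R, 0 < r & forall x, vabs x < r -> complex.Re `|f x| <= complex.Re `|f 0| + 1.
Proof.
move=> /differentiable_continuous /cvgrPdist_le /(_ 1 ltr01) /near0P[r r0 H].
exists r => // x /H h.
have h1 : `|f x| <= `|f 0| + 1.
  by rewrite -[X in `|X|](subrK (f 0)) (le_trans (ler_normD _ _)) // addrC lerD2l distrC.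
have re (w : W) : rc R (complex.Re `|w|) = `|w| by rewrite [LHS]RRe_real // ger0_real.
by rewrite -ler_rc rmorphD rmorph1 !re.
Qed.

Lemma holo_sep f : holomorphic_near0 f -> exists rho M : R, 0 < rho /\ sep rho M f.
Proof.
move=> H; have [s s0 Hs] := differentiable_bounded (nbhs_singleton H).
move/near0P: H => [r r0 Hr]; exists (Num.min r s), (cabs (f 0) + 1).
split; first by rewrite lt_min r0.
move=> x; rewrite lt_min => /andP[xr xs]; split; first exact: Hs.
move=> i; under eq_fun do rewrite upd_line.
by apply: cdiff_line; rewrite -upd_line upd_id; exact: Hr.
Qed.

Lemma sep_holo f (rho M : R) : 0 < rho -> sep rho M f -> holomorphic_near0 f.
Proof.
by move=> r0 H; apply/near0P; exists rho => // x hx; exact: sep_differentiable H hx.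
Qed.

Lemma sep_diff (rho M : R) f : (forall x, vabs x < rho -> differentiable f x /\ cabs (f x) <= M) ->
  sep rho M f.
Proof.
move=> H x hx; have [h1 h2] := H x hx; split => // i.
under eq_fun do rewrite upd_line.
by apply: cdiff_line; rewrite -upd_line upd_id.
Qed.

(** Weierstrass' theorem on uniform limits; the bound M' of an approximant may depend on the
    accuracy e. *)
Lemma sep_approx f (rho M : R) : (forall x, vabs x < rho -> cabs (f x) <= M) ->
  (forall e : R, 0 < e -> exists g, (exists M' : R, sep rho M' g) /\
    forall x, vabs x < rho -> cabs (f x - g x) <= e) ->
  sep rho M f.
Proof.
move=> HM H x hx; split; first exact: HM.
move=> i; apply: (@cdiff_approx _ _ rho M).
- by move=> z hz; apply: HM; exact: vabs_upd.
- move=> e e0; have [g [[M' Hg] Hfg]] := H e e0.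
  exists (fun z => g (upd x i z)) => z hz; split; first by have [] := sep_line i Hg hx hz.
  by apply: Hfg; exact: vabs_upd.
- by apply: le_lt_trans (cabs_coord _ _) hx.
Qed.

Lemma differentiable_rowP (F : E -> E) a :
  (forall i, differentiable (fun x => F x 0 i) a) -> differentiable F a.
Proof.
move=> H; have -> : F = \sum_(i < d) (fun x => F x 0 i *: delta_mx 0 i).
  by apply/funext => x; rewrite fct_sumE [LHS]row_sum_delta.
by apply: differentiable_sum => i; apply: differentiableZl.
Qed.

Lemma differentiable_coordP (F : E -> E) a i :
  differentiable F a -> differentiable (fun x => F x 0 i) a.
Proof.
move=> H; exact: (differentiable_comp H (differentiable_coord (F a) 0 i)).
Qed.

End Frechet.

(** * Power series *)

Section PrimeWeight.
Variable d : nat.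
Local Notation mnm := (mpoly.multinom d).

Fixpoint nth_prime n : nat := if n is n'.+1 then s2val (prime_above (nth_prime n')) else 2.

Lemma nth_prime_prime n : prime (nth_prime n).
Proof. by case: n => //= n; case: prime_above. Qed.

Lemma nth_prime_lt n : (nth_prime n < nth_prime n.+1)%N.
Proof. by rewrite /=; case: prime_above. Qed.

Lemma nth_prime_mono : {mono nth_prime : m n / (m <= n)%N}.
Proof. by apply: leq_mono; apply: homo_ltn => [|n]; [exact: ltn_trans | exact: nth_prime_lt]. Qed.

(* The Dirichlet weight: it turns monomials into smooth numbers, which orders them by a
   multiplicative, injective, integer-valued function. *)
Definition wt (m : mnm) : nat := (\prod_(i < d) nth_prime i ^ m i)%N.

Lemma wtD m m' : wt (mpoly.mnm_add m m') = (wt m * wt m')%N.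
Proof. by rewrite /wt -big_split /=; apply: eq_bigr => i _; rewrite mnmDE expnD. Qed.

Lemma wt_gt0 m : (0 < wt m)%N.
Proof. by rewrite prodn_gt0 // => i; rewrite expn_gt0 prime_gt0 // nth_prime_prime. Qed.

Lemma logn_wt m (j : 'I_d) : logn (nth_prime j) (wt m) = m j.
Proof.
have pos (P : pred 'I_d) : (0 < \prod_(i < d | P i) nth_prime i ^ m i)%N.
  by apply: prodn_cond_gt0 => i _; rewrite expn_gt0 prime_gt0 // nth_prime_prime.
rewrite /wt (bigD1 j) //= lognM ?pos ?expn_gt0 ?prime_gt0 ?nth_prime_prime //.
rewrite lognX logn_prime ?nth_prime_prime // eqxx muln1.
rewrite (_ : logn _ _ = 0%N) ?addn0 //.
elim/big_rec: _ => [|i n ij IH]; first by rewrite logn1.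
have [->|n0] := posnP n; first by rewrite muln0 logn0.
rewrite lognM ?n0 ?expn_gt0 ?prime_gt0 ?nth_prime_prime //.
rewrite IH addn0 lognX.
rewrite logn_prime ?nth_prime_prime // (inj_eq (incn_inj nth_prime_mono)).
by rewrite eq_sym (inj_eq val_inj) (negbTE ij) muln0.
Qed.

Lemma wt_inj : injective wt.
Proof. by move=> m m' e; apply/mnmP => i; rewrite -logn_wt e logn_wt. Qed.

(** Together with [wt_le] this says that growth which is geometric in the degree is the same as
    growth which is polynomial in the weight. *)
Lemma wt_ge m : (2 ^ mpoly.mdeg m <= wt m)%N.
Proof.
rewrite mdegE /wt expn_sum; apply: leq_prod => i _.
by case: (m i) => // k; rewrite leq_exp2r // prime_gt1 // nth_prime_prime.
Qed.

Lemma wt_le m : (wt m <= nth_prime d ^ mpoly.mdeg m)%N.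
Proof.
rewrite mdegE /wt expn_sum; apply: leq_prod => i _.
by case: (m i) => // k; rewrite leq_exp2r // nth_prime_mono ltnW.
Qed.

Lemma mdeg_lt_wt m : (mpoly.mdeg m < wt m)%N.
Proof. by apply: leq_trans (wt_ge m); rewrite ltn_expl. Qed.

End PrimeWeight.

Section PowerSums.
Variable F : fieldType.

(** Vandermonde: by linearity the sum vanishes with the powers replaced by any polynomial, in
    particular by the one whose roots are all the nodes except t x. *)
Lemma power_sums_eq0 (T : eqType) (s : seq T) (a t : T -> F) : uniq s ->
  {in s &, injective t} -> (forall k, \sum_(x <- s) a x * t x ^+ k = 0) ->
  forall x, x \in s -> a x = 0.
Proof.
move=> us it H x xs.
have HP (q : {poly F}) : \sum_(y <- s) a y * q.[t y] = 0.
  under eq_bigr do rewrite horner_coef mulr_sumr.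
  rewrite exchange_big big1 //= => k _.
  under eq_bigr do rewrite mulrCA.
  by rewrite -mulr_sumr H mulr0.
pose q := \prod_(b <- map t (rem x s)) ('X - b%:P).
have := HP q; rewrite (perm_big _ (perm_to_rem xs)) big_cons big_seq big1.
  rewrite /= addr0 => /eqP; rewrite mulf_eq0 => /orP[/eqP //|].
  rewrite -/(root q (t x)) root_prod_XsubC => /mapP[y ys e].
  have yS : y \in s by apply: mem_rem ys.
  move: ys; rewrite -(it x y xs yS e) mem_rem_uniq // inE eqxx //.
move=> y ys; have /eqP -> : q.[t y] == 0.
  by rewrite -/(root q (t y)) root_prod_XsubC map_f.
by rewrite mulr0.
Qed.

End PowerSums.

(** * Taylor coefficients: existence and uniqueness *)

Section Coefficients.
Variables (R : realType) (d : nat).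
Local Notation C := (CC R).
Local Notation E := 'rV[C]_d.
Local Notation mpol := (mpoly.mpoly d C).
Local Notation mnm := (mpoly.multinom d).
Local Notation mdeg := mpoly.mdeg.
Implicit Types (f g : E -> C) (x : E) (m : mnm) (c : mnm -> C).

Lemma mpoly_funE (P : mpol) x :
  mpoly_fun P x = \sum_(m <- mpoly.msupp P) mpoly.mcoeff m P * \prod_(i < d) x 0 i ^+ m i.
Proof. by rewrite /mpoly_fun mevalE. Qed.

Lemma cabs_monomial x m : cabs (\prod_(i < d) x 0 i ^+ m i) <= vabs x ^+ mdeg m.
Proof.
rewrite cabs_prod mdegE -prodrXr; apply: ler_prod => i _.
by rewrite cabs_ge0 cabsX lerXn2r ?nnegrE ?cabs_ge0 ?vabs_ge0 // cabs_coord.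
Qed.

(** This is f = O(|x|^k) at the origin. *)
Definition ordge k f := exists K r : R, 0 < r /\ forall x, vabs x < r -> cabs (f x) <= K * vabs x ^+ k.

Lemma mpoly_fun_scale (P : mpol) (t : C) x : mpoly_fun P (t *: x) =
  \sum_(m <- mpoly.msupp P) mpoly.mcoeff m P * t ^+ mdeg m * \prod_(i < d) x 0 i ^+ m i.
Proof.
rewrite mpoly_funE; apply: eq_bigr => m _; rewrite -mulrA; congr (_ * _).
by rewrite mdegE -prodrXr -big_split /=; apply: eq_bigr => i _; rewrite mxE exprMn.
Qed.

Lemma small_eq0 (a K r : R) : 0 < r -> (forall t : R, 0 < t < r -> a <= K * t) -> a <= 0.
Proof.
move=> r0 H; apply/ler_addgt0Pr => e e0; rewrite add0r.
have K1 : 0 < `|K| + 1 by rewrite ltr_wpDl.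
pose t := Num.min (r / 2) (e / (`|K| + 1)).
have t0 : 0 < t by rewrite lt_min !divr_gt0.
have tr : t < r by rewrite gt_min ltr_pdivrMr // ltr_pMr // ltr1n.
apply: (le_trans (H t _)); first by rewrite t0.
apply: (@le_trans _ _ ((`|K| + 1) * t)).
  by rewrite ler_wpM2r ?(ltW t0) // (le_trans (ler_norm _)) // lerDl.
by rewrite mulrC -ler_pdivlMr // ge_min lexx orbT.
Qed.

(* Isolating the part of lowest degree n: along each line through the origin it is
   O(t), hence zero, and at the points x_i = p_i^s it is a combination of the
   powers wt(m)^s. *)
Lemma mpoly_fun_ordge (P : mpol) k : ordge k (mpoly_fun P) ->
  forall m, (mdeg m < k)%N -> mpoly.mcoeff m P = 0.
Proof.
move=> [K [r [r0 H]]] m.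
elim/ltn_ind: (mdeg m) {-2}m (erefl (mdeg m)) => n IH {}m mn nk.
have low m' : (mdeg m' < n)%N -> mpoly.mcoeff m' P = 0.
  by move=> h; apply: (IH _ h m' erefl); rewrite mn in nk; exact: ltn_trans h nk.
pose Q x := \sum_(m' <- mpoly.msupp P | mdeg m' == n)
  mpoly.mcoeff m' P * \prod_(i < d) x 0 i ^+ m' i.
have Q0 x : Q x = 0.
  apply/eqP; rewrite -cabs_eq0; apply/eqP/le_anti; rewrite cabs_ge0 andbT.
  pose S := \sum_(m' <- mpoly.msupp P) cabs (mpoly.mcoeff m' P) * vabs x ^+ mdeg m'.
  have v1 : 0 < vabs x + 1 by rewrite ltr_wpDl ?vabs_ge0.
  apply: (@small_eq0 _ (`|K| * vabs x ^+ k + S) (Num.min 1 (r / (vabs x + 1)))).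
    by rewrite lt_min ltr01 divr_gt0.
  move=> t; rewrite lt_min => /and3P[t0 t1 tr].
  have tx : vabs (rc R t *: x) < r.
    rewrite vabsZ cabs_rc gtr0_norm //.
    apply: (@le_lt_trans _ _ (t * (vabs x + 1))); first by rewrite ler_wpM2l ?(ltW t0) // lerDl.
    by rewrite -ltr_pdivlMr.
  have tn0 : 0 < t ^+ n by rewrite exprn_gt0.
  rewrite -(ler_pM2l tn0).
  have -> : t ^+ n * cabs (Q x) = cabs (rc R t ^+ n * Q x).
    by rewrite cabsM cabsX cabs_rc gtr0_norm.
  have -> : rc R t ^+ n * Q x = mpoly_fun P (rc R t *: x) -
      \sum_(m' <- mpoly.msupp P | mdeg m' != n)
        mpoly.mcoeff m' P * rc R t ^+ mdeg m' * \prod_(i < d) x 0 i ^+ m' i.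
    rewrite mpoly_fun_scale (bigID (fun m' => mdeg m' == n)) /= addrK mulr_sumr.
    by apply: eq_bigr => m' /eqP ->; ring.
  apply: le_trans (cabsB _ _) _; rewrite mulrDl mulrDr.
  have tS (j : nat) : (n < j)%N -> t ^+ j <= t ^+ n * t.
    by move=> nj; rewrite -exprSr ler_wiXn2l ?ltW.
  apply: lerD.
    apply: le_trans (H _ tx) _; rewrite vabsZ cabs_rc gtr0_norm // exprMn.
    apply: (@le_trans _ _ (`|K| * (t ^+ k * vabs x ^+ k))).
      by rewrite ler_wpM2r ?ler_norm // mulr_ge0 ?exprn_ge0 ?vabs_ge0 ?ltW.
    rewrite [leRHS](_ : _ = `|K| * (t ^+ n * t * vabs x ^+ k)); last by ring.
    by rewrite ler_wpM2l // ler_wpM2r ?exprn_ge0 ?vabs_ge0 // tS // -mn.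
  apply: le_trans (cabs_sum _ _ _) _; rewrite /S [leRHS]mulrC -mulrA mulr_suml [leRHS]big_seq.
  rewrite [leLHS]big_mkcond [leLHS]big_seq /=; apply: ler_sum => m' ms.
  have [_|mn'] := eqVneq (mdeg m') n.
    by rewrite !mulr_ge0 ?cabs_ge0 ?exprn_ge0 ?vabs_ge0 ?(ltW t0).
  have nm' : (n < mdeg m')%N.
    rewrite ltn_neqAle eq_sym mn' /= leqNgt; apply/negP => /low h.
    by move: ms; rewrite mcoeff_msupp h eqxx.
  rewrite !cabsM cabsX cabs_rc gtr0_norm //.
  rewrite [leRHS](_ : _ = cabs (mpoly.mcoeff m' P) * (t ^+ n * t) * vabs x ^+ mdeg m'); last by ring.
  apply: ler_pM; rewrite ?mulr_ge0 ?cabs_ge0 ?exprn_ge0 ?(ltW t0) //; last exact: cabs_monomial.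
  by rewrite ler_wpM2l ?cabs_ge0 // tS.
have [ms|ms] := boolP (m \in mpoly.msupp P); last by apply/eqP; rewrite mcoeff_eq0.
pose s := [seq m' <- mpoly.msupp P | mdeg m' == n].
apply: (@power_sums_eq0 C mnm s (fun m' => mpoly.mcoeff m' P) (fun m' => (wt m')%:R)).
- by rewrite filter_uniq // msupp_uniq.
- move=> m1 m2 _ _ /eqP; rewrite eqr_nat => /eqP; exact: wt_inj.
- move=> e; have := Q0 (\row_i ((nth_prime i)%:R ^+ e)); rewrite /Q big_filter => h.
  rewrite -[RHS]h; apply: eq_bigr => m' _; congr (_ * _).
  rewrite /wt natr_prod -prodrXl; apply: eq_bigr => i _.
  by rewrite mxE natrX -!exprM mulnC.
- by rewrite mem_filter mn eqxx.
Qed.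


Definition trunc c N : mpol := \sum_(m : mpoly.bmultinom d N) c m *: mpoly.mpolyX C m.

Lemma mcoeff_trunc c N m : mpoly.mcoeff m (trunc c N) = if (mdeg m < N)%N then c m else 0.
Proof.
case: ifP => h; first exact: mcoeff_mpoly.
rewrite /trunc raddf_sum big1 //= => m' _.
rewrite mcoeffZ mcoeffX; case: eqP => [e|_]; last by rewrite mulr0.
by move: (bmdeg m'); rewrite e h.
Qed.

Lemma mpoly_fun_trunc c N x :
  mpoly_fun (trunc c N) x = \sum_(m : mpoly.bmultinom d N) c m * \prod_(i < d) x 0 i ^+ (m : mnm) i.
Proof.
rewrite /trunc mpoly_fun_sum; apply: eq_bigr => m _.
by rewrite /mpoly_fun mevalZ mevalX.
Qed.

(** Convergence of the Taylor series is expressed by geometric bounds on all remainders, with the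
    constants that also bound the coefficients; no infinite sum is formed. *)
Definition expands f c := exists K B : R, [/\ 0 <= K, 0 < B,
  forall m, cabs (c m) <= K * B ^+ mdeg m &
  forall N x, B * vabs x <= 1 -> cabs (f x - mpoly_fun (trunc c N) x) <= K * (B * vabs x) ^+ N].

Lemma ordge_sub f g k : ordge k f -> ordge k g -> ordge k (fun x => f x - g x).
Proof.
move=> [K [r [r0 H]]] [K' [r' [r'0 H']]]; exists (K + K'), (Num.min r r').
split=> [|x]; first by rewrite lt_min r0.
rewrite lt_min => /andP[h h']; rewrite mulrDl.
by apply: le_trans (cabsB _ _) _; apply: lerD; [exact: H | exact: H'].
Qed.

Lemma ordge_le f j k : (j <= k)%N -> ordge k f -> ordge j f.
Proof.
move=> jk [K [r [r0 H]]]; exists `|K|, (Num.min r 1); split=> [|x]; first by rewrite lt_min r0 ltr01.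
rewrite lt_min => /andP[h h']; apply: le_trans (H _ h) _.
apply: (@le_trans _ _ (`|K| * vabs x ^+ k)).
  by rewrite ler_wpM2r ?exprn_ge0 ?vabs_ge0 ?ler_norm.
by rewrite ler_wpM2l // ler_wiXn2l ?vabs_ge0 // ltW.
Qed.

Lemma expands_ordge f c k : expands f c -> ordge k (fun x => f x - mpoly_fun (trunc c k) x).
Proof.
move=> [K [B [K0 B0 _ H]]]; exists (K * B ^+ k), B^-1; split; first by rewrite invr_gt0.
move=> x hx; rewrite -mulrA -exprMn; apply: H.
by rewrite mulrC -ler_pdivlMr // mul1r ltW.
Qed.

Lemma expands_coef f c k (P : mpol) : expands f c -> ordge k (fun x => f x - mpoly_fun P x) ->
  forall m, (mdeg m < k)%N -> c m = mpoly.mcoeff m P.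
Proof.
move=> Hc HP m mk; have h : ordge k (mpoly_fun (P - trunc c k)).
  have := ordge_sub (expands_ordge k Hc) HP; congr (ordge _ _); apply/funext => x.
  by rewrite mpoly_funB; ring.
have := mpoly_fun_ordge h mk; rewrite mcoeffB mcoeff_trunc mk => /eqP.
by rewrite subr_eq0 => /eqP.
Qed.

Lemma expands_exists f : holomorphic_near0 f -> exists c, expands f c.
Proof.
move=> /holo_sep[rho [M [rho0 Hf]]]; pose r := rho / 4.
have r0 : 0 < r by rewrite divr_gt0.
have Hr : sep (4 * r) M f by rewrite /r mulrC divfK.
have [K [B [K1 B0 H]]] := sep_taylor d r0.
have M0 : 0 <= M by apply: le_trans (cabs_ge0 (f 0)) _; apply: (Hf 0 _).1; rewrite vabs0.
have K0 : 0 <= K * M by rewrite mulr_ge0 // (le_trans ler01).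
have [P HP] := choice (fun N => H f M N Hr).
have oP N : ordge N (fun x => f x - mpoly_fun (P N) x).
  have [_ _ h] := HP N; exists (K * M * B ^+ N), B^-1; split; first by rewrite invr_gt0.
  move=> x hx; rewrite -mulrA -exprMn; apply: h.
  by rewrite mulrC -ler_pdivlMr // mul1r ltW.
pose c m := mpoly.mcoeff m (P (mdeg m).+1).
have cP N m : (mdeg m < N)%N -> c m = mpoly.mcoeff m (P N).
  move=> mN; have h : ordge (mdeg m).+1 (mpoly_fun (P (mdeg m).+1 - P N)).
    have := ordge_sub (ordge_le mN (oP N)) (oP (mdeg m).+1); congr (ordge _ _); apply/funext => x.
    by rewrite mpoly_funB; move: (f x) (mpoly_fun _ _) (mpoly_fun _ _) => u v s; ring.
  have := mpoly_fun_ordge h (ltnSn _); rewrite mcoeffB => /eqP.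
  by rewrite subr_eq0 => /eqP.
have cT N : trunc c N = P N.
  apply/mpolyP => m; rewrite mcoeff_trunc; case: ltnP => h; first exact: cP.
  by have [-> //] := HP N.
exists c, (K * M), B; split => // [m|N x hx]; first by have [_ h _] := HP (mdeg m).+1; exact: h.
by rewrite cT; have [_ _ h] := HP N; exact: h.
Qed.

Lemma expands_near f g c : (\forall x \near (0 : E), f x = g x) -> expands f c -> expands g c.
Proof.
move=> /near0P[s s0 e] [K [B [K0 B0 Hc H]]].
(* With 2 / s added, B' |x| <= 1 forces |x| <= s / 2, where f and g agree. *)
pose B' := B + 2 / s; have B'0 : 0 < B' by rewrite addr_gt0 // divr_gt0.
have BB : B <= B' by rewrite lerDl ltW // divr_gt0.
exists K, B'; split => // [m|N x hx].
  apply: le_trans (Hc m) _; rewrite ler_wpM2l // lerXn2r ?nnegrE ?(ltW B0) ?(ltW B'0) //.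
have xs : vabs x < s.
  have : 2 / s * vabs x <= 1 by apply: le_trans hx; rewrite ler_wpM2r ?vabs_ge0 // lerDr ltW.
  by rewrite mulrAC ler_pdivrMr // mul1r => h; have := vabs_ge0 x; lra.
have h1 : B * vabs x <= B' * vabs x by rewrite ler_wpM2r ?vabs_ge0.
rewrite -e //; apply: le_trans (H N x (le_trans h1 hx)) _.
by rewrite ler_wpM2l // lerXn2r ?nnegrE ?mulr_ge0 ?vabs_ge0 ?(ltW B0) ?(ltW B'0).
Qed.

Lemma geometric_eq0 (a K : R) : 0 <= a -> (forall N, a <= K * 2^-1 ^+ N) -> a = 0.
Proof.
move=> a0 H; apply/le_anti; rewrite a0 andbT; apply/ler_addgt0Pr => e e0; rewrite add0r.
have [n Hn] : exists n : nat, `|K| / e < n%:R.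
  by exists (Num.truncn (`|K| / e)).+1; rewrite truncnS_gt.
apply: le_trans (H n) _; rewrite exprVn ler_pdivrMr ?exprn_gt0 //.
apply: le_trans (ler_norm K) _; rewrite mulrC -ler_pdivrMr //.
by apply: (le_trans (ltW Hn)); rewrite -natrX ler_nat ltnW // ltn_expl.
Qed.

Lemma expands_inj f g c : expands f c -> expands g c -> \forall x \near (0 : E), f x = g x.
Proof.
move=> [K [B [K0 B0 _ H]]] [K' [B' [K'0 B'0 _ H']]]; apply/near0P.
exists (2 * (B + B'))^-1; first by rewrite invr_gt0 mulr_gt0 // addr_gt0.
move=> x; rewrite -[_^-1]mul1r ltr_pdivlMr; last by rewrite mulr_gt0 // addr_gt0.
move=> hx; have v0 := vabs_ge0 x.
have b0 : 0 <= B * vabs x by rewrite mulr_ge0 // ltW.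
have b'0 : 0 <= B' * vabs x by rewrite mulr_ge0 // ltW.
have hs : B * vabs x + B' * vabs x <= 2^-1 by lra.
apply/eqP; rewrite -subr_eq0 -cabs_eq0; apply/eqP.
apply: (@geometric_eq0 _ (K + K')); first exact: cabs_ge0.
move=> N; have -> : f x - g x = (f x - mpoly_fun (trunc c N) x) - (g x - mpoly_fun (trunc c N) x) by ring.
apply: le_trans (cabsB _ _) _; rewrite mulrDl; apply: lerD.
  apply: le_trans (H N x _) _; first by lra.
  by rewrite ler_wpM2l // lerXn2r ?nnegrE //; lra.
apply: le_trans (H' N x _) _; first by lra.
by rewrite ler_wpM2l // lerXn2r ?nnegrE //; lra.
Qed.

Lemma half_sum_le N : \sum_(j < N) (2^-1 : R) ^+ j <= 2.
Proof.
suff -> : \sum_(j < N) (2^-1 : R) ^+ j = 2 - 2 * 2^-1 ^+ N.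
  by rewrite lerBlDr lerDl mulr_ge0 // exprn_ge0 // invr_ge0.
elim: N => [|N IH]; first by rewrite big_ord0 expr0 mulr1 subrr.
by rewrite big_ord_recr /= IH exprS; field.
Qed.

(** The sum is dominated by a product of d geometric series, each at most 2. *)
Lemma half_mdeg_sum_le N : \sum_(m : mpoly.bmultinom d N) (2^-1 : R) ^+ mdeg m <= 2 ^+ d.
Proof.
pose h (m : mpoly.bmultinom d N) : {ffun 'I_d -> 'I_N.+1} := [ffun i => inord ((m : mnm) i)].
have hE (m : mpoly.bmultinom d N) i : (h m i : nat) = (m : mnm) i.
  rewrite ffunE inordK // ltnS ltnW //; apply: leq_ltn_trans (bmdeg m).
  by rewrite mdegE (bigD1 i) //= leq_addr.
have hinj : injective h.
  move=> m m' e; apply/val_inj/mnmP => i /=.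
  by rewrite -!hE e.
pose G (q : {ffun 'I_d -> 'I_N.+1}) : R := \prod_(i < d) 2^-1 ^+ (q i).
have G0 q : 0 <= G q by rewrite prodr_ge0 // => i _; rewrite exprn_ge0 // invr_ge0.
apply: (@le_trans _ _ (\sum_q G q)).
  apply: (@le_trans _ _ (\sum_(q in h @: [set: mpoly.bmultinom d N]%SET) G q)).
    rewrite big_imset /=; last by move=> m m' _ _; exact: hinj.
    rewrite le_eqVlt; apply/orP; left; apply/eqP; apply: eq_big => [m|m _]; first by rewrite inE.
    by rewrite /G mdegE -prodrXr; apply: eq_bigr => i _; rewrite hE.
  by rewrite big_mkcond; apply: ler_sum => q _; case: ifP.
rewrite /G -(bigA_distr_bigA (fun (i : 'I_d) (j : 'I_N.+1) => (2^-1 : R) ^+ j)) /=.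
apply: (@le_trans _ _ (\prod_(i < d) (2 : R))); last by rewrite prodr_const card_ord.
apply: ler_prod => i _; rewrite half_sum_le andbT.
by rewrite sumr_ge0 // => j _; rewrite exprn_ge0 // invr_ge0.
Qed.

End Coefficients.

(** * Sums and products of convergent power series *)

Section ConvergentSeries.
Variables (R : realType) (d : nat).
Local Notation C := (CC R).
Local Notation E := 'rV[C]_d.
Local Notation mpol := (mpoly.mpoly d C).
Local Notation mnm := (mpoly.multinom d).
Local Notation mdeg := mpoly.mdeg.
Implicit Types (f g : E -> C) (x : E) (m : mnm) (c : mnm -> C).

Lemma mpoly_fun_sep (P : mpol) (rho : R) : 0 < rho -> exists M : R, sep rho M (mpoly_fun P).
Proof.
move=> r0; exists (\sum_(m <- mpoly.msupp P) cabs (mpoly.mcoeff m P) * rho ^+ mdeg m).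
move=> x hx; split.
  rewrite mpoly_funE; apply: le_trans (cabs_sum _ _ _) _; apply: ler_sum => m _.
  rewrite cabsM ler_wpM2l ?cabs_ge0 //; apply: le_trans (cabs_monomial _ _) _.
  by rewrite lerXn2r ?nnegrE ?vabs_ge0 ?ltW.
move=> i; under eq_fun do rewrite mpoly_funE.
apply: cdiff_sum => m _; apply: cdiffM; first exact: cdiff_cst.
have prodD (s : seq 'I_d) : cdiff (fun z => \prod_(j <- s) (upd x i z) 0 j ^+ m j) (x 0 i).
  elim: s => [|j s IH].
    by under eq_fun do rewrite big_nil; exact: cdiff_cst.
  under eq_fun do rewrite big_cons; apply: cdiffM => //; apply: cdiffX.
  under eq_fun do rewrite updE; case: eqP => _; [exact: cdiff_id | exact: cdiff_cst].
exact: prodD.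
Qed.

Definition growth c := exists K B : R, [/\ 0 <= K, 0 < B & forall m, cabs (c m) <= K * B ^+ mdeg m].

(** Writing (B |x|)^n = (2 B |x|)^n 2^-n halves the radius and leaves a factor 2^-n that is summable
    over all monomials. *)
Lemma trunc_diff c (K B : R) N N' x : 0 <= K -> 0 < B ->
  (forall m, cabs (c m) <= K * B ^+ mdeg m) -> 2 * B * vabs x <= 1 -> (N <= N')%N ->
  cabs (mpoly_fun (trunc c N') x - mpoly_fun (trunc c N) x)
    <= K * 2 ^+ d * (2 * B * vabs x) ^+ N.
Proof.
move=> K0 B0 Hc hx NN.
have v0 := vabs_ge0 x.
have y0 : 0 <= 2 * B * vabs x by rewrite mulr_ge0 // mulr_ge0 // ltW.
pose c' m := if (N <= mdeg m)%N then c m else 0.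
have -> : mpoly_fun (trunc c N') x - mpoly_fun (trunc c N) x = mpoly_fun (trunc c' N') x.
  rewrite -mpoly_funB; congr mpoly_fun; apply/mpolyP => m.
  rewrite mcoeffB !mcoeff_trunc /c'; case: (ltnP (mdeg m) N) => h.
    by rewrite (leq_trans h NN) subrr.
  by rewrite subr0.
rewrite mpoly_fun_trunc; apply: le_trans (cabs_sum _ _ _) _.
apply: (@le_trans _ _ (\sum_(m : mpoly.bmultinom d N') K * (2 * B * vabs x) ^+ N * 2^-1 ^+ mdeg m)).
  apply: ler_sum => m _; rewrite cabsM /c'; case: ifP => h; last first.
    rewrite cabs0 mul0r mulr_ge0 ?exprn_ge0 ?invr_ge0 //.
    by rewrite mulr_ge0 // exprn_ge0.
  apply: (@le_trans _ _ (K * B ^+ mdeg m * vabs x ^+ mdeg m)).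
    by apply: ler_pM; rewrite ?cabs_ge0 // cabs_monomial.
  have -> : K * B ^+ mdeg m * vabs x ^+ mdeg m = K * ((2 * B * vabs x) ^+ mdeg m * 2^-1 ^+ mdeg m).
    by rewrite -exprMn -mulrA -exprMn; congr (_ * _ ^+ _); field.
  rewrite -[leRHS]mulrA ler_wpM2l // ler_wpM2r ?exprn_ge0 ?invr_ge0 //.
  by rewrite ler_wiXn2l.
rewrite -mulr_sumr -[leRHS]mulrA [2 ^+ d * _]mulrC mulrA.
by rewrite ler_wpM2l ?half_mdeg_sum_le // mulr_ge0 // exprn_ge0.
Qed.

Lemma expands_surj c : growth c -> exists f, holomorphic_near0 f /\ expands f c.
Proof.
move=> [K [B [K0 B0 Hc]]].
pose K' := 2 * (K * 2 ^+ d).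
have K'0 : 0 <= K' by rewrite !mulr_ge0 // exprn_ge0.
have lim x : exists l, 2 * B * vabs x <= 1 -> forall N,
    cabs (mpoly_fun (trunc c N) x - l) <= K' * (2 * B * vabs x) ^+ N.
  have [hx|] := boolP (2 * B * vabs x <= 1); last by exists 0.
  have y0 : 0 <= 2 * B * vabs x by rewrite mulr_ge0 ?vabs_ge0 // mulr_ge0 // ltW.
  have [||l Hl] := @complex_complete R nat (fun=> True) (fun N => mpoly_fun (trunc c N) x)
      (fun N => K * 2 ^+ d * (2 * B * vabs x) ^+ N).
  - by exists 0%N.
  - have e0 N : 0 <= K * 2 ^+ d * (2 * B * vabs x) ^+ N by rewrite !mulr_ge0 ?exprn_ge0.
    move=> N N' _ _; case: (leqP N' N) => h.
      by apply: le_trans (trunc_diff K0 B0 Hc hx h) _; rewrite lerDr.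
    by rewrite cabsBC; apply: le_trans (trunc_diff K0 B0 Hc hx (ltnW h)) _; rewrite lerDl.
  by exists l => _ N; rewrite /K' -mulrA; exact: Hl.
have [f Hf] := choice lim.
have Hx x : vabs x < (4 * B)^-1 -> 2 * B * vabs x <= 2^-1.
  rewrite -[_^-1]mul1r ltr_pdivlMr ?mulr_gt0 // => h; lra.
have Hx1 x : vabs x < (4 * B)^-1 -> 2 * B * vabs x <= 1 by move=> /Hx h; lra.
have y0 x : 0 <= 2 * B * vabs x by rewrite mulr_ge0 ?vabs_ge0 // mulr_ge0 // ltW.
exists f; split; last first.
  exists K', (2 * B); split => //; first by rewrite mulr_gt0.
    move=> m; apply: le_trans (Hc m) _; apply: ler_pM => //; rewrite ?exprn_ge0 ?(ltW B0) //.
      rewrite /K' mulrCA ler_peMr // -exprS exprn_ege1 // ler1n //.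
    by rewrite lerXn2r ?nnegrE ?mulr_ge0 ?(ltW B0) // ler_peMl ?(ltW B0) // ler1n.
  by move=> N x hx; rewrite cabsBC; exact: Hf.
(* On this polydisc 2 B |x| <= 1/2, so the truncations converge uniformly and the limit is
   separately holomorphic. *)
have r0 : 0 < (4 * B)^-1 by rewrite invr_gt0 mulr_gt0.
apply: (@sep_holo _ _ _ (4 * B)^-1 (K' + 0) r0).
apply: sep_approx => [x hx|e e0].
  have := Hf x (Hx1 x hx) 0%N; rewrite expr0 mulr1.
  have -> : mpoly_fun (trunc c 0) x = 0.
    by rewrite mpoly_fun_trunc big1 // => m _; have := bmdeg m.
  by rewrite sub0r cabsN addr0.
have [N HN] : exists N, K' * 2^-1 ^+ N <= e.
  have [n Hn] : exists n : nat, K' / e < n%:R.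
    by exists (Num.truncn (K' / e)).+1; rewrite truncnS_gt.
  exists n; rewrite exprVn ler_pdivrMr ?exprn_gt0 // mulrC -ler_pdivrMr //.
  by apply: (le_trans (ltW Hn)); rewrite -natrX ler_nat ltnW // ltn_expl.
exists (mpoly_fun (trunc c N)); split; first exact: mpoly_fun_sep.
move=> x hx; rewrite cabsBC; apply: le_trans (Hf x (Hx1 x hx) N) _; apply: le_trans HN.
by rewrite ler_wpM2l // lerXn2r ?nnegrE ?invr_ge0 // Hx.
Qed.

Lemma ordge_bounded f c : expands f c -> exists M r : R, 0 < r /\ forall x, vabs x < r -> cabs (f x) <= M.
Proof.
move=> [K [B [K0 B0 _ H]]]; exists K, B^-1; split; first by rewrite invr_gt0.
move=> x hx; have := H 0%N x; rewrite expr0 mulr1.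
have -> : mpoly_fun (trunc c 0) x = 0.
  by rewrite mpoly_fun_trunc big1 // => m _; have := bmdeg m.
by rewrite subr0; apply; rewrite mulrC -ler_pdivlMr // mul1r ltW.
Qed.

Lemma ordge_mulr f h k : (exists M r : R, 0 < r /\ forall x, vabs x < r -> cabs (f x) <= M) ->
  ordge k h -> ordge k (fun x => f x * h x).
Proof.
move=> [M [r [r0 H]]] [K [s [s0 H']]]; exists (`|M| * `|K|), (Num.min r s).
split=> [|x]; first by rewrite lt_min r0.
rewrite lt_min => /andP[h1 h2]; rewrite cabsM -mulrA.
apply: ler_pM; rewrite ?cabs_ge0 //; first by apply: le_trans (H _ h1) (ler_norm _).
apply: le_trans (H' _ h2) _; by rewrite ler_wpM2r ?exprn_ge0 ?vabs_ge0 ?ler_norm.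
Qed.

Lemma ordge_add f g k : ordge k f -> ordge k g -> ordge k (fun x => f x + g x).
Proof.
move=> hf [K' [r' [r'0 H']]].
have : ordge k (fun x => f x - (fun x => - g x) x).
  apply: ordge_sub => //; exists K', r'; split => // x hx; rewrite cabsN; exact: H'.
by congr (ordge _ _); apply/funext => x; rewrite opprK.
Qed.

Lemma expandsM f g c e h : expands f c -> expands g e -> expands (fun x => f x * g x) h ->
  forall k m, (mdeg m < k)%N -> h m = mpoly.mcoeff m (trunc c k * trunc e k).
Proof.
move=> Hf Hg Hh k m mk; apply: (expands_coef Hh _ mk).
have -> : (fun x => f x * g x - mpoly_fun (trunc c k * trunc e k) x) =
   (fun x => f x * (g x - mpoly_fun (trunc e k) x) +
     mpoly_fun (trunc e k) x * (f x - mpoly_fun (trunc c k) x)).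
  by apply/funext => x; rewrite mpoly_funM; move: (f x) (g x) (mpoly_fun _ _) (mpoly_fun _ _) => u v s t; ring.
apply: ordge_add; apply: ordge_mulr; try exact: expands_ordge.
  exact: ordge_bounded Hf.
have [M HM] := mpoly_fun_sep (trunc e k) ltr01.
by exists M, 1; split => // x hx; case: (HM x hx).
Qed.

Lemma expandsD f g c e : expands f c -> expands g e ->
  expands (fun x => f x + g x) (fun m => c m + e m).
Proof.
move=> [K [B [K0 B0 Hc Hf]]] [K' [B' [K'0 B'0 He Hg]]].
have BB' : 0 < B + B' by rewrite addr_gt0.
have v0 := @vabs_ge0 R d.
exists (K + K'), (B + B'); split; rewrite ?addr_ge0 //.
  move=> m; rewrite mulrDl; apply: le_trans (cabsD _ _) _; apply: lerD.
    by apply: le_trans (Hc m) _; rewrite ler_wpM2l // lerXn2r ?nnegrE ?(ltW BB') ?(ltW B0) // lerDl ltW.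
  by apply: le_trans (He m) _; rewrite ler_wpM2l // lerXn2r ?nnegrE ?(ltW BB') ?(ltW B'0) // lerDr ltW.
move=> N x hx.
have b1 : B * vabs x <= (B + B') * vabs x by rewrite ler_wpM2r ?v0 // lerDl ltW.
have b2 : B' * vabs x <= (B + B') * vabs x by rewrite ler_wpM2r ?v0 // lerDr ltW.
have -> : trunc (fun m => c m + e m) N = trunc c N + trunc e N.
  apply/mpolyP => m; rewrite mcoeffD !mcoeff_trunc; case: ifP => // _; by rewrite addr0.
rewrite mpoly_funD.
have -> : f x + g x - (mpoly_fun (trunc c N) x + mpoly_fun (trunc e N) x) =
  (f x - mpoly_fun (trunc c N) x) + (g x - mpoly_fun (trunc e N) x) by rewrite opprD addrACA.
rewrite mulrDl; apply: le_trans (cabsD _ _) _; apply: lerD.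
  apply: le_trans (Hf N x (le_trans b1 hx)) _; rewrite ler_wpM2l // lerXn2r ?nnegrE //.
    by rewrite mulr_ge0 ?v0 // ltW.
  by rewrite mulr_ge0 ?v0 // ltW.
apply: le_trans (Hg N x (le_trans b2 hx)) _; rewrite ler_wpM2l // lerXn2r ?nnegrE //.
  by rewrite mulr_ge0 ?v0 // ltW.
by rewrite mulr_ge0 ?v0 // ltW.
Qed.

End ConvergentSeries.

(** * Germs and their Taylor coefficients *)

Section GermCoefficients.
Variables (R : realType) (d : nat).
Local Notation C := (CC R).
Local Notation E := 'rV[C]_d.
Local Notation mpol := (mpoly.mpoly d C).
Local Notation mnm := (mpoly.multinom d).
Local Notation mdeg := mpoly.mdeg.
Local Notation germ := (germ R d).
Local Notation holo := (holo R d).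
Implicit Types (f g : holo) (x : E) (m : mnm) (c : mnm -> C) (phi psi : germ)
  (F : automorphism R d).

Lemma germ_ofK phi : germ_of (repr phi) = phi.
Proof. by rewrite /germ_of reprK. Qed.

Lemma germ_ind (P : germ -> Prop) : (forall f, P (germ_of f)) -> forall phi, P phi.
Proof. by move=> H phi; rewrite -(germ_ofK phi). Qed.

Lemma germ_ofD f g : germ_of f + germ_of g = germ_of (f + g).
Proof. by rewrite /germ_of rmorphD. Qed.

Lemma germ_ofB f g : germ_of f - germ_of g = germ_of (f - g).
Proof. by rewrite /germ_of rmorphB. Qed.

Lemma germ_ofM f g : germ_of f * germ_of g = germ_of (f * g).
Proof. by rewrite /germ_of rmorphM. Qed.

Lemma germ_of1 : germ_of (1 : holo) = 1.
Proof. by rewrite /germ_of rmorph1. Qed.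

Lemma germ_of0 : germ_of (0 : holo) = 0.
Proof. by rewrite /germ_of rmorph0. Qed.

Definition gcoef phi : mnm -> C := projT1 (cid (expands_exists (holoP (repr phi)))).

Lemma gcoef_expands f : expands f (gcoef (germ_of f)).
Proof.
rewrite /gcoef; case: cid => c /= Hc; apply: expands_near Hc.
by apply/germ_ofP; rewrite germ_ofK.
Qed.

Lemma gcoefE f k (P : mpol) m : ordge k (fun x => f x - mpoly_fun P x) -> (mdeg m < k)%N ->
  gcoef (germ_of f) m = mpoly.mcoeff m P.
Proof. by move=> h; apply: (expands_coef (gcoef_expands f) h). Qed.

Lemma gcoef_unique f c : expands f c -> gcoef (germ_of f) = c.
Proof.
move=> H; apply/funext => m; rewrite (gcoefE (expands_ordge (mdeg m).+1 H)) //.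
by rewrite mcoeff_trunc ltnSn.
Qed.

Lemma gcoef_inj phi psi : gcoef phi = gcoef psi -> phi = psi.
Proof.
elim/germ_ind: phi => f; elim/germ_ind: psi => g e.
apply/germ_ofP; apply: (expands_inj (gcoef_expands f)); rewrite e; exact: gcoef_expands.
Qed.

(** With [gcoef_inj] and [gcoef_growth], this identifies germs with convergent power series. The
    quotients in the division theorem are produced in this way. *)
Lemma gcoef_surj c : growth c -> exists phi, gcoef phi = c.
Proof.
move=> /expands_surj[f [hf Hc]].
have hf' : f \in @holo_pred R d by apply/holo_predP.
by exists (germ_of (Holo hf')); apply: gcoef_unique.
Qed.

Lemma gcoef_growth phi : growth (gcoef phi).
Proof.
elim/germ_ind: phi => f; have [K [B [K0 B0 H _]]] := gcoef_expands f.
by exists K, B.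
Qed.

Lemma gcoefD phi psi m : gcoef (phi + psi) m = gcoef phi m + gcoef psi m.
Proof.
elim/germ_ind: phi => f; elim/germ_ind: psi => g; rewrite germ_ofD.
by rewrite (@gcoef_unique (f + g) _ (expandsD (gcoef_expands f) (gcoef_expands g))).
Qed.

Lemma gcoef0 m : gcoef 0 m = 0.
Proof. by apply: (addrI (gcoef 0 m)); rewrite -gcoefD !addr0. Qed.

Lemma gcoefN phi m : gcoef (- phi) m = - gcoef phi m.
Proof. by apply: (addrI (gcoef phi m)); rewrite -gcoefD !subrr gcoef0. Qed.

Lemma gcoefB phi psi m : gcoef (phi - psi) m = gcoef phi m - gcoef psi m.
Proof. by rewrite gcoefD gcoefN. Qed.

Lemma gcoef_sum (I : Type) (s : seq I) (P : pred I) (F : I -> germ) m :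
  gcoef (\sum_(i <- s | P i) F i) m = \sum_(i <- s | P i) gcoef (F i) m.
Proof. by apply: (big_morph (fun phi => gcoef phi m) (fun a b => gcoefD a b m) (gcoef0 m)). Qed.

Lemma gcoefM phi psi k m : (mdeg m < k)%N ->
  gcoef (phi * psi) m = mpoly.mcoeff m (trunc (gcoef phi) k * trunc (gcoef psi) k).
Proof.
elim/germ_ind: phi => f; elim/germ_ind: psi => g mk; rewrite germ_ofM.
exact: (expandsM (gcoef_expands f) (gcoef_expands g) (gcoef_expands (f * g)) mk).
Qed.

Lemma gcoef_mpoly (P : mpol) m : gcoef (germ_mpoly P) m = mpoly.mcoeff m P.
Proof.
apply: (@gcoefE _ (mdeg m).+1) => //; exists 0, 1; split => // x _ /=.
by rewrite subrr cabs0 mul0r.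
Qed.

Lemma germ_mpolyD (P Q : mpol) : germ_mpoly (P + Q) = germ_mpoly P + germ_mpoly Q.
Proof. by apply: gcoef_inj; apply/funext => m; rewrite gcoefD !gcoef_mpoly mcoeffD. Qed.

Lemma germ_mpolyM (P Q : mpol) : germ_mpoly (P * Q) = germ_mpoly P * germ_mpoly Q.
Proof.
rewrite germ_ofM; apply/germ_ofP; apply: filterE => x /=.
by rewrite mpoly_funM.
Qed.

Lemma germ_mpoly1 : germ_mpoly (1 : mpol) = 1.
Proof.
rewrite -germ_of1; apply/germ_ofP; apply: filterE => x /=.
by rewrite /mpoly_fun meval1.
Qed.

Lemma germ_mpoly0 : germ_mpoly (0 : mpol) = 0.
Proof. by apply: gcoef_inj; apply/funext => m; rewrite gcoef0 gcoef_mpoly mcoeff0. Qed.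

Lemma germ_mpoly_sum (I : Type) (s : seq I) (P : pred I) (F : I -> mpol) :
  germ_mpoly (\sum_(i <- s | P i) F i) = \sum_(i <- s | P i) germ_mpoly (F i).
Proof. exact: (big_morph (@germ_mpoly R d) germ_mpolyD germ_mpoly0). Qed.

(** Multiplication by these constant germs serves as scalar multiplication. *)
Definition cstg (a : C) : germ := germ_mpoly (mpoly.mpolyC d a).

Lemma cstgD a b : cstg (a + b) = cstg a + cstg b.
Proof. by rewrite /cstg mpolyCD germ_mpolyD. Qed.

Lemma cstgM a b : cstg (a * b) = cstg a * cstg b.
Proof. by rewrite /cstg mpolyCM germ_mpolyM. Qed.

Lemma cstg1 : cstg 1 = 1.
Proof. by rewrite /cstg mpolyC1 germ_mpoly1. Qed.

Lemma cstg0 : cstg 0 = 0.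
Proof. by rewrite /cstg mpolyC0 germ_mpoly0. Qed.

Lemma cstgN a : cstg (- a) = - cstg a.
Proof. by apply: (addrI (cstg a)); rewrite -cstgD !subrr cstg0. Qed.

Lemma germ_mpolyZ a (P : mpol) : germ_mpoly (a *: P) = cstg a * germ_mpoly P.
Proof. by rewrite /cstg -germ_mpolyM mul_mpolyC. Qed.

Lemma gcoefZ a phi m : gcoef (cstg a * phi) m = a * gcoef phi m.
Proof.
rewrite (gcoefM _ _ (ltnSn (mdeg m))).
have -> : trunc (gcoef (cstg a)) (mdeg m).+1 = mpoly.mpolyC d a.
  apply/mpolyP => m'; rewrite mcoeff_trunc; case: ifP => h; first exact: gcoef_mpoly.
  rewrite mcoeffC; case: eqP => [e|_]; last by rewrite mulr0.
  by move: h; rewrite e mdeg0.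
by rewrite mcoeffCM mcoeff_trunc ltnSn.
Qed.

Definition ordg k phi := forall m, (mdeg m < k)%N -> gcoef phi m = 0.

Lemma ordgP f k : ordg k (germ_of f) <-> ordge k f.
Proof.
have Hf := gcoef_expands f; split=> [h|h m mk].
  have := expands_ordge k Hf; congr (ordge _ _); apply/funext => x.
  rewrite mpoly_fun_trunc big1 ?subr0 // => m _; rewrite h ?mul0r //; exact: bmdeg.
rewrite (@gcoefE f k 0) ?mcoeff0 //; move: h; congr (ordge _ _); apply/funext => x.
by rewrite /mpoly_fun meval0 subr0.
Qed.

Lemma ordgD k phi psi : ordg k phi -> ordg k psi -> ordg k (phi + psi).
Proof. by move=> h1 h2 m mk; rewrite gcoefD h1 ?h2 ?addr0. Qed.

Lemma ordgN k phi : ordg k phi -> ordg k (- phi).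
Proof. by move=> h1 m mk; rewrite gcoefN h1 ?oppr0. Qed.

Lemma ordgB k phi psi : ordg k phi -> ordg k psi -> ordg k (phi - psi).
Proof. by move=> h1 h2; apply: ordgD => //; exact: ordgN. Qed.

Lemma ordg0 k : ordg k 0.
Proof. by move=> m _; rewrite gcoef0. Qed.

Lemma ordg_sum k (I : Type) (s : seq I) (P : pred I) (F : I -> germ) :
  (forall i, P i -> ordg k (F i)) -> ordg k (\sum_(i <- s | P i) F i).
Proof.
move=> H; elim/big_rec: _ => [|i x Pi h]; first exact: ordg0.
by apply: ordgD => //; exact: H.
Qed.

Lemma ordg_le j k phi : (j <= k)%N -> ordg k phi -> ordg j phi.
Proof. by move=> jk h m mj; apply: h; exact: leq_trans mj jk. Qed.

Lemma ordg_all phi : (forall k, ordg k phi) -> phi = 0.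
Proof.
by move=> H; apply: gcoef_inj; apply/funext => m; rewrite (H (mdeg m).+1) ?gcoef0.
Qed.

Lemma ordg_trunc k phi : ordg k (phi - germ_mpoly (trunc (gcoef phi) k)).
Proof. by move=> m mk; rewrite gcoefB gcoef_mpoly mcoeff_trunc mk subrr. Qed.

Lemma pullbackD F phi psi : pullback (phi + psi) F = pullback phi F + pullback psi F.
Proof.
elim/germ_ind: phi => f; elim/germ_ind: psi => g; rewrite germ_ofD !pullback_germ_of germ_ofD.
by apply/germ_ofP; apply: filterE.
Qed.

Lemma pullbackM F phi psi : pullback (phi * psi) F = pullback phi F * pullback psi F.
Proof.
elim/germ_ind: phi => f; elim/germ_ind: psi => g; rewrite germ_ofM !pullback_germ_of germ_ofM.
by apply/germ_ofP; apply: filterE.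
Qed.

Lemma pullback0 F : pullback (0 : germ) F = 0.
Proof. by apply: (addrI (pullback (0 : germ) F)); rewrite -pullbackD !addr0. Qed.

Lemma pullbackN F phi : pullback (- phi) F = - pullback phi F.
Proof. by apply: (addrI (pullback phi F)); rewrite -pullbackD !subrr pullback0. Qed.

Lemma pullbackB F phi psi : pullback (phi - psi) F = pullback phi F - pullback psi F.
Proof. by rewrite pullbackD pullbackN. Qed.

Lemma pullback_cst F a : pullback (cstg a) F = cstg a.
Proof.
rewrite pullback_germ_of; apply/germ_ofP; apply: filterE => x /=.
by rewrite !mpoly_funC.
Qed.

Lemma pullback1 F : pullback (1 : germ) F = 1.
Proof. by rewrite -cstg1 pullback_cst. Qed.

Lemma pullback_sum F (I : Type) (s : seq I) (P : pred I) (G : I -> germ) :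
  pullback (\sum_(i <- s | P i) G i) F = \sum_(i <- s | P i) pullback (G i) F.
Proof. exact: (big_morph (fun phi => pullback phi F) (pullbackD F) (pullback0 F)). Qed.

Lemma pullback_prod F (I : Type) (s : seq I) (P : pred I) (G : I -> germ) :
  pullback (\prod_(i <- s | P i) G i) F = \prod_(i <- s | P i) pullback (G i) F.
Proof. exact: (big_morph (fun phi => pullback phi F) (pullbackM F) (pullback1 F)). Qed.

Lemma pullback_near F (G H : automorphism R d) phi : (\forall x \near (0 : E), G (F x) = H x) ->
  pullback (pullback phi G) F = pullback phi H.
Proof.
elim/germ_ind: phi => f h; rewrite !pullback_germ_of; apply/germ_ofP.
by apply: filterS h => x /= ->.
Qed.

Lemma ordge1 (f : E -> C) : holomorphic_near0 f -> f 0 = 0 -> ordge 1 f.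
Proof.
move=> /expands_exists[c Hc] f0; have [K [B [K0 B0 _ H]]] := Hc.
have T1 x : mpoly_fun (trunc c 1) x = c (@mpoly.mnm0 d).
  rewrite mpoly_fun_trunc (bigD1 (@mpoly.bm0 d 0)) //=.
  have -> : \prod_(i < d) x 0 i ^+ (@mpoly.mnm0 d) i = 1.
    by rewrite big1 // => i _; rewrite mnm0E expr0.
  rewrite mulr1 big1 ?addr0 // => m m0.
  move: (bmdeg m); rewrite ltnS leqn0 mdeg_eq0 => /eqP e.
  by case/negP: m0; apply/eqP/val_inj.
have c0 : c (@mpoly.mnm0 d) = 0.
  have := H 1%N 0; rewrite vabs0 mulr0 expr1 mulr0 => /(_ ler01); rewrite T1 f0 sub0r cabsN => h.
  by apply/eqP; rewrite -cabs_eq0 eq_le h cabs_ge0.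
have := expands_ordge 1 Hc; congr (ordge _ _); apply/funext => x.
by rewrite T1 c0 subr0.
Qed.

Lemma vec_ordge (F : E -> E) k : (forall i, ordge k (fun x => F x 0 i)) ->
  exists K r : R, [/\ 0 < K, 0 < r & forall x, vabs x < r -> vabs (F x) <= K * vabs x ^+ k].
Proof.
move=> H; have [K HK] := choice H; have [r Hr] := choice HK.
have Hs i : 0 <= (r i)^-1 by case: (Hr i) => h _; rewrite invr_ge0 ltW.
pose s := 1 + \sum_i (r i)^-1; pose L := 1 + \sum_i `|K i|.
have s0 : 0 < s by rewrite ltr_pwDl // sumr_ge0.
have L0 : 0 < L by rewrite ltr_pwDl // sumr_ge0.
exists L, s^-1; split; rewrite ?invr_gt0 // => x hx.
apply: vabs_le => [|i]; first by rewrite mulr_ge0 ?exprn_ge0 ?vabs_ge0 ?ltW.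
have [r0 h] := Hr i; apply: (le_trans (h x _)).
  apply: lt_le_trans hx _; rewrite -[leRHS]invrK lef_pV2 ?posrE ?invr_gt0 //.
  by rewrite /s (bigD1 i) //= addrCA lerDl addr_ge0 // sumr_ge0.
rewrite ler_wpM2r ?exprn_ge0 ?vabs_ge0 // (le_trans (ler_norm _)) //.
by rewrite /L (bigD1 i) //= addrCA lerDl addr_ge0 // sumr_ge0.
Qed.

Lemma holo_coord (G : E -> E) i : holomorphic_near0 G -> holomorphic_near0 (fun x => G x 0 i).
Proof. by apply: filterS => x; exact: differentiable_coordP. Qed.

Lemma map_lipschitz (G : E -> E) : holomorphic_near0 G -> G 0 = 0 ->
  exists K r : R, [/\ 0 < K, 0 < r & forall x, vabs x < r -> vabs (G x) <= K * vabs x].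
Proof.
move=> hG G0; apply: (@vec_ordge G 1) => i; apply: ordge1; last by rewrite G0 mxE.
exact: holo_coord.
Qed.

Lemma aut_lipschitz F :
  exists K r : R, [/\ 0 < K, 0 < r & forall x, vabs x < r -> vabs (F x) <= K * vabs x].
Proof. by apply: map_lipschitz; [exact: aut_holo | exact: aut0]. Qed.

Lemma ordg_pullback F k phi : ordg k phi -> ordg k (pullback phi F).
Proof.
elim/germ_ind: phi => f; rewrite pullback_germ_of => /ordgP[K [r [r0 H]]]; apply/ordgP.
have [L [s [L0 s0 HL]]] := aut_lipschitz F.
exists (`|K| * L ^+ k), (Num.min s (r / L)); split=> [|x]; first by rewrite lt_min s0 divr_gt0.
rewrite lt_min => /andP[xs xr]; have Fx := HL _ xs.
apply: le_trans (H (F x) _) _; first by apply: le_lt_trans Fx _; rewrite mulrC -ltr_pdivlMr.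
apply: (@le_trans _ _ (`|K| * vabs (F x) ^+ k)).
  by rewrite ler_wpM2r ?exprn_ge0 ?vabs_ge0 ?ler_norm.
have LF : 0 <= L * vabs x by rewrite mulr_ge0 ?vabs_ge0 // ltW.
by rewrite -mulrA -exprMn ler_wpM2l // lerXn2r ?nnegrE ?vabs_ge0.
Qed.

End GermCoefficients.

(** * Division and Noetherianity *)

Section Dickson.
Variables (T : eqType) (d : nat) (e : T -> 'I_d -> nat).

(* Induction on the list cs of coordinates that are compared: a finite
   set dominating for the tail of cs handles all t with large i-th exponent, and the finitely
   many remaining values of that exponent are treated one by one. *)
Lemma dickson (cs : seq 'I_d) (A : set T) : exists s : seq T,
  (forall t, t \in s -> A t) /\
  forall t, A t -> exists2 u, u \in s & forall i, i \in cs -> (e u i <= e t i)%N.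
Proof.
elim: cs A => [|i cs IH] A.
  have [[t At]|nA] := pselect (exists t, A t); last by exists [::]; split => // t At; case: nA; exists t.
  exists [:: t]; split => [u|u _]; first by rewrite inE => /eqP ->.
  by exists t; rewrite ?inE.
have [s0 [s0A Hs0]] := IH A.
have [l Hl] := choice (fun n => IH (fun t => A t /\ e t i = n)).
pose M := (\max_(u <- s0) e u i)%N.
exists (s0 ++ flatten [seq l n | n <- iota 0 M]); split => [t|t At].
  rewrite mem_cat => /orP[|/flattenP[s /mapP[n _ ->]]]; first exact: s0A.
  by have [h _] := Hl n => /h[].
have [Mt|tM] := leqP M (e t i).
  have [u us0 Hu] := Hs0 t At; exists u; first by rewrite mem_cat us0.
  move=> j; rewrite inE => /orP[/eqP ->|]; last exact: Hu.
  by apply: leq_trans Mt; apply: leq_bigmax_seq.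
have [_ /(_ t (conj At erefl))[u ul Hu]] := Hl (e t i).
exists u.
  rewrite mem_cat; apply/orP; right; apply/flattenP; exists (l (e t i)) => //.
  by apply: map_f; rewrite mem_iota.
move=> j; rewrite inE => /orP[/eqP ->|]; last exact: Hu.
by have [h _] := Hl (e t i); have [_ ->] := h _ ul.
Qed.

End Dickson.

(** * Generation of ideals *)

Section IdealGen.
Variables (R : realType) (d : nat).
Local Notation germ := (germ R d).
Implicit Types (I J S : set germ) (phi psi : germ).

Lemma ideal_gen_ideal S : is_ideal (ideal_gen S).
Proof.
split=> [J [[J0 _ _] _]|u v hu hv J [HJ SJ]|a u hu J [HJ SJ]] //.
  by case: (HJ) => _ h _; apply: h; [exact: hu | exact: hv].
by case: (HJ) => _ _ h; apply: h; exact: hu.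
Qed.

Lemma ideal_gen_sub S : S `<=` ideal_gen S.
Proof. by move=> u Su J [_]; exact. Qed.

Lemma ideal_gen_min S I : is_ideal I -> S `<=` I -> ideal_gen S `<=` I.
Proof. by move=> hI SI u; apply. Qed.

Lemma ideal_gen_le S S' : S `<=` S' -> ideal_gen S `<=` ideal_gen S'.
Proof.
move=> SS; apply: ideal_gen_min; first exact: ideal_gen_ideal.
exact: subset_trans SS (@ideal_gen_sub S').
Qed.

Lemma is_idealN I u : is_ideal I -> I u -> I (- u).
Proof. by move=> [_ _ h] Iu; rewrite -mulN1r; exact: h. Qed.

Lemma is_idealB I u v : is_ideal I -> I u -> I v -> I (u - v).
Proof. by move=> hI Iu Iv; case: (hI) => _ h _; apply: h => //; exact: is_idealN. Qed.

Lemma is_ideal_sum I (T : Type) (s : seq T) (P : pred T) (F : T -> germ) : is_ideal I ->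
  (forall i, P i -> I (F i)) -> I (\sum_(i <- s | P i) F i).
Proof. by move=> [h0 hD _] H; elim/big_rec: _ => // i x Pi Ix; apply: hD => //; exact: H. Qed.

Lemma ideal_gen_finite S u : ideal_gen S u ->
  exists s : seq germ, (forall v, v \in s -> S v) /\ ideal_gen [set v | v \in s] u.
Proof.
pose J u := exists s : seq germ, (forall v, v \in s -> S v) /\ ideal_gen [set v | v \in s] u.
apply: (@ideal_gen_min S J); last first.
  move=> v Sv; exists [:: v]; split; first by move=> w; rewrite inE => /eqP ->.
  by apply: ideal_gen_sub; rewrite /= inE.
split.
- by exists [::]; split => //; case: (ideal_gen_ideal [set v | v \in [::]]).
- move=> v w [s [sS hv]] [t [tS hw]]; exists (s ++ t); split.
    by move=> z; rewrite mem_cat => /orP[/sS|/tS].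
  case: (ideal_gen_ideal [set v | v \in s ++ t]) => _ h _; apply: h.
    by apply: ideal_gen_le hv => z /= zs; rewrite mem_cat zs.
  by apply: ideal_gen_le hw => z /= zs; rewrite mem_cat zs orbT.
- move=> a v [s [sS hv]]; exists s; split => //.
  by case: (ideal_gen_ideal [set v | v \in s]) => _ _; apply.
Qed.

End IdealGen.

(** * Division with remainder in the ring of germs *)

Section Division.
Variables (R : realType) (d : nat).
Local Notation C := (CC R).
Local Notation mnm := (mpoly.multinom d).
Local Notation mdeg := mpoly.mdeg.
Local Notation germ := (germ R d).
Local Notation madd := (@mpoly.mnm_add d).
Local Notation msub := (@mpoly.mnm_sub d).
Implicit Types (m a b : mnm) (c : mnm -> C) (phi psi : germ).

Lemma gcoefM_conv phi psi m : gcoef (phi * psi) m =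
  \sum_(k : mpoly.bmultinom d (mdeg m).+1 * mpoly.bmultinom d (mdeg m).+1 | m == madd k.1 k.2)
    gcoef phi k.1 * gcoef psi k.2.
Proof.
rewrite (gcoefM _ _ (ltnSn (mdeg m))) mcoeffM; apply: eq_bigr => k _.
by rewrite !mcoeff_trunc !bmdeg.
Qed.

(** Since the weight is multiplicative, bounds by powers of it behave well under convolution, which
    is what the division estimate exploits. *)
Lemma growth_wt c : growth c <->
  exists (K : R) (s : nat), 0 <= K /\ forall m, cabs (c m) <= K * (wt m)%:R ^+ s.
Proof.
split=> [[K [B [K0 B0 H]]]|[K [s [K0 H]]]].
  have [s Hs] : exists s : nat, B <= 2 ^+ s.
    exists (Num.truncn B).+1; apply: (le_trans (ltW (truncnS_gt B))).
    by rewrite -natrX ler_nat ltnW // ltn_expl.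
  exists K, s; split => // m; apply: le_trans (H m) _; rewrite ler_wpM2l //.
  apply: (@le_trans _ _ ((2 ^+ s) ^+ mdeg m)).
    by rewrite lerXn2r ?nnegrE ?exprn_ge0 // ltW.
  by rewrite -exprM mulnC exprM lerXn2r ?nnegrE // -natrX ler_nat wt_ge.
exists K, ((nth_prime d)%:R ^+ s); split => //.
  by rewrite exprn_gt0 // ltr0n prime_gt0 // nth_prime_prime.
move=> m; apply: le_trans (H m) _; rewrite ler_wpM2l // -exprM mulnC exprM.
by rewrite lerXn2r ?nnegrE // -natrX ler_nat wt_le.
Qed.

(** The initial monomial is the lightest one, as in any local order on power series. *)
Definition is_lead phi m := gcoef phi m != 0 /\ forall m', (wt m' < wt m)%N -> gcoef phi m' = 0.

Lemma lead_exists phi : phi != 0 -> exists m, is_lead phi m.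
Proof.
move=> phi0; pose P n := `[< exists m, wt m = n /\ gcoef phi m != 0 >].
have exP : exists n, P n.
  apply: contrapT => h; case/negP: phi0; apply/eqP/gcoef_inj/funext => m.
  rewrite gcoef0; apply/eqP; apply: contrapT => /negP hm.
  by case: h; exists (wt m); apply/asboolP; exists m.
case: (ex_minnP exP) => n /asboolP[m [<- hm]] Hmin; exists m; split => // m' h.
apply/eqP; apply: contrapT => /negP hm'.
have : (wt m <= wt m')%N by apply: Hmin; apply/asboolP; exists m'.
by rewrite leqNgt h.
Qed.

Lemma lead_uniq phi m m' : is_lead phi m -> is_lead phi m' -> m = m'.
Proof.
move=> [h1 h2] [h1' h2']; apply: wt_inj; case: (ltngtP (wt m) (wt m')) => // h.
  by move: h1; rewrite h2' // eqxx.
by move: h1'; rewrite h2 // eqxx.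
Qed.

(** Recursion on the weight: the iterates of [Phi] from zero are stationary at m from the step wt m
    + 1 on. *)
Lemma wt_fix (Phi : (mnm -> C) -> mnm -> C) :
  (forall h h' m, (forall m', (wt m' < wt m)%N -> h m' = h' m') -> Phi h m = Phi h' m) ->
  exists h, forall m, h m = Phi h m.
Proof.
move=> HP; pose H n := iter n Phi (fun=> 0).
have HH n n' m : (wt m < n)%N -> (wt m < n')%N -> H n m = H n' m.
  elim: n n' m => // n IH [|n'] m //; rewrite !ltnS => h h' /=; apply: HP => m' mm.
  by apply: IH; exact: leq_trans mm _.
exists (fun m => H (wt m).+1 m) => m /=; apply: HP => m' mm.
exact: (HH (wt m) (wt m').+1 m' mm (ltnSn _)).
Qed.

(** In the coefficient of a product by phi, terms lighter than the initial monomial a vanish, and a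
    term of the same weight is a itself since weights are injective. *)
Lemma conv_low (phi : germ) (q : mnm -> C) a m : is_lead phi a -> gcoef phi a = 1 ->
  \sum_(k : mpoly.bmultinom d (mdeg m).+1 * mpoly.bmultinom d (mdeg m).+1
      | (m == madd k.1 k.2) && ~~ (wt a < wt k.2)%N) q k.1 * gcoef phi k.2 =
  if mpoly.lem a m then q (msub m a) else 0.
Proof.
move=> [_ la] a1.
have key (k : mpoly.bmultinom d (mdeg m).+1 * mpoly.bmultinom d (mdeg m).+1) :
    ~~ (wt a < wt k.2)%N -> (k.2 : mnm) = a \/ gcoef phi k.2 = 0.
  rewrite -leqNgt leq_eqVlt => /orP[/eqP /wt_inj|/la]; by [left | right].
have ledeg (m' : mnm) : mpoly.lem m' m -> (mdeg m' < (mdeg m).+1)%N.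
  by move=> /submK e; rewrite ltnS -e mdegD leq_addl.
case: ifP => h; last first.
  rewrite big1 // => k /andP[/eqP e hw]; have [ka|->] := key k hw; last by rewrite mulr0.
  case/negP: (negbT h); rewrite -ka; apply/mnm_lepP => i.
  by rewrite [in leqRHS]e mnmDE leq_addl.
have d1 : (mdeg (msub m a) < (mdeg m).+1)%N by rewrite ltnS mdegB.
rewrite (bigD1 (mpoly.BMultinom d1, mpoly.BMultinom (ledeg a h))) /=; last first.
  by rewrite submK // eqxx ltnn.
rewrite a1 mulr1 big1 ?addr0 // => k /andP[/andP[e hw] ne].
have [ka|->] := key k hw; last by rewrite mulr0.
case/negP: ne; rewrite -pair_eqE /pair_eq /=; apply/andP; split; last by apply/eqP/val_inj.
by apply/eqP/val_inj => /=; rewrite -[LHS](addmK a) -{1}ka; congr (msub _ a); exact/esym/eqP.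
Qed.

(** Put A = wt a, W = wt m, and let L > A be the weight of [k.2]. Then wt k.1 * A = W (A / L), and
    the s + e + 1 factors A / L are spent as follows: s of them offset the growth L^s of f, one
    provides 1 / L <= 2^-deg for summability, and e of them are each at most A / (A + 1) < 1. A
    large e thus makes the total as small as desired. *)
Lemma conv_high_bound a (s e : nat) (m : mnm) (q f : mnm -> C) (K Kf : R) : 0 <= K -> 0 <= Kf ->
  (forall b, (wt (madd b a) < wt m)%N -> cabs (q b) <= K * ((wt b * wt a)%:R ^+ (s + e).+1)) ->
  (forall b, cabs (f b) <= Kf * (wt b)%:R ^+ s) ->
  cabs (\sum_(k : mpoly.bmultinom d (mdeg m).+1 * mpoly.bmultinom d (mdeg m).+1
      | (m == madd k.1 k.2) && (wt a < wt k.2)%N) q k.1 * f k.2) <=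
  K * (wt m)%:R ^+ (s + e).+1 *
   (Kf * ((wt a)%:R ^+ s.+1 * ((wt a)%:R / (wt a).+1%:R) ^+ e * 2 ^+ d)).
Proof.
move=> K0 Kf0 Hq Hf; apply: le_trans (cabs_sum _ _ _) _.
set W := (wt m)%:R; set A := (wt a)%:R; set th := A / _.
have A0 : 0 < A by rewrite ltr0n wt_gt0.
have W0 : 0 < W by rewrite ltr0n wt_gt0.
have th0 : 0 <= th by rewrite divr_ge0.
pose G (b : mnm) : R := K * W ^+ (s + e).+1 * (Kf * (A ^+ s.+1 * th ^+ e)) * 2^-1 ^+ mdeg b.
have G0 b : 0 <= G b.
  have A0' := ltW A0; have W0' := ltW W0.
  by rewrite /G; do ![apply: mulr_ge0 => // | apply: exprn_ge0 => //]; rewrite invr_ge0.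
have HG (k : mpoly.bmultinom d (mdeg m).+1 * mpoly.bmultinom d (mdeg m).+1) :
    (m == madd k.1 k.2) && (wt a < wt k.2)%N -> cabs (q k.1 * f k.2) <= G k.2.
  move=> /andP[/eqP e' ak]; rewrite cabsM.
  have Wk : W = (wt k.1)%:R * (wt k.2)%:R by rewrite /W [in LHS]e' wtD natrM.
  set B := (wt k.1)%:R in Wk *; set L := (wt k.2)%:R in Wk *.
  have B0 : 0 < B by rewrite ltr0n wt_gt0.
  have L0 : 0 < L by rewrite ltr0n wt_gt0.
  have AL : A + 1 <= L by rewrite natr1 ler_nat.
  have h1 : cabs (q k.1) <= K * (B * A) ^+ (s + e).+1.
    rewrite /B /A -natrM; apply: Hq; rewrite wtD [in ltnRHS]e' wtD ltn_pmul2l //; exact: wt_gt0.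
  apply: le_trans (ler_pM (cabs_ge0 _) (cabs_ge0 _) h1 (Hf k.2)) _.
  rewrite -/L /G.
  have hL : L^-1 <= 2^-1 ^+ mdeg k.2.
    rewrite exprVn lef_pV2 ?posrE ?exprn_gt0 // -natrX ler_nat; exact: wt_ge.
  have hth : A / L <= th.
    by rewrite /th ler_pM2l // lef_pV2 ?posrE // -natr1.
  have -> : K * (B * A) ^+ (s + e).+1 * (Kf * L ^+ s) =
      K * W ^+ (s + e).+1 * (Kf * (A ^+ s.+1 * (A / L) ^+ e)) * L^-1.
    rewrite Wk !exprMn exprVn !exprS !exprD; field.
    by rewrite expf_neq0 gt_eqF.
  apply: ler_pM; rewrite ?invr_ge0 ?(ltW L0) //.
    have A0' := ltW A0; have W0' := ltW W0; have L0' := ltW L0.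
    by do ![apply: mulr_ge0 => // | apply: exprn_ge0 => //]; rewrite ?invr_ge0.
  rewrite ler_wpM2l ?mulr_ge0 ?exprn_ge0 ?(ltW W0) // ler_wpM2l // ler_wpM2l ?exprn_ge0 ?(ltW A0) //.
  by rewrite lerXn2r ?nnegrE // divr_ge0 // ltW.
apply: le_trans (ler_sum _ HG) _.
apply: (@le_trans _ _ (\sum_(b : mpoly.bmultinom d (mdeg m).+1) G b)).
  set bm := mpoly.bmultinom d (mdeg m).+1.
  pose S := [set k : bm * bm | (m == madd k.1 k.2) && (wt a < wt k.2)%N]%SET.
  have inj : {in S &, injective (fun k : bm * bm => k.2)}.
    move=> k k'; rewrite !inE => /andP[/eqP e1 _] /andP[/eqP e2 _] e3.
    apply/eqP; rewrite -pair_eqE /pair_eq /= e3 eqxx andbT; apply/eqP/val_inj => /=.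
    have kE (x : bm * bm) : m = madd x.1 x.2 -> (x.1 : mnm) = msub m x.2.
      move=> e4; exact: (etrans (esym (addmK x.2 x.1)) (congr1 (fun z => msub z x.2) (esym e4))).
    by rewrite (kE k e1) (kE k' e2) e3.
  have -> : \sum_(k : bm * bm | (m == madd k.1 k.2) && (wt a < wt k.2)%N) G k.2 =
      \sum_(b in (fun k : bm * bm => k.2) @: S) G b.
    by rewrite big_imset //=; apply: eq_bigl => k; rewrite inE.
  by rewrite big_mkcond; apply: ler_sum => b _; case: ifP.
rewrite /G -mulr_sumr -!mulrA ler_wpM2l // ler_wpM2l ?exprn_ge0 ?(ltW W0) //.
rewrite ler_wpM2l // ler_wpM2l ?exprn_ge0 ?(ltW A0) // ler_wpM2l ?exprn_ge0 //.
exact: half_mdeg_sum_le.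
Qed.

(* The coefficients h of the dividend reduced so far are defined by recursion on the weight, and
   |h m| <= 2 Kg wt(m)^N by induction provided the exponent N is large. *)
Lemma germ_division (fs : seq germ) (lm : germ -> mnm) (g : germ) :
  (forall f, f \in fs -> is_lead f (lm f) /\ gcoef f (lm f) = 1) ->
  exists q : nat -> germ, forall m, has (fun f => mpoly.lem (lm f) m) fs ->
    gcoef (g - \sum_(i < size fs) q i * fs`_i) m = 0.
Proof.
move=> Hfs.
pose n := size fs; pose a (i : 'I_n) := lm fs`_i.
have fsi (i : 'I_n) : fs`_i \in fs by rewrite mem_nth.
(* The first divisor whose initial monomial divides m, or [size fs] if there is none. A reduced
   coefficient at m is charged to the quotient of that divisor only, which is what [Q] records. *)
pose pick m := find (fun f => mpoly.lem (lm f) m) fs.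
pose Q (h : mnm -> C) (i : nat) (b : mnm) : C :=
  if pick (madd b (lm fs`_i)) == i then h (madd b (lm fs`_i)) else 0.
(* The contribution to m of the non-initial terms of the i-th divisor; it involves h at smaller
   weights only, hence the recursion. *)
pose hi (h : mnm -> C) m (i : 'I_n) : C :=
  \sum_(k : mpoly.bmultinom d (mdeg m).+1 * mpoly.bmultinom d (mdeg m).+1
      | (m == madd k.1 k.2) && (wt (a i) < wt k.2)%N) Q h i k.1 * gcoef fs`_i k.2.
have [|h hE] := @wt_fix (fun h m => gcoef g m - \sum_(i < n) hi h m i).
  move=> h h' m hh; congr (_ - _); apply: eq_bigr => i _; apply: eq_bigr => k /andP[/eqP e ak].
  congr (_ * _); rewrite /Q; case: ifP => // _; apply: hh.
  by rewrite [in ltnRHS]e !wtD ltn_pmul2l // wt_gt0.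
have [Kf [s [Kf0 Hf]]] : exists (Kf : R) (s : nat), 0 <= Kf /\
    forall (i : 'I_n) b, cabs (gcoef fs`_i b) <= Kf * (wt b)%:R ^+ s.
  have H (i : 'I_n) : exists Ks : R * nat, 0 <= Ks.1 /\
      forall b, cabs (gcoef fs`_i b) <= Ks.1 * (wt b)%:R ^+ Ks.2.
    have /growth_wt[K [s H]] := gcoef_growth fs`_i; by exists (K, s).
  have [Ks HK] := choice H.
  exists (\sum_i (Ks i).1), (\max_i (Ks i).2); split.
    by apply: sumr_ge0 => i _; case: (HK i).
  move=> i b; have [K0 /(_ b) h1] := HK i; apply: (le_trans h1).
  apply: ler_pM => //.
    by rewrite (bigD1 i) //= lerDl sumr_ge0 // => j _; case: (HK j).
  by rewrite ler_weXn2l ?ler1n ?wt_gt0 // (leq_bigmax i).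
have /growth_wt[Kg [s' [Kg0 Hg]]] := gcoef_growth g.
wlog ss : s Hf / (s' <= s)%N.
  move=> W; apply: (W (maxn s s')); last exact: leq_maxr.
  move=> i b; apply: le_trans (Hf i b) _; rewrite ler_wpM2l //.
  by rewrite ler_weXn2l ?ler1n ?wt_gt0 // leq_maxl.
pose D (i : 'I_n) (e : nat) : R :=
  Kf * ((wt (a i))%:R ^+ s.+1 * ((wt (a i))%:R / (wt (a i)).+1%:R) ^+ e * 2 ^+ d).
(* With total factor 1/2 the bound 2 Kg reproduces itself: Kg + 2 Kg / 2 = 2 Kg. *)
have [e He] : exists e, \sum_(i < n) D i e <= 2^-1.
  have H (i : 'I_n) : exists e0, forall e, (e0 <= e)%N -> D i e <= 2^-1 / n%:R.
    have n0 : 0 < n%:R :> R by rewrite ltr0n (leq_ltn_trans _ (ltn_ord i)).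
    pose A : R := (wt (a i))%:R; pose th : R := A / (wt (a i)).+1%:R.
    have A0 : 0 < A by rewrite ltr0n wt_gt0.
    have th0 : 0 < th by rewrite divr_gt0.
    have th1 : th < 1 by rewrite ltr_pdivrMr // mul1r ltr_nat.
    pose c0 := Kf * (A ^+ s.+1 * 2 ^+ d) + 1.
    have c00 : 0 < c0 by rewrite ltr_wpDl // mulr_ge0 // mulr_ge0 ?exprn_ge0 // ltW.
    have ep : 0 < 2^-1 / n%:R / c0 by rewrite !divr_gt0 ?invr_gt0.
    have /cvgrPdist_le /(_ _ ep) [e0 _ He0] : th ^+ e @[e --> \oo] --> (0 : R).
      by apply: cvg_expr; rewrite gtr0_norm.
    exists e0 => e ee; have := He0 e ee; rewrite sub0r normrN ger0_norm ?exprn_ge0 ?(ltW th0) //.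
    rewrite ler_pdivlMr // => {}He0; apply: le_trans He0; rewrite /D -/A -/th /c0.
    have -> : Kf * (A ^+ s.+1 * th ^+ e * 2 ^+ d) = th ^+ e * (Kf * (A ^+ s.+1 * 2 ^+ d)) by ring.
    by rewrite ler_wpM2l ?exprn_ge0 ?(ltW th0) // lerDl.
  have [e0 He0] := choice H; exists (\max_i e0 i).
  have [n0|n0] := posnP n.
    by rewrite big1 ?invr_ge0 // => i _; have := ltn_ord i; rewrite [X in (_ < X)%N]n0.
  apply: (@le_trans _ _ (\sum_(i < n) 2^-1 / n%:R)).
    by apply: ler_sum => i _; apply: He0; exact: (leq_bigmax i).
  by rewrite sumr_const card_ord -[leLHS]mulr_natr divfK // pnatr_eq0 -lt0n.
pose N := (s + e).+1.
have Hh m : cabs (h m) <= 2 * Kg * (wt m)%:R ^+ N.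
  elim/ltn_ind: (wt m) {-2}m (erefl (wt m)) => w IH {}m wm.
  rewrite hE; apply: le_trans (cabsB _ _) _.
  have W0 : 0 <= (wt m)%:R ^+ N :> R by rewrite exprn_ge0.
  have h1 : cabs (gcoef g m) <= Kg * (wt m)%:R ^+ N.
    apply: le_trans (Hg m) _; rewrite ler_wpM2l // ler_weXn2l ?ler1n ?wt_gt0 //.
    by rewrite /N (leq_trans ss) // leqW // leq_addr.
  have h2 : cabs (\sum_(i < n) hi h m i) <= 2 * Kg * (wt m)%:R ^+ N * 2^-1.
    apply: le_trans (cabs_sum _ _ _) _.
    apply: (@le_trans _ _ (\sum_(i < n) 2 * Kg * (wt m)%:R ^+ N * D i e)); last first.
      by rewrite -mulr_sumr ler_wpM2l // mulr_ge0 // mulr_ge0.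
    apply: ler_sum => i _; apply: conv_high_bound => //; first by rewrite mulr_ge0.
    move=> b hb; rewrite /Q; case: ifP => _; last by rewrite cabs0 !mulr_ge0 // exprn_ge0.
    by rewrite -wtD; apply: (IH (wt (madd b (lm fs`_i)))) => //; rewrite -wm.
  apply: le_trans (lerD h1 h2) _.
  by rewrite le_eqVlt; apply/orP; left; apply/eqP; field.
have [q Hq] : exists q : nat -> germ, forall i : nat, (i < n)%N -> gcoef (q i) = Q h i.
  have H (i : nat) : exists q : germ, (i < n)%N -> gcoef q = Q h i.
    have [q Hq] : exists q : germ, gcoef q = Q h i; last by exists q.
    apply: gcoef_surj; apply/growth_wt.
    exists (2 * Kg * (wt (lm fs`_i))%:R ^+ N), N; split; first by rewrite !mulr_ge0 // exprn_ge0.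
    move=> b; rewrite /Q; case: ifP => _; last by rewrite cabs0 !mulr_ge0 // exprn_ge0.
    apply: le_trans (Hh _) _; rewrite wtD natrM exprMn [_ ^+ N * _]mulrC mulrA.
    by [].
  by have [q Hq] := choice H; exists q.
exists q => m Hm.
have pm : (pick m < n)%N by rewrite -has_find.
rewrite gcoefB gcoef_sum.
have E (i : 'I_n) : gcoef (q i * fs`_i) m = hi h m i + (if pick m == i :> nat then h m else 0).
  rewrite gcoefM_conv (bigID (fun k : mpoly.bmultinom d (mdeg m).+1 * mpoly.bmultinom d (mdeg m).+1 =>
    (wt (a i) < wt k.2)%N)) /= Hq //; congr (_ + _).
  have [h1 h2] := Hfs _ (fsi i); rewrite conv_low //.
  case: ifP => hl; first by rewrite /Q submK.
  case: eqP => // e'; move: hl; rewrite /a -e'.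
  by rewrite (nth_find 0 Hm).
rewrite (eq_bigr _ (fun i _ => E i)) big_split /= opprD addrA -hE.
rewrite (bigD1 (Ordinal pm)) //= eqxx big1 ?addr0 ?subrr // => i hi'.
by case: eqP => // e'; case/negP: hi'; apply/eqP/val_inj.
Qed.

(* For g in I this is Noetherianity; in general, also closedness in the Krull topology. *)
Lemma ideal_closed_fg (I : set germ) : is_ideal I -> exists s : seq germ,
  (forall f, f \in s -> I f) /\
  forall g, (forall k, exists u, I u /\ ordg k (g - u)) -> ideal_gen [set f | f \in s] g.
Proof.
move=> hI.
have [lm Hlm] : exists lm : germ -> mnm, forall f, f != 0 -> is_lead f (lm f).
  have H (f : germ) : exists m, f != 0 -> is_lead f m.
    have [->|f0] := eqVneq f 0; first by exists (@mpoly.mnm0 d).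
    by have [m Hm] := lead_exists f0; exists m.
  by have [lm Hlm] := choice H; exists lm.
(* A standard basis: the initial exponent of any nonzero element of I dominates that of some member
   of s. *)
have [s [sA Hs]] := dickson (fun f i => lm f i) (enum 'I_d) [set f | I f /\ f != 0].
pose nf (f : germ) := cstg d (gcoef f (lm f))^-1 * f.
have nf1 f : f != 0 -> gcoef (nf f) (lm f) = 1.
  by move=> f0; rewrite gcoefZ mulVf //; case: (Hlm f f0).
have nfl f : f != 0 -> is_lead (nf f) (lm f).
  move=> f0; split; first by rewrite nf1 // oner_eq0.
  by move=> m' hm'; have [_ h] := Hlm f f0; rewrite /nf gcoefZ (h m' hm') mulr0.
have nf0 f : f != 0 -> nf f != 0.
  by move=> f0; apply/eqP => e; have := nf1 f f0; rewrite e gcoef0 => /eqP; rewrite eq_sym oner_eq0.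
have lnf f : f != 0 -> lm (nf f) = lm f.
  by move=> f0; apply: lead_uniq (nfl f f0); apply: Hlm; exact: nf0.
have InF f : I f -> I (nf f) by move=> If; case: hI => _ _; apply.
exists (map nf s); split=> [_ /mapP[f /sA[If _] ->]|g Hg]; first exact: InF.
have [|q Hq] := @germ_division (map nf s) lm g.
  by move=> _ /mapP[f /sA[_ f0] ->]; rewrite lnf //; split; [exact: nfl | exact: nf1].
set fs := map nf s in Hq *; set S := \sum_(i < size fs) q i * fs`_i in Hq *.
have HS : ideal_gen [set f | f \in fs] S.
  apply: is_ideal_sum; first exact: ideal_gen_ideal.
  move=> i _; case: (ideal_gen_ideal [set f | f \in fs]) => _ _; apply.
  by apply: ideal_gen_sub; rewrite /= mem_nth.
have IS : I S.
  apply: (ideal_gen_min hI _ HS) => f /= /mapP[f' /sA[If' _] ->]; exact: InF.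
suff -> : g = S by [].
apply/eqP; rewrite -subr_eq0; apply/eqP; apply: contrapT => /eqP r0.
have lr := Hlm _ r0; set r := g - S in r0 lr Hq *; set b := lm r in lr.
(* A monomial of weight at most wt b has degree below wt b, so u - S, which lies in I, has the same
   initial monomial b as the remainder r. It is then divisible by an initial monomial of the basis,
   where the coefficient of r vanishes. *)
have [u [Iu Hu]] := Hg (wt b).
have uE m : (mdeg m < wt b)%N -> gcoef (u - S) m = gcoef r m.
  move=> hm; have := Hu m hm; rewrite !gcoefB => /eqP; rewrite subr_eq0 => /eqP ->.
  by [].
have lu : is_lead (u - S) b.
  case: lr => r1 r2; split; first by rewrite uE // mdeg_lt_wt.
  move=> m' hm'; rewrite uE ?r2 //; apply: ltn_trans hm'; exact: mdeg_lt_wt.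
have u0 : u - S != 0.
  by apply/eqP => e; case: lu => /eqP + _; rewrite e gcoef0.
have [f fs' Hf] := Hs (u - S) (conj (is_idealB hI Iu IS) u0).
have [If f0] := sA _ fs'.
have lb : lm (u - S) = b by apply: lead_uniq lu; exact: Hlm.
case: lr => /eqP + _; apply; apply: Hq; apply/hasP; exists (nf f); first by rewrite map_f.
rewrite lnf //; apply/mnm_lepP => i; rewrite -lb; apply: Hf; exact: mem_enum.
Qed.

End Division.

(** * The inverse mapping theorem *)

Section Limits.
Variables (R : realType) (d : nat).
Local Notation C := (CC R).
Local Notation E := 'rV[C]_d.
Implicit Types (f : E -> C) (x y : E).

(** Cauchy's estimate of order 1 on the complex line through x and y, parametrised so that y sits at
    1: with s = r / |y - x| the disc of radius 4 s stays in the polydisc of radius 5 r. *)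
Lemma cauchy_lipschitz f (r M : R) : 0 < r ->
  (forall x, vabs x < 5 * r -> differentiable f x /\ cabs (f x) <= M) ->
  forall x y, vabs x < r / 4 -> vabs y < r / 4 -> cabs (f y - f x) <= 8 * M / r * vabs (y - x).
Proof.
move=> r0 H x y hx hy.
have [->|ne] := eqVneq y x; first by rewrite !subrr cabs0 vabs0 mulr0.
have n0 : 0 < vabs (y - x) by rewrite lt_def vabs_ge0 vabs_eq0 subr_eq0 ne.
have nr : vabs (y - x) <= r / 2.
  by apply: le_trans (vabsD _ _) _; rewrite vabsN; lra.
pose s := r / vabs (y - x); have s0 : 0 < s by rewrite divr_gt0.
have [|c [_ Hc]] := @cauchy_taylor R (fun z => f (x + z *: (y - x))) s M s0.
  move=> z hz; have h : vabs (x + z *: (y - x)) < 5 * r.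
    apply: le_lt_trans (vabsD _ _) _; rewrite vabsZ.
    have : cabs z * vabs (y - x) < 4 * r by rewrite -ltr_pdivlMr // -mulrA.
    by move: hx; lra.
  by have [h1 h2] := H _ h; split => //; apply: cdiff_line.
have c0 : f x = c 0%N.
  have := Hc 1%N 0; rewrite cabs0 mulr0 expr1 mulr0 big_ord1 expr0 mulr1 scale0r addr0.
  move=> /(_ (divr_ge0 (ltW s0) (ler0n _ 2))) h; apply/eqP; rewrite -subr_eq0 -cabs_eq0 eq_le h.
  exact: cabs_ge0.
have := Hc 1%N 1; rewrite cabs1 mulr1 expr1 big_ord1 expr0 mulr1 scale1r (addrC x) subrK -c0.
have -> : 8 * M * s^-1 = 8 * M / r * vabs (y - x) by rewrite /s invfM invrK; ring.
by apply; rewrite ler_pdivlMr // mul1r /s ler_pdivlMr //; move: nr; lra.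
Qed.

(** The increments are bounded by a function [D] of the point, not by a constant, so that the limit
    inherits orders of vanishing. The 4 is 2 from the geometric series times 2 from completeness of
    C. *)
Lemma geometric_limit (u : nat -> E -> C) (D : E -> R) (r M : R) :
  (forall n, exists M' : R, sep r M' (u n)) ->
  (forall x, vabs x < r -> 0 <= D x <= M) ->
  (forall n x, vabs x < r -> cabs (u n.+1 x - u n x) <= D x * 2^-1 ^+ n) ->
  exists f, (exists M' : R, sep r M' f) /\
    forall n x, vabs x < r -> cabs (u n x - f x) <= 4 * D x * 2^-1 ^+ n.
Proof.
move=> Hu HD Hd.
have P n : 0 <= 2^-1 ^+ n :> R by rewrite exprn_ge0 // invr_ge0.
have step x n k : vabs x < r -> cabs (u (n + k)%N x - u n x) <= 2 * D x * (2^-1 ^+ n - 2^-1 ^+ (n + k)%N).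
  move=> hx; elim: k => [|k IH]; first by rewrite addn0 !subrr cabs0 mulr0.
  rewrite addnS -(subrK (u (n + k)%N x) (u (n + k).+1 x)) -addrA.
  apply: le_trans (cabsD _ _) _; apply: le_trans (lerD (Hd _ _ hx) IH) _.
  by rewrite exprS; move: (2^-1 ^+ n) (2^-1 ^+ (n + k)%N) (D x) => a b c; lra.
have cau x : vabs x < r -> exists l, forall n, cabs (u n x - l) <= 4 * D x * 2^-1 ^+ n.
  move=> hx; have /andP[D0 _] := HD _ hx.
  have sm m n : (n <= m)%N -> cabs (u m x - u n x) <= 2 * D x * 2^-1 ^+ n.
    move=> /subnKC <-; apply: le_trans (step _ _ _ hx) _.
    by rewrite ler_wpM2l ?mulr_ge0 // gerBl.
  have [|m n _ _|l Hl] := @complex_complete R nat (fun=> True) (u ^~ x) (fun n => 2 * D x * 2^-1 ^+ n).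
  - by exists 0%N.
  - have [h|h] := leqP n m.
      by apply: le_trans (sm _ _ h) _; rewrite lerDr mulr_ge0 // mulr_ge0.
    by rewrite cabsBC; apply: le_trans (sm _ _ (ltnW h)) _; rewrite lerDl mulr_ge0 // mulr_ge0.
  by exists l => n; have := Hl n I; lra.
have [f Hf] : exists f, forall x, vabs x < r -> forall n, cabs (u n x - f x) <= 4 * D x * 2^-1 ^+ n.
  have H x : exists l, vabs x < r -> forall n, cabs (u n x - l) <= 4 * D x * 2^-1 ^+ n.
    by have [/cau[l Hl]|h] := pselect (vabs x < r); [exists l | exists 0].
  by have [f Hf] := choice H; exists f.
exists f; split => [|n x hx]; last exact: Hf.
have [M0 H0] := Hu 0%N.
exists (M0 + 4 * M); apply: sep_approx => [x hx|e e0].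
  have h := Hf x hx 0%N; have [h0 _] := H0 x hx; have /andP[D0 DM] := HD x hx.
  have -> : f x = u 0%N x - (u 0%N x - f x) by rewrite opprB addrC subrK.
  apply: le_trans (cabsB _ _) _; apply: lerD => //.
  by apply: le_trans h _; rewrite expr0; lra.
have [n Hn] : exists n, 4 * `|M| * 2^-1 ^+ n <= e.
  apply: contrapT => h; have /negP : ~ (e <= 0) by rewrite leNgt e0.
  case/negP; rewrite (_ : e = 0) //.
  apply: (@geometric_eq0 R e (4 * `|M|)) => [|N]; first exact: ltW.
  by rewrite leNgt; apply/negP => h'; apply: h; exists N; exact: ltW.
exists (u n); split; first exact: Hu.
move=> x hx; rewrite cabsBC; apply: le_trans (Hf x hx n) _; apply: le_trans Hn.
have /andP[D0 DM] := HD x hx.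
by rewrite ler_wpM2r // ler_wpM2l // (le_trans DM) // ler_norm.
Qed.

End Limits.

(** * Local inverses, and the group of automorphisms *)

Section InverseMapping.
Variables (R : realType) (d : nat).
Local Notation C := (CC R).
Local Notation E := 'rV[C]_d.
Implicit Types (x y : E) (F G : automorphism R d).

Lemma ordge2_lipschitz (psi : E -> E) : holomorphic_near0 psi ->
  (forall i, ordge 2 (fun x => psi x 0 i)) ->
  exists2 r : R, 0 < r & forall x y, vabs x < r -> vabs y < r ->
    vabs (psi y - psi x) <= 2^-1 * vabs (y - x).
Proof.
move=> /near0P[s s0 Hs] /vec_ordge[K [t [K0 t0 Ht]]].
(* On the polydisc of radius 5 r one has |psi| <= 25 K r^2; the Cauchy constant is then 200 K r, at
   most 1/2 when 400 K r <= 1. *)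
pose r := Num.min (Num.min s t / 5) (400 * K)^-1.
have K4 : 0 < 400 * K by move: K0; lra.
have r0 : 0 < r by rewrite lt_min invr_gt0 K4 andbT divr_gt0 // lt_min s0.
have rst : 5 * r <= Num.min s t by rewrite mulrC -ler_pdivlMr // ge_min lexx.
have rK : 400 * K * r <= 1.
  by rewrite mulrC -ler_pdivlMr // div1r ge_min lexx orbT.
exists (r / 4); first by rewrite divr_gt0.
move=> x y hx hy; apply: vabs_le => [|i]; first by rewrite mulr_ge0 ?invr_ge0 ?vabs_ge0.
rewrite !mxE; apply: le_trans (@cauchy_lipschitz R d (fun x => psi x 0 i) r (25 * K * r ^+ 2) r0 _ x y hx hy) _.
  move=> z hz; have := lt_le_trans hz rst; rewrite lt_min => /andP[zs zt]; split.
    by apply: differentiable_coordP; exact: Hs.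
  apply: le_trans (cabs_coord _ _) _; apply: le_trans (Ht _ zt) _.
  have -> : 25 * K * r ^+ 2 = K * (5 * r) ^+ 2 by ring.
  rewrite ler_wpM2l ?(ltW K0) // lerXn2r ?nnegrE ?vabs_ge0 ?(ltW hz) //.
  by rewrite mulr_ge0 // ltW.
rewrite ler_wpM2r ?vabs_ge0 //.
have -> : 8 * (25 * K * r ^+ 2) / r = 200 * K * r by field; rewrite gt_eqF.
by move: rK; lra.
Qed.

(** The inverse at y is the fixed point of z -> y + psi z, where psi = id - Phi has Lipschitz
    constant 1/2. The iterates from 0 are holomorphic in y and converge uniformly. *)
Lemma inverse_tangent_id (Phi : E -> E) : holomorphic_near0 Phi -> Phi 0 = 0 ->
  (forall i, ordge 2 (fun x => x 0 i - Phi x 0 i)) ->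
  exists H : E -> E, [/\ H 0 = 0, holomorphic_near0 H,
    \forall x \near (0 : E), H (Phi x) = x & \forall x \near (0 : E), Phi (H x) = x].
Proof.
move=> hPhi Phi0 H2; pose psi x : E := x - Phi x.
have hpsi : holomorphic_near0 psi.
  apply: filterS hPhi => x hx; exact: (differentiableB (diff_id_holo x) hx).
have psi0 : psi 0 = 0 by rewrite /psi Phi0 subr0.
have [|r1 r10 L1] := ordge2_lipschitz hpsi.
  by move=> i; have := H2 i; congr (ordge _ _); apply/funext => x; rewrite !mxE.
move/near0P: hpsi => [r2 r20 L2].
pose r := Num.min r1 r2; have r0 : 0 < r by rewrite lt_min r10.
have L x y : vabs x < r -> vabs y < r -> vabs (psi y - psi x) <= 2^-1 * vabs (y - x).
  by rewrite !lt_min => /andP[h _] /andP[h' _]; exact: L1.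
have dpsi x : vabs x < r -> differentiable psi x.
  by rewrite lt_min => /andP[_ h]; exact: L2.
clearbody r.
have Lpsi x : vabs x < r -> vabs (psi x) <= 2^-1 * vabs x.
  by move=> hx; have := L 0 x; rewrite vabs0 psi0 !subr0; exact.
pose u n y := iter n (fun z => y + psi z) 0.
have ub n y : vabs y < r / 2 -> vabs (u n y) < r /\ vabs (u n y) <= 2 * vabs y.
  move=> hy; have y0 := vabs_ge0 y.
  elim: n => [|n [IH1 IH2]]; first by rewrite /= vabs0 r0 mulr_ge0.
  suff h : vabs (u n.+1 y) <= 2 * vabs y by split => //; move: h hy; lra.
  by rewrite /=; apply: le_trans (vabsD _ _) _; have := Lpsi _ IH1; rewrite -/(u n y); move: IH2; lra.
have ud n y : vabs y < r / 2 -> vabs (u n.+1 y - u n y) <= vabs y * 2^-1 ^+ n.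
  move=> hy; elim: n => [|n IH]; first by rewrite /= psi0 addr0 subr0 expr0 mulr1.
  have -> : u n.+2 y - u n.+1 y = psi (u n.+1 y) - psi (u n y).
    by rewrite /= -/(u n y) opprD addrACA subrr add0r.
  apply: le_trans (L _ _ (ub _ _ hy).1 (ub _ _ hy).1) _.
  by rewrite exprS mulrCA ler_wpM2l ?invr_ge0.
have udiff n y : vabs y < r / 2 -> differentiable (u n) y.
  move=> hy; elim: n => [|n IH]; first exact: (differentiable_cst (0 : E) y).
  have h1 : differentiable (fun y => psi (u n y)) y.
    exact: (differentiable_comp IH (dpsi _ (ub n _ hy).1)).
  exact: (differentiableD (diff_id_holo y) h1).
have HH (i : 'I_d) : exists f, (exists M' : R, sep (r / 2) M' f) /\
    forall n y, vabs y < r / 2 -> cabs (u n y 0 i - f y) <= 4 * vabs y * 2^-1 ^+ n.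
  apply: (@geometric_limit R d (fun n y => u n y 0 i) (@vabs R d) (r / 2) r).
  - move=> n; exists r; apply: sep_diff => y hy; split.
      by apply: differentiable_coordP; exact: udiff.
    by apply: le_trans (cabs_coord _ _) _; apply: ltW; case: (ub n _ hy).
  - by move=> x hx; rewrite vabs_ge0 /=; move: hx; lra.
  - move=> n x hx; have := le_trans (cabs_coord _ i) (ud n x hx); by rewrite !mxE.
have [f Hf] := choice HH; pose H y : E := \row_i f i y.
have Hlim n y : vabs y < r / 2 -> vabs (u n y - H y) <= 4 * vabs y * 2^-1 ^+ n.
  move=> hy; apply: vabs_le => [|i]; last by rewrite !mxE; case: (Hf i) => _; exact.
  by rewrite !mulr_ge0 ?vabs_ge0 // exprn_ge0 // invr_ge0.
have Hb y : vabs y < r / 8 -> vabs (H y) < r.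
  move=> hy; have hy' : vabs y < r / 2 by move: hy; lra.
  have := Hlim 0%N y hy'; rewrite expr0 mulr1 /= sub0r vabsN => h.
  by apply: le_lt_trans h _; move: hy; lra.
have Hfix y : vabs y < r / 8 -> H y = y + psi (H y).
  move=> hy; have hy' : vabs y < r / 2 by move: hy r0; lra.
  apply/eqP; rewrite -subr_eq0 -vabs_eq0; apply/eqP.
  apply: (@geometric_eq0 R _ (8 * vabs y)) => [|n]; first exact: vabs_ge0.
  have -> : H y - (y + psi (H y)) = (psi (u n y) - psi (H y)) - (u n.+1 y - H y).
    by rewrite /= -/(u n y); apply/rowP => k; rewrite !mxE; ring.
  apply: le_trans (vabsD _ _) _; rewrite vabsN.
  have h1 := L _ _ (Hb _ hy) (ub n _ hy').1; have h2 := Hlim n _ hy'.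
  have h3 := Hlim n.+1 _ hy'; rewrite exprS in h3.
  move: h1 h2 h3 (vabs_ge0 (u n y - H y)); set A := vabs (u n y - H y); set B := vabs _.
  set D := vabs (u n.+1 y - H y); move: (2^-1 ^+ n) (vabs y) => q v.
  by move: A B D => A B D; nra.
have contr x y z : vabs x < r -> vabs z < r -> x = y + psi x -> z = y + psi z -> x = z.
  move=> hx hz ex ez; apply/eqP; rewrite -subr_eq0 -vabs_eq0 eq_le vabs_ge0 andbT.
  have := L _ _ hz hx; have -> : psi x - psi z = x - z.
    by move: ex ez; move: (psi x) (psi z) => a b -> ->; rewrite opprD addrACA subrr add0r.
  by move: (vabs _) => v; lra.
have r8 : 0 < r / 8 by rewrite divr_gt0.
have holoH : holomorphic_near0 H.
  have r2' : 0 < r / 2 by rewrite divr_gt0.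
  apply/near0P; exists (r / 2) => // x hx; apply: differentiable_rowP => i.
  have [[M' HM] _] := Hf i.
  have -> : (fun x => H x 0 i) = f i by apply/funext => z; rewrite mxE.
  exact: sep_differentiable HM hx.
exists H; split => //.
- have h0 : vabs (0 : E) < r / 8 by rewrite vabs0.
  apply: (contr _ 0 0); rewrite ?vabs0 //; last by rewrite psi0 addr0.
    exact: Hb.
  exact: Hfix.
- have [K [s [K0 s0 HK]]] := map_lipschitz hPhi Phi0.
  apply/near0P; exists (Num.min (Num.min r s) (r / 8 / K)).
    by rewrite !lt_min r0 s0 divr_gt0.
  move=> x; rewrite !lt_min => /andP[/andP[xr xs]]; rewrite ltr_pdivlMr // mulrC => xK.
  have Px : vabs (Phi x) < r / 8 by apply: le_lt_trans (HK _ xs) _.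
  apply: (contr _ (Phi x)) => //; first exact: Hb.
    exact: Hfix.
  by rewrite /psi addrC subrK.
- apply/near0P; exists (r / 8) => // y hy; have := Hfix y hy; rewrite /psi addrCA => e.
  by apply/esym/eqP; rewrite -subr_eq0; apply/eqP/(addrI (H y)); rewrite addr0 -e.
Qed.

Lemma mulmx_holo (A : 'M[C]_d) (G : E -> E) : holomorphic_near0 G -> holomorphic_near0 (fun x => G x *m A).
Proof.
apply: filterS => x hx; apply: differentiable_rowP => j.
have -> : (fun y => (G y *m A) 0 j) = \sum_i (fun y => G y 0 i * A i j).
  by apply/funext => y; rewrite fct_sumE mxE.
apply: differentiable_sum => i; apply: differentiableM; last exact: (differentiable_cst (A i j) x).
exact: differentiable_coordP.
Qed.

Lemma vabs_mulmx (A : 'M[C]_d) : exists2 K : R, 0 < K & forall x, vabs (x *m A) <= K * vabs x.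
Proof.
pose K := 1 + \sum_i \sum_j cabs (A i j).
have S0 (P : pred 'I_d) j : 0 <= \sum_(i | P i) cabs (A i j) by apply: sumr_ge0 => i _; exact: cabs_ge0.
have K0 : 0 < K.
  by rewrite ltr_pwDl // sumr_ge0 // => i _; rewrite sumr_ge0 // => j _; exact: cabs_ge0.
exists K => // x; apply: vabs_le => [|j]; first by rewrite mulr_ge0 ?vabs_ge0 // ltW.
rewrite mxE; apply: le_trans (cabs_sum _ _ _) _.
apply: (@le_trans _ _ (\sum_i cabs (A i j) * vabs x)).
  by apply: ler_sum => i _; rewrite cabsM mulrC ler_wpM2l ?cabs_ge0 // cabs_coord.
rewrite -mulr_suml ler_wpM2r ?vabs_ge0 // /K exchange_big /= [X in _ <= _ + X](bigD1 j) //= addrCA lerDl.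
by rewrite addr_ge0 // sumr_ge0.
Qed.

Lemma holo_near (P : E -> Prop) (G : E -> E) : holomorphic_near0 G -> G 0 = 0 ->
  (\forall x \near (0 : E), P x) -> \forall x \near (0 : E), P (G x).
Proof.
move=> hG G0 /near0P[r r0 Hr]; have [K [s [K0 s0 HK]]] := map_lipschitz hG G0.
apply/near0P; exists (Num.min s (r / K)); first by rewrite lt_min s0 divr_gt0.
move=> x; rewrite lt_min => /andP[xs]; rewrite ltr_pdivlMr // mulrC => xr.
by apply: Hr; apply: le_lt_trans (HK _ xs) _.
Qed.

Lemma holo_map_comp (F G : E -> E) : holomorphic_near0 F -> F 0 = 0 -> holomorphic_near0 G -> G 0 = 0 ->
  holomorphic_near0 (fun x => G (F x)).
Proof.
move=> hF F0 hG G0; have := holo_near hF F0 hG; apply: filterS2 hF => x h1 h2.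
exact: (differentiable_comp h1 h2).
Qed.

(** The linear part is given as a matrix, to be read off Taylor coefficients; it acts on row vectors
    from the right. Composition with its inverse reduces to the case tangent to the identity. *)
Lemma inverse_mapping (Phi : E -> E) (A : 'M[C]_d) : holomorphic_near0 Phi -> Phi 0 = 0 -> A \in unitmx ->
  (forall j, ordge 2 (fun x => (x *m A - Phi x) 0 j)) ->
  exists F : automorphism R d, aut_fun F = Phi.
Proof.
move=> hPhi Phi0 uA H2; pose Psi x := Phi x *m invmx A.
have hPsi : holomorphic_near0 Psi by exact: mulmx_holo.
have Psi0 : Psi 0 = 0 by rewrite /Psi Phi0 mul0mx.
have [|H [H0 hH H1 H3]] := inverse_tangent_id hPsi Psi0.
  move=> i; have [K [r [K0 r0 HK]]] := vec_ordge H2.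
  have [L L0 HL] := vabs_mulmx (invmx A).
  exists (L * K), r; split => // x hx; rewrite -mulrA.
  have -> : x 0 i - Psi x 0 i = ((x *m A - Phi x) *m invmx A) 0 i.
    by rewrite mulmxBl mulmxK // !mxE.
  apply: le_trans (cabs_coord _ _) _; apply: le_trans (HL _) _.
  by rewrite ler_wpM2l ?(ltW L0) // HK.
pose B y : E := y *m invmx A.
have hid : holomorphic_near0 (fun x : E => x) by apply: filterE => x; exact: diff_id_holo.
have hB : holomorphic_near0 B by exact: mulmx_holo hid.
have B0 : B 0 = 0 by rewrite /B mul0mx.
have inv : exists G : E -> E, [/\ G 0 = 0, holomorphic_near0 G,
    \forall x \near (0 : E), G (Phi x) = x & \forall x \near (0 : E), Phi (G x) = x].
  exists (fun y => H (B y)); split => //; first by rewrite B0.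
    exact: holo_map_comp.
  have := holo_near hB B0 H3; apply: filterS => y h.
  by rewrite -[LHS](mulmxKV uA) -/(Psi _) h /B mulmxKV.
by exists (@Automorphism R d Phi Phi0 hPhi inv).
Qed.

Lemma aut_id_exists : exists F : automorphism R d, aut_fun F = id.
Proof.
have hid : holomorphic_near0 (id : E -> E) by apply: filterE => x; exact: diff_id_holo.
have inv : exists G : E -> E, [/\ G 0 = 0, holomorphic_near0 G,
    \forall x \near (0 : E), G (id x) = x & \forall x \near (0 : E), id (G x) = x].
  by exists id; split => //; exact: filterE.
by exists (@Automorphism R d id erefl hid inv).
Qed.

Lemma aut_comp_exists F G : exists H : automorphism R d, aut_fun H = (fun x => G (F x)).
Proof.
have h0 : G (F 0) = 0 by rewrite !aut0.
have hh : holomorphic_near0 (fun x => G (F x)) by apply: holo_map_comp; rewrite ?aut0 //; exact: aut_holo.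
have inv : exists H : E -> E, [/\ H 0 = 0, holomorphic_near0 H,
    \forall x \near (0 : E), H (G (F x)) = x & \forall x \near (0 : E), G (F (H x)) = x].
  have [F' [F'0 hF' F1 F2]] := aut_inv F; have [G' [G'0 hG' G1 G2]] := aut_inv G.
  exists (fun x => F' (G' x)); split; first by rewrite G'0.
  - exact: holo_map_comp.
  - by have := aut_near F G1; apply: filterS2 F1 => x h1 ->.
  - by have := holo_near hG' G'0 F2; apply: filterS2 G2 => x h1 ->.
by exists (@Automorphism R d _ h0 hh inv).
Qed.

Lemma aut_iter_exists F n : exists H : automorphism R d, aut_fun H = iter n F.
Proof.
elim: n => [|n [H eH]]; first exact: aut_id_exists.
have [H' eH'] := aut_comp_exists H F; exists H'; rewrite eH' eH.
by apply/funext => x.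
Qed.

Lemma aut_inverse_exists F : exists G : automorphism R d,
  (\forall x \near (0 : E), G (F x) = x) /\ (\forall x \near (0 : E), F (G x) = x).
Proof.
have [G [G0 hG G1 G2]] := aut_inv F.
have inv : exists H : E -> E, [/\ H 0 = 0, holomorphic_near0 H,
    \forall x \near (0 : E), H (G x) = x & \forall x \near (0 : E), G (H x) = x].
  by exists F; split => //; [exact: aut0 | exact: aut_holo].
by exists (@Automorphism R d G G0 hG inv).
Qed.

End InverseMapping.

(** * Contracting automorphisms *)

Section Contraction.
Variables (R : realType) (d : nat).
Local Notation C := (CC R).
Local Notation E := 'rV[C]_d.
Implicit Types (x y : E) (F G : automorphism R d).

Lemma compact_iter (F : E -> E) (W K : set E) n : (forall x, W x -> {for x, continuous F}) ->
  (forall x, W x -> W (F x)) -> K `<=` W -> compact K -> compact (iter n F @` K).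
Proof.
move=> cF FW KW cK; apply: (@continuous_compact _ _ (iter n F) K) => //.
apply: continuous_in_subspaceT => x /set_mem Kx.
have h k : W (iter k F x) by elim: k => [|k IH] /=; [exact: KW | exact: FW].
elim: n => [|n IH]; first exact: cvg_id.
apply: (@continuous_comp _ _ _ (iter n F) F x IH); exact: cF.
Qed.

(* The compact sets F^n (K), where K is the closure of F (U), decrease to {0}. *)
Lemma contracting_uniform (F : E -> E) (U : set E) : U 0 -> (forall x, U x -> {for x, continuous F}) ->
  relatively_compact_in (F @` U) U -> \bigcap_(n in [set: nat]) (iter n F @` U) = [set 0] ->
  forall e : R, 0 < e -> exists n, forall x, U x -> vabs (iter n F x) < e.
Proof.
move=> U0 cF [cK KU] capF e e0; set K := closure (F @` U) in cK KU.
have FK x : U x -> K (F x) by move=> Ux; apply: subset_closure; exists x.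
clearbody K.
have FU x : U x -> U (F x) by move=> Ux; apply: KU; exact: FK.
suff [n Hn] : exists n, forall x, K x -> vabs (iter n F x) < e.
  by exists n.+1 => x Ux; rewrite iterSr; apply: Hn; exact: FK.
apply: contrapT => H.
have [xs Hxs] : exists xs : nat -> E, forall n, K (xs n) /\ e <= vabs (iter n F (xs n)).
  have h n : exists x, K x /\ e <= vabs (iter n F x).
    apply: contrapT => h; apply: H; exists n => x Kx; rewrite ltNge; apply/negP => h'.
    by apply: h; exists x.
  by have [xs Hxs] := choice h; exists xs.
have iterK n x : K x -> K (iter n F x).
  by move=> Kx; elim: n => //= n IH; apply: FK; exact: KU.
(* The points F^n (x_n) stay at distance at least e from 0. A cluster point lies in every F^m (K),
   hence is 0, which is absurd. *)
pose ys n := iter n F (xs n).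
have ysm m n : (m <= n)%N -> (iter m F @` K) (ys n).
  move=> mn; exists (iter (n - m) F (xs n)); first by apply: iterK; case: (Hxs n).
  by rewrite -iterD subnKC.
have [y [Ky cy]] : K `&` cluster (ys @ \oo) !=set0.
  by apply: cK; exists 0%N => // n _ /=; apply: iterK; case: (Hxs n).
have y0 : y = 0.
  suff : (\bigcap_(n in [set: nat]) (iter n F @` U)) y by rewrite capF.
  move=> m _; suff : (iter m F @` K) y by move=> [z /KU Uz <-]; exists z.
  have cl : closed (iter m F @` K).
    have ck := @compact_iter F U K m cF FU KU cK.
    apply: compact_closed; first exact: norm_hausdorff.
    exact ck.
  apply: cl => V Vy; apply: cy => //; exists m => // n /= mn; exact: ysm.
have : nbhs y [set z : E | vabs z < e].
  by rewrite y0; apply/near0P; exists e.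
move=> /(cy [set z : E | e <= vabs z]) [|z [/= h1]]; last by rewrite ltNge h1.
by exists 0%N => // n _ /=; case: (Hxs n).
Qed.

Lemma contracting_half F : contracting F -> exists (N : nat) (G : automorphism R d) (r : R),
  [/\ aut_fun G = iter N F, 0 < r & forall x, vabs x < r -> vabs (G x) <= 2^-1 * vabs x].
Proof.
move=> cF; have /near0P[rho rho0 Hrho] := aut_holo F.
(* F is differentiable on this polydisc, hence on U; since F maps U into itself, all iterates are
   differentiable on U. *)
have oW : open_nbhs (0 : E) [set x : E | vabs x < rho].
  split; last by rewrite /= vabs0.
  rewrite openE => x /= xr; apply/nearP; exists (rho - vabs x); first by rewrite subr_gt0.
  move=> y hy; rewrite -(subrK x y); apply: le_lt_trans (vabsD _ _) _.
  by rewrite -ltrBrDr.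
have [U [oU UW rc cap]] := cF _ oW.
have U0 : U 0 by case: oU.
have dF x : U x -> differentiable F x by move=> /UW; exact: Hrho.
have FU x : U x -> U (F x).
  by move=> Ux; case: rc => _; apply; apply: subset_closure; exists x.
have /near0P[s s0 Hs] : \forall x \near (0 : E), U x by exact: open_nbhs_nbhs.
pose r := s / 5; have r0 : 0 < r by rewrite divr_gt0.
(* Chosen to turn the Cauchy constant 8 M / r, with M = r / 16, into 1/2. *)
have e0 : 0 < r / 16 by rewrite divr_gt0.
have [|n Hn] := contracting_uniform U0 _ rc cap e0.
  by move=> x Ux; apply: differentiable_continuous; exact: dF.
have [G eG] := aut_iter_exists F n.
have dG x : U x -> differentiable (iter n F) x.
  move=> Ux; have Uk k : U (iter k F x) by elim: k => //= k IH; exact: FU.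
  elim: (n) => [|k IH]; first exact: diff_id_holo.
  exact: (differentiable_comp IH (dF _ (Uk k))).
exists n, G, (r / 4); split=> // [|x hx]; first by rewrite divr_gt0.
apply: vabs_le => [|i]; first by rewrite mulr_ge0 ?invr_ge0 ?vabs_ge0.
have h0 : vabs (0 : E) < r / 4 by rewrite vabs0 divr_gt0.
have := @cauchy_lipschitz R d (fun x => G x 0 i) r (r / 16) r0 _ 0 x h0 hx.
rewrite aut0 mxE !subr0.
have -> : 8 * (r / 16) / r = 2^-1 by field; rewrite gt_eqF.
apply=> z hz; have Uz : U z by apply: Hs; rewrite /r in hz; move: hz; lra.
split; first by apply: differentiable_coordP; rewrite eG; exact: dG.
by apply: le_trans (cabs_coord _ _) _; rewrite eG ltW // Hn.
Qed.

End Contraction.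

(** * Generalised eigenfunctions of the pull-back operator *)

Section Operator.
Variables (R : realType) (d : nat) (G : automorphism R d).
Local Notation C := (CC R).
Local Notation germ := (germ R d).
Local Notation cstg := (@cstg R d).
Implicit Types (phi psi : germ) (p q : {poly C}) (a b : C).

Definition pb phi : germ := pullback phi G.

(** The operator p(T), where T is the pull-back [pb]; [shiftg b] below is T - b. *)
Definition pact p phi : germ := \sum_(i < size p) cstg p`_i * iter i pb phi.

Definition shiftg b phi : germ := pb phi - cstg b * phi.

Definition gen_eigen b phi := exists n, iter n (shiftg b) phi = 0.

Lemma pbZ a phi : pb (cstg a * phi) = cstg a * pb phi.
Proof. by rewrite /pb pullbackM pullback_cst. Qed.

Lemma iter_pbZ n a phi : iter n pb (cstg a * phi) = cstg a * iter n pb phi.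
Proof. by elim: n => //= n ->; rewrite pbZ. Qed.

Lemma iter_pbD n phi psi : iter n pb (phi + psi) = iter n pb phi + iter n pb psi.
Proof. by elim: n => //= n ->; rewrite /pb pullbackD. Qed.

Lemma pactE n p phi : (size p <= n)%N -> pact p phi = \sum_(i < n) cstg p`_i * iter i pb phi.
Proof.
move=> pn; rewrite /pact (big_ord_widen n (fun i => cstg p`_i * iter i pb phi) pn) big_mkcond /=.
by apply: eq_bigr => i _; case: ltnP => // h; rewrite nth_default // cstg0 mul0r.
Qed.

Lemma pactD p q phi : pact (p + q) phi = pact p phi + pact q phi.
Proof.
have hp := leq_maxl (size p) (size q); have hq := leq_maxr (size p) (size q).
rewrite (pactE phi hp) (pactE phi hq) (pactE phi (size_polyD p q)) -big_split /=.
by apply: eq_bigr => i _; rewrite coefD cstgD mulrDl.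
Qed.

Lemma pact_addr p phi psi : pact p (phi + psi) = pact p phi + pact p psi.
Proof. by rewrite /pact -big_split /=; apply: eq_bigr => i _; rewrite iter_pbD mulrDr. Qed.

Lemma pact_scaler p a phi : pact p (cstg a * phi) = cstg a * pact p phi.
Proof. by rewrite /pact mulr_sumr; apply: eq_bigr => i _; rewrite iter_pbZ mulrCA. Qed.

Lemma pact0r p : pact p 0 = 0.
Proof. by apply: (addrI (pact p 0)); rewrite -pact_addr !addr0. Qed.

Lemma pact_sumr p (I : Type) (s : seq I) (P : pred I) (F : I -> germ) :
  pact p (\sum_(i <- s | P i) F i) = \sum_(i <- s | P i) pact p (F i).
Proof. exact: (big_morph (pact p) (pact_addr p) (pact0r p)). Qed.

Lemma pact_subr p phi psi : pact p (phi - psi) = pact p phi - pact p psi.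
Proof. by apply/eqP; rewrite eq_sym subr_eq -pact_addr subrK. Qed.

Lemma pactC a phi : pact a%:P phi = cstg a * phi.
Proof. by rewrite (pactE phi (size_polyC_leq1 a)) big_ord1 coefC. Qed.

Lemma pact1 phi : pact 1 phi = phi.
Proof. by rewrite -polyC1 pactC cstg1 mul1r. Qed.

Lemma pactX p phi : pact (p * 'X) phi = pb (pact p phi).
Proof.
rewrite (@pactE (size p).+1) ?size_polyMleq //; last first.
  by apply: leq_trans (size_polyMleq _ _) _; rewrite size_polyX addn2.
rewrite big_ord_recl coefMX /= cstg0 mul0r add0r /pb /pact pullback_sum.
by apply: eq_bigr => i _; rewrite coefMX /= -pbZ.
Qed.

Lemma pactZ a p phi : pact (a%:P * p) phi = cstg a * pact p phi.
Proof.
rewrite (@pactE (size p)) ?mul_polyC ?size_scale_leq // mulr_sumr.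
by apply: eq_bigr => i _; rewrite coefZ cstgM mulrA.
Qed.

Lemma pactM p q phi : pact (p * q) phi = pact p (pact q phi).
Proof.
elim/poly_ind: p => [|p a IH]; first by rewrite mul0r -polyC0 !pactC !cstg0 !mul0r.
rewrite mulrDl !pactD mulrAC !pactX IH; congr (_ + _).
by rewrite pactZ pactC.
Qed.

Lemma pact_comm p q phi : pact p (pact q phi) = pact q (pact p phi).
Proof. by rewrite -!pactM mulrC. Qed.

Lemma pact_X phi : pact 'X phi = pb phi.
Proof. by rewrite -['X]mul1r pactX pact1. Qed.

Lemma pact_shiftg b phi : pact ('X - b%:P) phi = shiftg b phi.
Proof.
by rewrite -polyCN pactD -['X]mul1r pactX pact1 pactC cstgN mulNr.
Qed.

Lemma pact_iter_shiftg b n phi : pact (('X - b%:P) ^+ n) phi = iter n (shiftg b) phi.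
Proof.
elim: n => [|n IH]; first by rewrite expr0 pact1.
by rewrite exprS pactM IH pact_shiftg.
Qed.

Lemma shiftg0 b : shiftg b 0 = 0.
Proof. by rewrite -pact_shiftg pact0r. Qed.

Lemma iter_shiftg0 b n : iter n (shiftg b) 0 = 0.
Proof. by elim: n => //= n ->; exact: shiftg0. Qed.

(** A C[T]-submodule of the germs. It is applied to the germs of order at least k and to ideals
    invariant under G. *)
Definition pb_stable (M : set germ) := [/\ M 0, forall u v, M u -> M v -> M (u + v),
  forall a u, M u -> M (cstg a * u) & forall u, M u -> M (pb u)].

Lemma pact_stable M p phi : pb_stable M -> M phi -> M (pact p phi).
Proof.
move=> [M0 MD MZ Mpb] Mphi; rewrite /pact; elim/big_rec: _ => // i x _ Mx.
by apply: MD => //; apply: MZ; elim: (nat_of_ord i) => //= n IH; exact: Mpb.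
Qed.

Lemma pb_stable_ordg k : pb_stable (ordg k).
Proof.
split; [exact: ordg0 | exact: ordgD | | by move=> u; exact: ordg_pullback].
by move=> a u hu m mk; rewrite gcoefZ hu ?mulr0.
Qed.

Lemma pb_stable_ideal I : is_ideal I -> invariant_under G I -> pb_stable I.
Proof. by move=> [I0 ID IM] inv; split => // a u; exact: IM. Qed.

Lemma shiftg_ordg k b phi : ordg k phi -> ordg k (shiftg b phi).
Proof. by move=> h; rewrite -pact_shiftg; exact: (pact_stable _ (pb_stable_ordg k) h). Qed.

(** Bezout, one root at a time: if u P + v Q = 1 with P the factor of c and Q the rest, then modulo
    M the germ v Q phi is killed by P and u P phi by Q, and the induction proceeds with the
    latter. *)
Lemma primary_decomposition (M : set germ) (l : seq C) (e : C -> nat) phi : pb_stable M -> uniq l ->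
  M (pact (\prod_(b <- l) ('X - b%:P) ^+ e b) phi) ->
  exists f : C -> {poly C}, M (phi - \sum_(b <- l) pact (f b) phi) /\
    forall b, b \in l -> M (iter (e b) (shiftg b) (pact (f b) phi)).
Proof.
move=> hM; elim: l phi => [|c l IH] phi /=.
  by rewrite big_nil pact1 => _ h; exists (fun=> 0); rewrite big_nil subr0.
move=> /andP[cl ul]; rewrite big_cons; set P := _ ^+ e c; set Q := \prod_(b <- l) _ => h.
have cop : coprimep P Q.
  rewrite /Q big_seq; elim/big_rec: _ => [|b x hb IHx]; first exact: coprimep1.
  rewrite coprimepMr IHx andbT; apply: coprimep_expl; apply: coprimep_expr.
  by rewrite coprimep_XsubC root_XsubC; apply: contraNneq cl => <-.
have [[u v] /= uv] := Bezout_eq1_coprimepP _ _ cop.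
have [|f [f1 f2]] := IH (pact (u * P) phi) ul.
  by rewrite -pactM mulrCA mulrC [Q * P]mulrC mulrC pactM; exact: pact_stable.
have fl b : b \in l -> (b == c) = false by move=> hb; apply: contraNF cl => /eqP <-.
exists (fun b => if b == c then v * Q else f b * (u * P)); split.
  rewrite big_cons eqxx -{1}[phi]pact1 -uv [X in X - _]pactD.
  have -> : \sum_(j <- l) pact (if j == c then v * Q else f j * (u * P)) phi =
      \sum_(j <- l) pact (f j) (pact (u * P) phi).
    by rewrite big_seq [RHS]big_seq; apply: eq_bigr => b /fl ->; rewrite pactM.
  by rewrite opprD addrA addrK.
move=> b; rewrite inE => /orP[/eqP ->|hb].
  by rewrite eqxx -pact_iter_shiftg -pactM mulrCA pactM; exact: pact_stable.
by rewrite fl // pactM; exact: f2.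
Qed.

(** With D the number of monomials of degree less than k, the coefficients in degree less than k of
    phi, T phi, ..., T^D phi are linearly dependent; the resulting polynomial splits over C. *)
Lemma annihilator k phi : exists l : seq C, ordg k (pact (\prod_(b <- l) ('X - b%:P)) phi).
Proof.
pose D := #|{: mpoly.bmultinom d k}|.
pose A : 'M[C]_(D.+1, D) := \matrix_(i, j) gcoef (iter i pb phi) (@enum_val (mpoly.bmultinom d k) predT j).
have : kermx A != 0.
  rewrite kermx_eq0 /row_free neq_ltn; apply/orP; left.
  by rewrite ltnS rank_leq_col.
move=> /rowV0Pn[v /sub_kermxP vA v0].
pose p := \poly_(i < D.+1) v 0 (inord i).
have p0 : p != 0.
  apply: contraNneq v0 => e; apply/eqP/rowP => i; rewrite mxE.
  by have := congr1 (fun q : {poly C} => q`_i) e; rewrite coef_poly ltn_ord inord_val coef0.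
have hp : ordg k (pact p phi).
  move=> m mk; rewrite (pactE phi (size_poly _ _)) gcoef_sum.
  have := congr1 (fun w : 'rV_D => w 0 (enum_rank (mpoly.BMultinom mk))) vA; rewrite !mxE => e.
  rewrite -[RHS]e; apply: eq_bigr => i _.
  by rewrite gcoefZ coef_poly ltn_ord inord_val mxE enum_rankK.
have [l pl] := closed_field_poly_normal p; exists l.
have -> : \prod_(b <- l) ('X - b%:P) = (lead_coef p)^-1%:P * p.
  by rewrite {2}pl -mul_polyC mulrA -polyCM mulVf ?lead_coef_eq0 // mul1r.
by rewrite pactM; exact: (pact_stable _ (pb_stable_ordg k) hp).
Qed.

(** As T is multiplicative, (T - ab)(phi psi) = (T - a) phi . T psi + a phi . (T - b) psi, and in
    each summand the sum of the nilpotency orders has dropped by one. *)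
Lemma gen_eigenM a b phi psi : gen_eigen a phi -> gen_eigen b psi -> gen_eigen (a * b) (phi * psi).
Proof.
move=> [m hm] [n hn]; exists (m + n)%N.
suff H N : forall k l phi psi, (k + l)%N = N -> iter k (shiftg a) phi = 0 ->
    iter l (shiftg b) psi = 0 -> iter N (shiftg (a * b)) (phi * psi) = 0 by exact: (H _ m n).
elim: N => [|N IH] [|k] [|l] {m n hm hn} {}phi {}psi // e.
- by move=> /= -> _; rewrite mul0r.
- by move=> h _; rewrite [phi]h mul0r iter_shiftg0.
- by move=> _ h; rewrite [psi]h mulr0 iter_shiftg0.
move=> hm hn; rewrite iterSr.
have -> : shiftg (a * b) (phi * psi) = shiftg a phi * pb psi + cstg a * phi * shiftg b psi.
  by rewrite /shiftg /pb pullbackM cstgM mulrBl mulrBr addrA subrK mulrACA mulrA.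
have addI c u v n : iter n (shiftg c) u = 0 -> iter n (shiftg c) v = 0 -> iter n (shiftg c) (u + v) = 0.
  by rewrite -!pact_iter_shiftg pact_addr => -> ->; rewrite addr0.
apply: addI.
  apply: (IH k l.+1); first by case: e => <-.
    by rewrite -iterSr.
  by rewrite -pact_iter_shiftg -pact_X pact_comm pact_iter_shiftg hn pact0r.
apply: (IH k.+1 l); first by case: e => <-; rewrite addSn addnS.
  by rewrite -pact_iter_shiftg pact_scaler pact_iter_shiftg hm mulr0.
by rewrite -iterSr.
Qed.

Lemma gen_eigen1 : gen_eigen 1 1.
Proof. by exists 1%N; rewrite /= /shiftg /pb pullback1 cstg1 mul1r subrr. Qed.

Lemma gen_eigenX a phi n : gen_eigen a phi -> gen_eigen (a ^+ n) (phi ^+ n).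
Proof.
move=> h; elim: n => [|n IH]; first by rewrite !expr0; exact: gen_eigen1.
by rewrite !exprS; exact: gen_eigenM.
Qed.

Lemma gen_eigen_prod (I : Type) (s : seq I) (a : I -> C) (F : I -> germ) :
  (forall i, gen_eigen (a i) (F i)) -> gen_eigen (\prod_(i <- s) a i) (\prod_(i <- s) F i).
Proof. by move=> H; elim/big_rec2: _ => [|i x y _]; [exact: gen_eigen1 | exact: gen_eigenM]. Qed.

Lemma gen_eigen_le a n n' phi : (n <= n')%N -> iter n (shiftg a) phi = 0 -> iter n' (shiftg a) phi = 0.
Proof. by move=> /subnK <- h; rewrite iterD h iter_shiftg0. Qed.

End Operator.

(** * Coordinates made of generalised eigenfunctions *)

Section Linearization.
Variables (R : realType) (d : nat).
Local Notation C := (CC R).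
Local Notation E := 'rV[C]_d.
Local Notation germ := (germ R d).
Local Notation cstg := (@cstg R d).
Local Notation mnm1 i := (@mpoly.mnm1 d i).
Implicit Types (phi psi : germ) (F G : automorphism R d) (b : C) (x : E).

Definition coordg i : germ := germ_mpoly (mpoly.mpolyX C (mnm1 i)).

(** The differential of phi at 0, as a row vector. *)
Definition ling phi : E := \row_i gcoef phi (mnm1 i).

Lemma mdeg_mnm1 i : mpoly.mdeg (mnm1 i) = 1%N.
Proof. exact: mdeg1. Qed.

Lemma mdeg_lt2 (m : mpoly.multinom d) : (mpoly.mdeg m < 2)%N -> m = @mpoly.mnm0 d \/ exists i, m = mnm1 i.
Proof.
rewrite ltnS leq_eqVlt => /orP[|]; last by rewrite ltnS leqn0 mdeg_eq0 => /eqP; left.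
by move=> /mdeg1P[i /eqP ->]; right; exists i.
Qed.

Lemma ordg2P phi : ordg 1 phi -> ling phi = 0 -> ordg 2 phi.
Proof.
move=> h1 h2 m /mdeg_lt2[->|[i ->]]; first by rewrite h1 // mdeg0.
by have := congr1 (fun v : E => v 0 i) h2; rewrite !mxE.
Qed.

Lemma ling_ordg2 phi : ordg 2 phi -> ling phi = 0.
Proof. by move=> h; apply/rowP => i; rewrite !mxE h // mdeg_mnm1. Qed.

Lemma lingD phi psi : ling (phi + psi) = ling phi + ling psi.
Proof. by apply/rowP => i; rewrite !mxE gcoefD. Qed.

Lemma lingB phi psi : ling (phi - psi) = ling phi - ling psi.
Proof. by apply/rowP => i; rewrite !mxE gcoefB. Qed.

Lemma lingZ b phi : ling (cstg b * phi) = b *: ling phi.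
Proof. by apply/rowP => i; rewrite !mxE gcoefZ. Qed.

Lemma ling_sum (I : Type) (s : seq I) (P : pred I) (F : I -> germ) :
  ling (\sum_(i <- s | P i) F i) = \sum_(i <- s | P i) ling (F i).
Proof.
apply: (big_morph ling lingD); by apply/rowP => i; rewrite !mxE gcoef0.
Qed.

Lemma ling_coordg i : ling (coordg i) = delta_mx 0 i.
Proof.
apply/rowP => j; rewrite !mxE eqxx /= gcoef_mpoly mcoeffX.
by rewrite eq_mnm1 eq_sym.
Qed.

Lemma ordg1_coordg i : ordg 1 (coordg i).
Proof.
move=> m; rewrite ltnS leqn0 mdeg_eq0 => /eqP ->; rewrite gcoef_mpoly mcoeffX.
by case: eqP => // /(congr1 (@mpoly.mdeg d)); rewrite mdeg_mnm1 mdeg0.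
Qed.

Lemma ling_pullback F : exists B : 'M[C]_d, forall phi, ordg 1 phi -> ling (pullback phi F) = ling phi *m B.
Proof.
exists (\matrix_i ling (pullback (coordg i) F)) => phi h1.
pose psi := phi - \sum_i cstg (ling phi 0 i) * coordg i.
have h : ordg 2 psi.
  apply: ordg2P.
    apply: ordgB => //; apply: ordg_sum => i _ m hm.
    by rewrite gcoefZ (ordg1_coordg i hm) mulr0.
  rewrite lingB ling_sum; apply/eqP; rewrite subr_eq0 [X in X == _]row_sum_delta; apply/eqP.
  by apply: eq_bigr => i _; rewrite lingZ ling_coordg.
have := ling_ordg2 (ordg_pullback F h); rewrite /psi pullbackB pullback_sum lingB ling_sum.
move/eqP; rewrite subr_eq0 => /eqP ->; apply/rowP => j; rewrite summxE mxE.
by apply: eq_bigr => i _; rewrite pullbackM pullback_cst lingZ !mxE.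
Qed.

Lemma pullback_id F phi : (\forall x \near (0 : E), F x = x) -> pullback phi F = phi.
Proof.
elim/germ_ind: phi => f h; rewrite pullback_germ_of; apply/germ_ofP.
by apply: filterS h => x /= ->.
Qed.

Lemma pullback_inverse G : exists F, forall phi, pullback (pullback phi G) F = phi.
Proof.
have [F [_ h]] := aut_inverse_exists G; have [H eH] := aut_id_exists R d.
exists F => phi; rewrite (@pullback_near _ _ F G H phi); first by apply: pullback_id; rewrite eH; exact: filterE.
by rewrite eH.
Qed.

(** Let B be the action of the inverse of G on linear parts. If T phi = b phi to first order, the
    linear part v of phi satisfies v = b v B, hence |v| <= |b| K |v|, and v = 0 as soon as |b| K <
    1. *)
Lemma shiftg_small G : exists2 c : R, 0 < c & forall b phi, cabs b < c -> ordg 1 phi ->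
  ordg 2 (shiftg G b phi) -> ordg 2 phi.
Proof.
have [F FG] := pullback_inverse G; have [B HB] := ling_pullback F.
have [K K0 HK] := vabs_mulmx B.
exists K^-1; first by rewrite invr_gt0.
move=> b phi hb h1 h2; apply: ordg2P => //.
have := ling_ordg2 h2; rewrite /shiftg lingB lingZ => /eqP; rewrite subr_eq0 => /eqP e.
have := HB _ (ordg_pullback G h1); rewrite FG e => e2.
apply/eqP; rewrite -vabs_eq0; apply: contraTT hb => n0; rewrite -leNgt -div1r ler_pdivrMr //.
have v0 : 0 < vabs (ling phi) by rewrite lt_def n0 vabs_ge0.
by rewrite -(ler_pM2r v0) mul1r mulrAC mulrC mulrA -[leRHS]mulrA -vabsZ {1}e2 HK.
Qed.

Section Half.
Variables (G : automorphism R d) (r0 : R).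
Hypotheses (r00 : 0 < r0) (HG : forall x, vabs x < r0 -> vabs (G x) <= 2^-1 * vabs x).

Lemma half_stable (r : R) x : r <= r0 -> vabs x < r -> vabs (G x) < r.
Proof.
move=> hr hx; apply: le_lt_trans (HG (lt_le_trans hx hr)) _.
by have := vabs_ge0 x; move: hx; lra.
Qed.

(** From f (G x) = b f x and |b| >= 1 one gets |f x| <= |f (G^n x)| = O(2^-n |x|) for all n. *)
Lemma eigen_ge1 b psi : ordg 1 psi -> shiftg G b psi = 0 -> 1 <= cabs b -> psi = 0.
Proof.
elim/germ_ind: psi => f /ordgP[K [r [r1 Hf]]].
rewrite /shiftg /pb pullback_germ_of germ_ofM => /eqP; rewrite subr_eq0 => /eqP /germ_ofP/near0P[s s0 Hs] b1.
rewrite -germ_of0; apply/germ_ofP/near0P; pose t := Num.min (Num.min r s) r0.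
exists t; first by rewrite !lt_min r1 s0.
have tr : t <= r by rewrite !ge_min lexx.
have ts : t <= s by rewrite !ge_min lexx orbT.
have t0 : t <= r0 by rewrite ge_min lexx orbT.
have H n x : vabs x < t -> cabs (f x) <= `|K| * vabs x * 2^-1 ^+ n.
  elim: n x => [|n IH] x hx.
    rewrite expr0 mulr1; apply: le_trans (Hf _ (lt_le_trans hx tr)) _.
    by rewrite expr1 ler_wpM2r ?vabs_ge0 ?ler_norm.
  apply: (@le_trans _ _ (cabs (f (G x)))).
    have := Hs _ (lt_le_trans hx ts).
    rewrite -[LHS]/(f (G x)) -[RHS]/(mpoly_fun (mpoly.mpolyC d b) x * f x) mpoly_funC => ->.
    by rewrite cabsM ler_peMl ?cabs_ge0.
  apply: le_trans (IH _ (half_stable t0 hx)) _.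
  rewrite exprS !mulrA ler_wpM2r ?exprn_ge0 ?invr_ge0 // -mulrA ler_wpM2l // mulrC.
  exact: HG (lt_le_trans hx t0).
move=> x hx; apply/eqP; rewrite -cabs_eq0; apply/eqP.
apply: (@geometric_eq0 R _ (`|K| * vabs x)) => [|n]; first exact: cabs_ge0.
exact: H.
Qed.

(** The iteration v -> b^-1 (v o G - f) runs on a single polydisc of radius t, which G maps into
    itself. Composition with G multiplies a bound in |x|^k by 2^-k, and division by b leaves a
    factor at most 1/2. *)
Lemma shiftg_surj k b phi : 2 * 2^-1 ^+ k <= cabs b -> ordg k phi ->
  exists2 psi, ordg k psi & shiftg G b psi = phi.
Proof.
move=> hb; elim/germ_ind: phi => f /ordgP[K [r [r1 Hf]]].
have b0 : 0 < cabs b by apply: lt_le_trans hb; rewrite mulr_gt0 // exprn_gt0 // invr_gt0.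
have bn0 : b != 0 by rewrite -cabs_gt0.
have [rho [M [rho0 Hrho]]] := holo_sep (holoP f).
have /near0P[s s0 Hs] := aut_holo G.
have /near0P[q q0 Hq] := holoP f.
have [t [t0 [tr trho ts tq] tr0]] : exists t : R, [/\ 0 < t, [/\ t <= r, t <= rho, t <= s & t <= q] & t <= r0].
  exists (Num.min (Num.min (Num.min r rho) (Num.min s q)) r0).
  by rewrite !lt_min r1 rho0 s0 q0 r00 !ge_min !lexx ?orbT.
have Gt x : vabs x < t -> vabs (G x) < t by exact: half_stable.
pose u n := iter n (fun (v : E -> C) x => b^-1 * (v (G x) - f x)) (fun=> 0).
pose D x := `|K| / cabs b * vabs x ^+ k.
have D0 x : 0 <= D x by rewrite mulr_ge0 ?exprn_ge0 ?vabs_ge0 // divr_ge0 // ltW.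
have DG x : vabs x < t -> D (G x) <= 2^-1 ^+ k * D x.
  move=> hx; rewrite /D mulrCA ler_wpM2l ?divr_ge0 ?(ltW b0) // -exprMn.
  by rewrite lerXn2r ?nnegrE ?mulr_ge0 ?invr_ge0 ?vabs_ge0 // HG // (lt_le_trans hx tr0).
have ud n : exists M' : R, forall x, vabs x < t -> differentiable (u n) x /\ cabs (u n x) <= M'.
  elim: n => [|n [M' IH]].
    by exists 0 => x _; split; [exact: (differentiable_cst 0 x) | rewrite /= cabs0].
  exists ((cabs b)^-1 * (M' + M)) => x hx; have [h1 h2] := IH _ (Gt _ hx); split.
    have h3 : differentiable (fun x => u n (G x)) x.
      exact: (differentiable_comp (Hs _ (lt_le_trans hx ts)) h1).
    have h4 := Hq _ (lt_le_trans hx tq).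
    exact: (differentiableM (differentiable_cst b^-1 x) (differentiableB h3 h4)).
  rewrite /= cabsM cabsV ler_wpM2l ?invr_ge0 ?(ltW b0) //; apply: le_trans (cabsB _ _) _.
  by apply: lerD => //; have [] := Hrho _ (lt_le_trans hx trho).
have step n x : vabs x < t -> cabs (u n.+1 x - u n x) <= D x * 2^-1 ^+ n.
  elim: n x => [|n IH] x hx.
    rewrite /= subr0 sub0r cabsM cabsN cabsV expr0 mulr1 /D mulrC -mulrA mulrCA.
    rewrite [leRHS]mulrC ler_pM2r ?invr_gt0 //; apply: le_trans (Hf _ (lt_le_trans hx tr)) _.
    by rewrite ler_wpM2r ?exprn_ge0 ?vabs_ge0 ?ler_norm.
  have -> : u n.+2 x - u n.+1 x = b^-1 * (u n.+1 (G x) - u n (G x)) by rewrite /= -/(u n); ring.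
  rewrite cabsM cabsV mulrC ler_pdivrMr //; apply: le_trans (IH _ (Gt _ hx)) _.
  apply: le_trans (ler_wpM2r _ (DG _ hx)) _; first by rewrite exprn_ge0 // invr_ge0.
  rewrite exprS; have P : 0 <= 2^-1 ^+ n :> R by rewrite exprn_ge0 // invr_ge0.
  move: hb P (D0 x) (ltW b0); move: (cabs b) (D x) (2^-1 ^+ n) (2^-1 ^+ k) => B A c e hb P A0 B0.
  have h : (2 * e) * (A * c) <= B * (A * c) by rewrite ler_wpM2r // mulr_ge0.
  by move: h; lra.
have [||v [[M' Hv] Hlim]] := @geometric_limit R d u D t (`|K| / cabs b * t ^+ k) _ _ step.
- by move=> n; have [M' HM] := ud n; exists M'; apply: sep_diff.
- move=> x hx; rewrite D0 /D ler_wpM2l ?divr_ge0 ?(ltW b0) //.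
  by rewrite lerXn2r ?nnegrE ?vabs_ge0 ?(ltW t0) // ltW.
have hv : v \in @holo_pred R d by apply/holo_predP; exact: sep_holo Hv.
exists (germ_of (Holo hv)).
  apply/ordgP; exists (4 * (`|K| / cabs b)), t; split => // x hx.
  rewrite -[leRHS]mulrA; have := Hlim 0%N x hx; rewrite expr0 mulr1 /= sub0r cabsN; exact.
rewrite /shiftg /pb pullback_germ_of germ_ofM germ_ofB; apply/germ_ofP/near0P; exists t => // x hx.
rewrite -[LHS]/(v (G x) - mpoly_fun (mpoly.mpolyC d b) x * v x) mpoly_funC.
apply/eqP; rewrite -subr_eq0 -cabs_eq0; apply/eqP.
apply: (@geometric_eq0 R _ (4 * D (G x) + cabs b * (4 * D x))) => [|n]; first exact: cabs_ge0.
have -> : v (G x) - b * v x - f x = b * (u n.+1 x - v x) - (u n (G x) - v (G x)).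
  by rewrite /= -/(u n) mulrBr mulrA mulfV // mul1r; ring.
apply: le_trans (cabsB _ _) _; rewrite cabsM.
have h1 := Hlim n _ (Gt _ hx); have h2 := Hlim n.+1 _ hx.
rewrite addrC mulrDl; apply: lerD => //; rewrite -[leRHS]mulrA ler_wpM2l ?cabs_ge0 //.
apply: le_trans h2 _; apply: ler_wpM2l; first by rewrite mulr_ge0.
by rewrite exprS ler_piMl ?exprn_ge0 ?invr_ge0 // invf_le1 // ler1n.
Qed.

Lemma iter_shiftg_surj k b n phi : 2 * 2^-1 ^+ k <= cabs b -> ordg k phi ->
  exists2 psi, ordg k psi & iter n (shiftg G b) psi = phi.
Proof.
move=> hb; elim: n phi => [|n IH] phi h; first by exists phi.
have [psi h1 <-] := shiftg_surj hb h; have [chi h2 <-] := IH _ h1.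
by exists chi.
Qed.

Lemma iter_shiftg_ordg2 (c : R) b n phi :
  (forall b phi, cabs b < c -> ordg 1 phi -> ordg 2 (shiftg G b phi) -> ordg 2 phi) ->
  cabs b < c -> ordg 1 phi -> ordg 2 (iter n (shiftg G b) phi) -> ordg 2 phi.
Proof.
move=> Hc hb; elim: n phi => // n IH phi h1; rewrite iterSr => h.
by apply: (Hc _ _ hb h1); apply: IH h; exact: shiftg_ordg.
Qed.

Lemma gen_eigen_lt1 b phi : ordg 1 phi -> phi != 0 -> gen_eigen G b phi -> cabs b < 1.
Proof.
move=> h1 h0 [n hn]; rewrite ltNge; apply/negP => b1; case/negP: h0; apply/eqP.
elim: n phi h1 hn => // n IH phi h1; rewrite iterSr => hn.
by apply: (@eigen_ge1 b) => //; apply: IH => //; exact: shiftg_ordg.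
Qed.

(** Coordinates are matched to first order only, which is what the inverse mapping theorem requires.
    The eigenfunctions for all coordinates are pooled in one list, from which a basis is extracted
    later. *)
Lemma coordg_gen_eigen : exists s : seq (C * germ),
  (forall bf, bf \in s -> [/\ bf.1 != 0, ordg 1 bf.2 & gen_eigen G bf.1 bf.2]) /\
  forall i, exists2 t, {subset t <= s} & ling (coordg i) = \sum_(bf <- t) ling bf.2.
Proof.
have [c c0 Hc] := shiftg_small G.
have [k [k2 kc]] : exists k, (2 <= k)%N /\ 2 * 2^-1 ^+ k <= c.
  apply: contrapT => H; suff e : c = 0 by move: c0; rewrite e ltxx.
  apply: (@geometric_eq0 R c 2) => [|n]; first exact: ltW.
  rewrite leNgt; apply/negP => h; apply: H; exists (n + 2)%N; rewrite leq_addl; split => //.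
  apply: ltW; apply: le_lt_trans h; rewrite ler_wpM2l // exprD ler_piMr ?exprn_ge0 ?invr_ge0 //.
  by rewrite exprn_ile1 ?invr_ge0 // invf_le1 // ler1n.
have H i : exists s : seq (C * germ),
  (forall bf, bf \in s -> [/\ bf.1 != 0, ordg 1 bf.2 & gen_eigen G bf.1 bf.2]) /\
  ling (coordg i) = \sum_(bf <- s) ling bf.2.
  have [l Hl] := annihilator G k (coordg i).
  (* Equal roots are grouped with their multiplicities, since [primary_decomposition] needs distinct
     ones. *)
  rewrite -prodr_undup_exp_count in Hl.
  have [f [f1 f2]] := primary_decomposition (pb_stable_ordg G k) (undup_uniq l) Hl.
  have o1 b : ordg 1 (pact G (f b) (coordg i)).
    exact: (pact_stable _ (pb_stable_ordg G 1) (@ordg1_coordg i)).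
  (* The component for b is a generalised eigenfunction only modulo O(|x|^k). Subtracting a z of
     order k with the same image under the power of T - b makes it exact, and k >= 2 leaves the
     linear part unchanged. *)
  have Hy b : exists y, b \in undup l -> 2 * 2^-1 ^+ k <= cabs b ->
      [/\ ordg 1 y, gen_eigen G b y & ling y = ling (pact G (f b) (coordg i))].
    have [[hb hk]|h] := pselect (b \in undup l /\ 2 * 2^-1 ^+ k <= cabs b); last first.
      by exists 0 => h1 h2; case: h.
    have [z z1 z2] := iter_shiftg_surj (count_mem b l) hk (f2 b hb).
    exists (pact G (f b) (coordg i) - z) => _ _; split.
    - by apply: ordgB => //; apply: ordg_le z1; exact: ltnW.
    - by exists (count_mem b l); rewrite -pact_iter_shiftg pact_subr !pact_iter_shiftg z2 subrr.
    - by rewrite lingB (ling_ordg2 (ordg_le k2 z1)) subr0.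
  have [y Hy'] := choice Hy.
  exists [seq (b, y b) | b <- undup l & 2 * 2^-1 ^+ k <= cabs b]; split.
    move=> _ /mapP[b + ->] /=; rewrite mem_filter => /andP[hk hb].
    have [y1 y2 _] := Hy' b hb hk; split => //.
    by rewrite -cabs_gt0; apply: lt_le_trans hk; rewrite mulr_gt0 // exprn_gt0 // invr_gt0.
  have := ling_ordg2 (ordg_le k2 f1); rewrite lingB => /eqP; rewrite subr_eq0 => /eqP ->.
  rewrite big_map big_filter ling_sum [RHS]big_mkcond /= big_seq [RHS]big_seq.
  apply: eq_bigr => b hb; case: ifP => [hk|/negbT]; first by have [_ _ ->] := Hy' b hb hk.
  rewrite -ltNge => hk; apply: ling_ordg2.
  apply: (iter_shiftg_ordg2 Hc (lt_le_trans hk kc) (o1 b)); exact: ordg_le k2 (f2 b hb).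
have [s Hs] := choice H; exists (flatten [seq s i | i <- enum 'I_d]); split.
  by move=> bf /flattenP[_ /mapP[i _ ->]]; case: (Hs i) => h _; exact: h.
move=> i; exists (s i); last by case: (Hs i).
by move=> bf h; apply/flattenP; exists (s i) => //; apply: map_f; rewrite mem_enum.
Qed.

(** The linear parts of the pooled eigenfunctions span, so d of them form an invertible matrix, and
    the corresponding germs are the components of a biholomorphism. *)
Lemma linearization : exists (Phi : automorphism R d) (nu : 'I_d -> C),
  forall i, [/\ nu i != 0, cabs (nu i) < 1 & gen_eigen G (nu i) (pullback (coordg i) Phi)].
Proof.
have [s [Hs Ht]] := coordg_gen_eigen.
pose y j := (nth (0, 0) s j).2.
pose Y : 'M[C]_(size s, d) := \matrix_(j < size s) ling (y j).
have fullY : row_full Y.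
  rewrite -sub1mx; apply/row_subP => i; rewrite row1 -ling_coordg.
  have [t ts ->] := Ht i; rewrite big_seq; apply: summx_sub => bf /ts hbf.
  have hi : (index bf s < size s)%N by rewrite index_mem.
  have -> : ling bf.2 = row (Ordinal hi) Y by rewrite rowK /y /= nth_index.
  exact: row_sub.
pose f := fullrankfun fullY; pose A := rowsub f Y.
have uA : A \in unitmx by exact: fullrowsub_unit.
have sf i : nth (0, 0) s (f i) \in s by rewrite mem_nth.
pose Phi (x : E) : E := \row_i repr (y (f i)) x.
have Phi0 : Phi 0 = 0.
  apply/rowP => i; rewrite !mxE; have [_ h _] := Hs _ (sf i).
  have [K [r [r1 Hr]]] : ordge 1 (repr (y (f i))) by apply/ordgP; rewrite germ_ofK.
  have := Hr 0; rewrite vabs0 expr1 mulr0 => /(_ r1) h'.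
  by apply/eqP; rewrite -cabs_eq0 eq_le h' cabs_ge0.
have hPhi : holomorphic_near0 Phi.
  have /filter_forall : forall i, \forall x \near (0 : E), differentiable (repr (y (f i))) x.
    by move=> i; exact: holoP.
  apply: filterS => x hx; apply: differentiable_rowP => i.
  have -> : (fun x => Phi x 0 i) = repr (y (f i)) by apply/funext => z; rewrite mxE.
  exact: hx.
have [||Psi ePsi] := @inverse_mapping R d Phi A^T hPhi Phi0.
- by rewrite unitmx_tr.
- move=> j; pose P : mpoly.mpoly d C := \sum_i A j i *: mpoly.mpolyX C (mnm1 i).
  have : ordg 2 (germ_mpoly P - y (f j)).
    have [_ h _] := Hs _ (sf j).
    have gP : germ_mpoly P = \sum_i cstg (A j i) * coordg i.
      by rewrite germ_mpoly_sum; apply: eq_bigr => i _; rewrite germ_mpolyZ.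
    apply: ordg2P.
      apply: ordgB => //; rewrite gP; apply: ordg_sum => i _ m hm.
      by rewrite gcoefZ (ordg1_coordg i hm) mulr0.
    rewrite lingB gP ling_sum; apply/eqP; rewrite subr_eq0; apply/eqP/rowP => k.
    rewrite summxE (bigD1 k) //= big1 => [|i ik].
      by rewrite lingZ ling_coordg !mxE !eqxx mulr1 addr0.
    by rewrite lingZ ling_coordg !mxE eq_sym (negbTE ik) andbF mulr0.
  rewrite -[y (f j)]germ_ofK germ_ofB => /ordgP; congr (ordge _ _); apply/funext => x.
  rewrite -[LHS]/(mpoly_fun P x - repr (y (f j)) x) !mxE; congr (_ - _).
  rewrite mpoly_fun_sum; apply: eq_bigr => i _.
  by rewrite /mpoly_fun mevalZ mevalXU mulrC; congr (_ * _); rewrite [RHS]mxE.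
exists Psi, (fun i => (nth (0, 0) s (f i)).1) => i.
have [h1 h2 h3] := Hs _ (sf i).
have eP : pullback (coordg i) Psi = y (f i).
  rewrite pullback_germ_of -[y _]germ_ofK; apply/germ_ofP; apply: filterE => x.
  by rewrite -[LHS]/(mpoly_fun _ (Psi x)) ePsi /mpoly_fun mevalXU mxE.
(* The germ 0 is a generalised eigenfunction for every value, so the bound |nu| < 1 requires a
   nonzero germ; a zero one would make A singular. *)
have n0 : y (f i) != 0.
  apply: contraTneq uA => e; apply/negP => uA.
  have := mulmxV uA => /(congr1 (row i)); rewrite row_mul.
  have -> : row i A = 0.
    by apply/rowP => k; rewrite !mxE -/(y (f i)) e gcoef0.
  rewrite mul0mx row1 => /(congr1 (fun v : E => v 0 i)); rewrite !mxE !eqxx => /eqP.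
  by rewrite eq_sym oner_eq0.
split; [exact: h1| |by rewrite eP].
exact: (gen_eigen_lt1 h2 n0 h3).
Qed.

End Half.
End Linearization.

(** * Isotypic components of an invariant ideal *)

Section Isotypic.
Variables (R : realType) (d : nat).
Local Notation C := (CC R).
Local Notation germ := (germ R d).
Local Notation cstg := (@cstg R d).
Local Notation mpol := (mpoly.mpoly d C).
Local Notation mnm := (mpoly.multinom d).
Local Notation mdeg := mpoly.mdeg.
Local Notation mcoeff := (@mpoly.mcoeff d C).
Variables (G Phi : automorphism R d) (nu : 'I_d -> C).
Hypothesis Hnu : forall i, [/\ nu i != 0, cabs (nu i) < 1 & gen_eigen G (nu i) (pullback (coordg R i) Phi)].
Implicit Types (phi : germ) (P : mpol) (m : mnm) (mu : C).

Definition monval m : C := \prod_i nu i ^+ m i.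

Definition isotypic mu P := forall m, mcoeff m P != 0 -> monval m = mu.

(** Here phi is an expression in the coordinates [Phi]: the germ under study is
    [pullback phi Phi]. *)
Definition isotypic_part mu phi P := forall m, mcoeff m P = if monval m == mu then gcoef phi m else 0.

Lemma monval_neq0 m : monval m != 0.
Proof. by apply/prodf_neq0 => i _; rewrite expf_neq0 //; case: (Hnu i). Qed.

(** All |nu_j| are below 1, so |mu| <= |nu_i|^(m_i), which bounds each exponent. *)
Lemma monval_finite mu : mu != 0 -> exists K, forall m, monval m = mu -> (mdeg m < K)%N.
Proof.
move=> mu0; have r0 : 0 < cabs mu by rewrite cabs_gt0.
have H i : exists N, forall n, cabs mu <= cabs (nu i) ^+ n -> (n < N)%N.
  have [n0 n1 _] := Hnu i.
  have /cvgrPdist_lt /(_ _ r0) [N _ HN] : cabs (nu i) ^+ e @[e --> \oo] --> (0 : R).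
    by apply: cvg_expr; rewrite ger0_norm ?cabs_ge0.
  exists N => n h; rewrite ltnNge; apply/negP => /HN /=.
  by rewrite sub0r normrN ger0_norm ?exprn_ge0 ?cabs_ge0 // ltNge h.
have [N HN] := choice H.
exists (\sum_i N i).+1 => m e; rewrite ltnS mdegE; apply: leq_sum => i _; apply: ltnW; apply: HN.
rewrite -e /monval cabs_prod (bigD1 i) //= cabsX ler_piMr ?exprn_ge0 ?cabs_ge0 //.
apply: prodr_ile1 => j _; have [_ h _] := Hnu j.
by rewrite cabsX exprn_ge0 ?cabs_ge0 // exprn_ile1 ?cabs_ge0 // ltW.
Qed.

Lemma isotypic_part_exists mu phi : mu != 0 -> exists P, isotypic_part mu phi P.
Proof.
move=> /monval_finite[K HK]; exists (trunc (fun m => if monval m == mu then gcoef phi m else 0) K).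
move=> m; rewrite mcoeff_trunc; case: ifP => // h; case: eqP => // /HK.
by rewrite h.
Qed.

Lemma isotypic_partP mu phi P : isotypic_part mu phi P -> isotypic mu P.
Proof. by move=> H m; rewrite H; case: (_ =P mu) => // _; rewrite eqxx. Qed.

Lemma mpolyX_gen_eigen m : gen_eigen G (monval m) (pullback (germ_mpoly (mpoly.mpolyX C m)) Phi).
Proof.
have -> : pullback (germ_mpoly (mpoly.mpolyX C m)) Phi = \prod_i pullback (coordg R i) Phi ^+ m i.
  rewrite mpolyXE_id (big_morph (@germ_mpoly R d) (@germ_mpolyM R d) (@germ_mpoly1 R d)) pullback_prod.
  apply: eq_bigr => i _; rewrite /coordg; elim: (m i) => [|n IH].
    by rewrite !expr0 germ_mpoly1 pullback1.
  by rewrite !exprS germ_mpolyM pullbackM IH.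
by apply: gen_eigen_prod => i; apply: gen_eigenX; case: (Hnu i).
Qed.

Definition in_coords P : germ := pullback (germ_mpoly P) Phi.

Lemma in_coords_sum (I : Type) (s : seq I) (p : pred I) (F : I -> mpol) :
  in_coords (\sum_(i <- s | p i) F i) = \sum_(i <- s | p i) in_coords (F i).
Proof. by rewrite /in_coords germ_mpoly_sum pullback_sum. Qed.

Lemma in_coordsZ a P : in_coords (a *: P) = cstg a * in_coords P.
Proof. by rewrite /in_coords germ_mpolyZ pullbackM pullback_cst. Qed.

Lemma isotypic_gen_eigen mu P : isotypic mu P -> gen_eigen G mu (in_coords P).
Proof.
move=> HP; rewrite [P]mpolyE in_coords_sum.
have H m : exists n, iter n (shiftg G (monval m)) (in_coords (mpoly.mpolyX C m)) = 0.
  exact: mpolyX_gen_eigen.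
have [n Hn] := choice H; exists (\sum_(m <- mpoly.msupp P) n m)%N.
rewrite -pact_iter_shiftg pact_sumr big_seq big1 // => m hm; rewrite pact_iter_shiftg.
have -> : mu = monval m by rewrite HP // -mcoeff_msupp.
rewrite in_coordsZ -pact_iter_shiftg pact_scaler pact_iter_shiftg.
rewrite (@gen_eigen_le _ _ _ _ (n m)) ?mulr0 //.
by rewrite (bigD1_seq m) ?msupp_uniq //= leq_addr.
Qed.

(* Bezout: on the finitely many monomials of degree < k, the polynomial q in the pull-back
   operator is the projection to the generalised eigenspace of mu. *)
Lemma isotypic_projection mu phi P n k : isotypic_part mu phi P ->
  exists q u, q = 1 - u * ('X - mu%:P) ^+ n /\
    ordg k (pact G q (pullback phi Phi) - in_coords P).
Proof.
move=> HP; pose X (m : mpoly.bmultinom d k) := in_coords (mpoly.mpolyX C (m : mnm)).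
have [e He] : exists e, forall m : mpoly.bmultinom d k, iter e (shiftg G (monval m)) (X m) = 0.
  have [e He] := choice (fun m : mpoly.bmultinom d k => mpolyX_gen_eigen m).
  exists (\max_m e m)%N => m; apply: gen_eigen_le (He m); exact: (leq_bigmax m).
pose Q : {poly C} := \prod_(m : mpoly.bmultinom d k | monval m != mu) ('X - (monval m)%:P) ^+ e.
(* The exponent e kills the monomials of value mu; the extra n makes q congruent to 1 modulo (X -
   mu)^n, so that q also fixes any germ killed by (T - mu)^n. *)
have cop : coprimep (('X - mu%:P) ^+ (e + n)) Q.
  rewrite /Q; elim/big_rec: _ => [|m x hm IHx]; first exact: coprimep1.
  rewrite coprimepMr IHx andbT; apply: coprimep_expl; apply: coprimep_expr.
  by rewrite coprimep_XsubC root_XsubC.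
have [[u v] /= uv] := Bezout_eq1_coprimepP _ _ cop.
exists (v * Q), (u * ('X - mu%:P) ^+ e); split.
  by rewrite -uv exprD mulrA addrAC subrr add0r.
have qX (m : mpoly.bmultinom d k) : pact G (v * Q) (X m) = if monval m == mu then X m else 0.
  case: eqP => [em|/eqP em]; last first.
    by rewrite /Q (bigD1 m) //= mulrCA mulrC pactM pact_iter_shiftg He pact0r.
  have -> : v * Q = 1 - u * ('X - mu%:P) ^+ n * ('X - mu%:P) ^+ e.
    by rewrite -uv exprD -mulrA [_ ^+ n * _]mulrC addrAC subrr add0r.
  rewrite pactD pact1 -mulNr pactM pact_iter_shiftg.
  by have := He m; rewrite em => ->; rewrite pact0r addr0.
have h1 : ordg k (pact G (v * Q) (pullback phi Phi - in_coords (trunc (gcoef phi) k))).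
  apply: (pact_stable _ (pb_stable_ordg G k)).
  by rewrite /in_coords -pullbackB; apply: ordg_pullback; exact: ordg_trunc.
have h2 : pact G (v * Q) (in_coords (trunc (gcoef phi) k)) = in_coords (trunc (fun m => mcoeff m P) k).
  rewrite /trunc !in_coords_sum pact_sumr; apply: eq_bigr => m _.
  rewrite !in_coordsZ pact_scaler -/(X m) qX HP.
  by case: ifP; rewrite ?cstg0 ?mulr0 ?mul0r.
have h3 : ordg k (in_coords P - in_coords (trunc (fun m => mcoeff m P) k)).
  rewrite /in_coords -pullbackB; apply: ordg_pullback => m mk.
  by rewrite gcoefB !gcoef_mpoly mcoeff_trunc mk subrr.
rewrite pact_subr h2 in h1; have := ordgB h1 h3.
by rewrite opprB addrA subrK.
Qed.

(** For every k, a polynomial in T applied to the given element of I agrees with its isotypic part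
    modulo O(|x|^k); closedness of I concludes. *)
Lemma isotypic_part_mem (I : set germ) mu phi P : is_ideal I -> invariant_under G I ->
  (forall g, (forall k, exists u, I u /\ ordg k (g - u)) -> I g) ->
  I (pullback phi Phi) -> isotypic_part mu phi P -> I (in_coords P).
Proof.
move=> hI inv cl Iphi HP; apply: cl => k.
have [q [u [_ h]]] := isotypic_projection 0 k HP.
exists (pact G q (pullback phi Phi)); split.
  exact: (pact_stable _ (pb_stable_ideal hI inv) Iphi).
by rewrite -opprB; exact: ordgN.
Qed.

(** The projection modulo O(|x|^k) can be taken to fix this germ, so it equals its isotypic part to
    every order. Generalised eigenfunctions are therefore polynomials in the coordinates. *)
Lemma gen_eigen_isotypic mu phi P : gen_eigen G mu (pullback phi Phi) -> isotypic_part mu phi P ->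
  pullback phi Phi = in_coords P.
Proof.
move=> [n hn] HP; apply/eqP; rewrite -subr_eq0; apply/eqP; apply: ordg_all => k.
have [q [u [-> h]]] := isotypic_projection n k HP; move: h.
by rewrite pactD pact1 -mulNr pactM pact_iter_shiftg hn pact0r addr0.
Qed.

Lemma isotypic_expansion phi (P : C -> mpol) k :
  (forall mu, mu != 0 -> isotypic_part mu phi (P mu)) ->
  exists s : seq C, (forall mu, mu \in s -> mu != 0) /\
    ordg k (pullback phi Phi - \sum_(mu <- s) in_coords (P mu)).
Proof.
move=> HP; exists (undup [seq monval m | m : mpoly.bmultinom d k]); split.
  by move=> mu; rewrite mem_undup => /mapP[m _ ->]; exact: monval_neq0.
rewrite -in_coords_sum /in_coords -pullbackB; apply: ordg_pullback => m mk.
have hm : monval m \in undup [seq monval m | m : mpoly.bmultinom d k].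
  by rewrite mem_undup; apply/mapP; exists (mpoly.BMultinom mk); rewrite ?mem_enum.
rewrite gcoefB gcoef_mpoly raddf_sum /= (bigD1_seq _ hm) ?undup_uniq //=.
rewrite HP ?monval_neq0 // eqxx big_seq_cond big1 ?addr0 ?subrr // => mu /andP[hmu ne].
rewrite HP; first by rewrite eq_sym (negbTE ne).
by move: hmu; rewrite mem_undup => /mapP[m' _ ->]; exact: monval_neq0.
Qed.

End Isotypic.

(** * Weights and generators *)

Section IntegerWeights.
Variables (R : realType) (d : nat).

(* Dirichlet's theorem, by the pigeonhole principle. *)
Lemma simultaneous_approximation (om : 'I_d -> R) (M : nat) : (0 < M)%N -> (forall i, 0 < om i) ->
  exists q w, (0 < q)%N /\ forall i, `|q%:R * om i - (w i)%:R| < M%:R^-1.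
Proof.
move=> M0 om0; have MR : 0 < M%:R :> R by rewrite ltr0n.
have pos (q : nat) i : 0 <= q%:R * om i by rewrite mulr_ge0 // ltW.
pose fr (q : nat) i : R := q%:R * om i - (Num.truncn (q%:R * om i))%:R.
have fr0 q i : 0 <= fr q i by rewrite subr_ge0 truncn_le pos.
have fr1 q i : fr q i < 1 by rewrite ltrBlDr addrC natr1 truncnS_gt.
have frM q i : 0 <= M%:R * fr q i by rewrite mulr_ge0 ?fr0 // ltW.
have hM q i : (Num.truncn (M%:R * fr q i) < M)%N.
  rewrite -(ltr_nat R); apply: (@le_lt_trans _ _ (M%:R * fr q i)); first by rewrite truncn_le.
  by rewrite -[ltRHS]mulr1 ltr_pM2l.
pose box (q : 'I_(M ^ d).+1) : {ffun 'I_d -> 'I_M} := [ffun i => Ordinal (hM q i)].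
have : ~~ injectiveb box.
  apply/negP => /injectiveP /leq_card; rewrite card_ffun !card_ord ltnn.
  by [].
move=> /injectivePn[q1 [q2 ne e]].
wlog lt : q1 q2 ne e / (q1 < q2)%N.
  move=> W; case: (ltngtP q1 q2) => h; first exact: (W q1 q2).
    by apply: (W q2 q1) => //; rewrite eq_sym.
  by case/negP: ne; apply/eqP/val_inj.
exists (q2 - q1)%N, (fun i => Num.truncn (q2%:R * om i) - Num.truncn (q1%:R * om i))%N.
split=> [|i]; first by rewrite subn_gt0.
have le12 : q1%:R * om i <= q2%:R * om i by rewrite ler_wpM2r ?ler_nat ?(ltW (om0 i)) // ltnW.
rewrite natrB; last by rewrite (ltnW lt).
rewrite natrB; last exact: le_truncn.
have -> : (q2%:R - q1%:R) * om i - ((Num.truncn (q2%:R * om i))%:R - (Num.truncn (q1%:R * om i))%:R) =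
    fr q2 i - fr q1 i by rewrite /fr; ring.
have := congr1 (fun f : {ffun 'I_d -> 'I_M} => nat_of_ord (f i)) e; rewrite !ffunE /= => e'.
rewrite -(ltr_pM2l MR) mulfV ?gt_eqF // -[X in X * _]gtr0_norm // -normrM mulrBr.
have h1 : (Num.truncn (M%:R * fr q1 i))%:R <= M%:R * fr q1 i by rewrite truncn_le.
have h2 : (Num.truncn (M%:R * fr q2 i))%:R <= M%:R * fr q2 i by rewrite truncn_le.
have h3 := truncnS_gt (M%:R * fr q1 i); have h4 := truncnS_gt (M%:R * fr q2 i).
rewrite -natr1 in h3; rewrite -natr1 in h4; rewrite e' in h1 h3.
by rewrite ltr_norml; move: h1 h2 h3 h4; move: (_ * _) (_ * _) (_%:R) => a b c; lra.
Qed.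

(** Let w approximate q om within 1 / M. The integers w.a and w.b differ from q times the common
    value om.a = om.b by at most N / M each, hence from each other by at most 2 N / M < 1, so they
    coincide. *)
Lemma integer_weights (om : 'I_d -> R) (N : nat) : (forall i, 0 < om i) ->
  exists w : 'I_d -> nat, (forall i, (0 < w i)%N) /\
  forall a b : 'I_d -> nat, (\sum_i a i <= N)%N -> (\sum_i b i <= N)%N ->
    \sum_i om i * (a i)%:R = \sum_i om i * (b i)%:R -> (\sum_i w i * a i = \sum_i w i * b i)%N.
Proof.
move=> om0.
(* The part 2 N + 1 gives 2 N / M < 1. The sum of the truncated inverses gives 1 / M < om i, so that
   w i = 0 is impossible. *)
pose M := (2 * N + 1 + \sum_i Num.truncn (om i)^-1)%N.
have M0 : (0 < M)%N by rewrite /M addn1.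
have MR : 0 < M%:R :> R by rewrite ltr0n.
have Mom i : M%:R^-1 < om i.
  rewrite -[ltRHS]invrK ltf_pV2 ?posrE ?invr_gt0 //.
  apply: lt_le_trans (truncnS_gt _) _; rewrite ler_nat /M (bigD1 i) //=.
  by move: (\sum_(j | j != i) _)%N (Num.truncn _) => S t; lia.
have [q [w [q0 Hw]]] := simultaneous_approximation M0 om0.
have err (a : 'I_d -> nat) : (\sum_i a i <= N)%N ->
    `|q%:R * (\sum_i om i * (a i)%:R) - (\sum_i w i * a i)%:R| <= N%:R / M%:R.
  move=> ha; rewrite natr_sum mulr_sumr -sumrB; apply: le_trans (ler_norm_sum _ _ _) _.
  apply: (@le_trans _ _ (\sum_i (a i)%:R / M%:R)).
    apply: ler_sum => i _; rewrite natrM mulrA -mulrBl normrM normr_nat mulrC ler_wpM2l //.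
    exact: ltW (Hw i).
  by rewrite -mulr_suml -natr_sum ler_wpM2r ?invr_ge0 ?ler_nat // ltW.
exists w; split=> [i|a b ha hb e].
  rewrite lt0n; apply/negP => /eqP w0; have := Hw i; rewrite w0 subr0.
  rewrite gtr0_norm ?mulr_gt0 ?ltr0n // => h; have := lt_trans h (Mom i).
  by rewrite -[ltRHS]mul1r ltr_pM2r // ltNge ler1n q0.
have h1 := err a ha; have h2 := err b hb; rewrite -e in h2.
apply/eqP; rewrite -(eqr_nat R) -subr_eq0; apply/eqP.
set A : nat := (\sum_i w i * a i)%N in h1 *; set B : nat := (\sum_i w i * b i)%N in h2 *.
have h3 : `|A%:R - B%:R : R| < 1.
  have -> : A%:R - B%:R = (q%:R * (\sum_i om i * (a i)%:R) - B%:R) - (q%:R * (\sum_i om i * (a i)%:R) - A%:R) :> R.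
    by ring.
  apply: le_lt_trans (ler_normB _ _) _; apply: le_lt_trans (lerD h2 h1) _.
  by rewrite -mulrDl ltr_pdivrMr // mul1r -natrD ltr_nat /M; lia.
have [AB|AB] := leqP B A.
  by move: h3; rewrite -natrB // normr_nat -[1]/(1%:R : R) ltr_nat ltnS leqn0 => /eqP ->.
by move: h3; rewrite distrC -natrB ?(ltnW AB) // normr_nat -[1]/(1%:R : R) ltr_nat ltnS leqn0 subn_eq0 leqNgt AB.
Qed.

End IntegerWeights.

(** * Linear algebra: spanning families and triangularization *)

Section Triangular.
Variable K : numClosedFieldType.

(** A finite subset of W whose span has maximal dimension. *)
Lemma span_of_set n (W : set 'rV[K]_n) : exists X : seq 'rV[K]_n,
  (forall v, v \in X -> W v) /\ forall v, W v -> v \in <<X>>%VS.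
Proof.
pose P k := `[< exists X : seq 'rV[K]_n, (forall v, v \in X -> W v) /\ \dim <<X>> = k >].
have P0 : exists k, P k by exists 0%N; apply/asboolP; exists [::]; rewrite span_nil dimv0.
have Pb k : P k -> (k <= \dim {: 'rV[K]_n})%N.
  by move=> /asboolP[X [_ <-]]; apply: dimvS; exact: subvf.
case: (ex_maxnP P0 Pb) => k /asboolP[X [XW dX]] Hk; exists X; split => // v Wv.
have sX : (<<X>> <= <<v :: X>>)%VS by rewrite span_cons addvSr.
suff : <<X>>%VS == <<v :: X>>%VS by move=> /eqP ->; apply: memv_span; rewrite inE eqxx.
rewrite eqEdim sX dX; apply: Hk; apply/asboolP; exists (v :: X); split => // w.
by rewrite inE => /orP[/eqP ->|/XW].
Qed.

Lemma triangularization n (M : 'M[K]_n) : exists P L : 'M[K]_n,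
  [/\ P \in unitmx, is_trig_mx L & P *m M = L *m P].
Proof.
case: n M => [|n] M; first by exists 1%:M, 0; split; rewrite ?unitmx1 ?mx0_is_trig // !flatmx0.
have [P Pu PM] := spectral.Schur M (ltn0Sn n); have uP := spectral.unitarymx_unit Pu.
exists P, (P *m M *m invmx P); split => //; last by rewrite mulmxKV.
by move: PM; rewrite /mxred.similar_to mxred.conjumx.
Qed.

End Triangular.

(** * Generators of one isotypic component in triangular position *)

Section TriangularGenerators.
Variables (R : realType) (d : nat).
Local Notation C := (CC R).
Local Notation E := 'rV[C]_d.
Local Notation germ := (germ R d).
Local Notation cstg := (@cstg R d).
Local Notation mpol := (mpoly.mpoly d C).
Local Notation mnm := (mpoly.multinom d).
Local Notation mdeg := mpoly.mdeg.
Local Notation mcoeff := (@mpoly.mcoeff d C).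
Variables (F G Phi : automorphism R d) (nu : 'I_d -> C) (N : nat) (I : set germ).
Hypothesis Hnu : forall i, [/\ nu i != 0, cabs (nu i) < 1 & gen_eigen G (nu i) (pullback (coordg R i) Phi)].
Hypotheses (GF : aut_fun G = iter N F) (hI : is_ideal I) (invF : invariant_under F I).
Implicit Types (phi : germ) (P : mpol) (m : mnm) (mu : C) (s : seq mpol).

Local Notation isotypic := (isotypic nu).
Local Notation in_coords := (in_coords Phi).

Definition gens s : set germ := [set u | exists2 P, P \in s & u = in_coords P].

Lemma gens_sub s t : {subset s <= t} -> ideal_gen (gens s) `<=` ideal_gen (gens t).
Proof. by move=> st; apply: ideal_gen_le => u [P /st Pt ->]; exists P. Qed.

Lemma pullback_iter phi : pullback (pullback phi G) F = pullback (pullback phi F) G.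
Proof.
have [H eH] := aut_iter_exists F N.+1.
rewrite (@pullback_near _ _ F G H); last by apply: filterE => x; rewrite GF eH iterSr.
by rewrite (@pullback_near _ _ G F H) //; apply: filterE => x; rewrite GF eH iterS.
Qed.

Lemma invariant_iter : invariant_under G I.
Proof.
have H n (H : automorphism R d) : aut_fun H = iter n F -> invariant_under H I.
  elim: n H => [|n IH] H eH phi Iphi.
    by rewrite pullback_id // eH; exact: filterE.
  have [H' eH'] := aut_iter_exists F n.
  rewrite -(@pullback_near _ _ F H' H); first by apply: invF; apply: (IH H').
  by apply: filterE => x; rewrite eH eH' iterSr.
exact: (H N).
Qed.

(** F commutes with its iterate G, hence with every power of T - mu. *)
Lemma gen_eigen_pullback mu phi : gen_eigen G mu phi -> gen_eigen G mu (pullback phi F).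
Proof.
move=> [n hn]; exists n; suff -> : iter n (shiftg G mu) (pullback phi F) = pullback (iter n (shiftg G mu) phi) F.
  by rewrite hn pullback0.
elim: n {hn} => //= n ->.
by rewrite /shiftg /pb pullbackB pullbackM pullback_cst pullback_iter.
Qed.

Lemma isotypic_sum mu (T : Type) (s : seq T) (p : T -> mpol) : (forall t, isotypic mu (p t)) ->
  isotypic mu (\sum_(t <- s) p t).
Proof.
move=> H m; rewrite raddf_sum /= => h; apply: contrapT => ne; case/negP: h; apply/eqP.
by rewrite big1 // => t _; apply/eqP; apply: contrapT => /negP /H.
Qed.

Lemma isotypicZ mu a P : isotypic mu P -> isotypic mu (a *: P).
Proof. by move=> H m; rewrite mcoeffZ mulf_eq0 negb_or => /andP[_ /H]. Qed.

Lemma pullback_surj phi : exists psi, pullback psi Phi = phi.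
Proof.
have [Psi [h _]] := aut_inverse_exists Phi; have [H eH] := aut_id_exists R d.
exists (pullback phi Psi); rewrite (@pullback_near _ _ Phi Psi H) ?eH //.
by apply: pullback_id; rewrite eH; exact: filterE.
Qed.

(* F preserves the finite-dimensional space of mu-isotypic elements of I; the generators come
   from a basis in which it is triangular. *)
Lemma triangular_generators mu : mu != 0 -> exists s,
  [/\ forall P, P \in s -> isotypic mu P /\ I (in_coords P),
      forall P, isotypic mu P -> I (in_coords P) -> ideal_gen (gens s) (in_coords P) &
      forall i, (i < size s)%N -> ideal_gen (gens (take i.+1 s)) (pullback (in_coords s`_i) F)].
Proof.
move=> mu0; have [K HK] := monval_finite Hnu mu0.
pose D := #|{: mpoly.bmultinom d K}|.
(* Polynomials isotypic for mu have degree less than K, so row vectors indexed by the monomials of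
   degree less than K encode all of them. *)
pose pv (v : 'rV[C]_D) : mpol := \sum_(m : mpoly.bmultinom d K) v 0 (enum_rank m) *: mpoly.mpolyX C (m : mnm).
have pvD (T : Type) (s : seq T) (a : T -> C) (v : T -> 'rV[C]_D) :
    pv (\sum_(t <- s) a t *: v t) = \sum_(t <- s) a t *: pv (v t).
  rewrite /pv; under [RHS]eq_bigr do rewrite scaler_sumr.
  rewrite exchange_big; apply: eq_bigr => m _ /=.
  by rewrite summxE scaler_suml; apply: eq_bigr => t _; rewrite mxE scalerA.
have [X [XW HX]] := span_of_set [set v : 'rV[C]_D | isotypic mu (pv v) /\ I (in_coords (pv v))].
set r := size X; pose p (i : 'I_r) := pv X`_i.
have hp i : isotypic mu (p i) /\ I (in_coords (p i)) by apply: XW; rewrite mem_nth.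
have spanP P : isotypic mu P -> I (in_coords P) -> exists c : 'I_r -> C, P = \sum_i c i *: p i.
  move=> isoP IP; pose v : 'rV[C]_D := \row_j mcoeff (enum_val j : mpoly.bmultinom d K) P.
  have ev : P = pv v.
    have -> : pv v = trunc (fun m => mcoeff m P) K.
      by apply: eq_bigr => m _; rewrite mxE enum_rankK.
    apply/mpolyP => m; rewrite mcoeff_trunc; case: ifP => // h.
    by apply/eqP; apply: contraFT h => /isoP /HK.
  have /HX : [set v : 'rV[C]_D | isotypic mu (pv v) /\ I (in_coords (pv v))] v by rewrite /= -ev.
  move=> /(@coord_span _ _ _ (in_tuple X)) e.
  exists (fun i => coord (in_tuple X) i v); rewrite {1}ev {1}e.
  exact: (pvD _ _ (fun i => coord (in_tuple X) i v) (fun i => X`_i)).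
(* The pull-back of p i by F is still a generalised eigenfunction of G for mu, hence an isotypic
   polynomial in the coordinates, and it lies in I; so it is in the span again. *)
have FP i : exists c : 'I_r -> C, pullback (in_coords (p i)) F = in_coords (\sum_j c j *: p j).
  have [hi Ii] := hp i.
  have [phi ephi] := pullback_surj (pullback (in_coords (p i)) F).
  have [P HP] := isotypic_part_exists Hnu phi mu0.
  have e : pullback phi Phi = in_coords P.
    apply: (gen_eigen_isotypic Hnu _ HP); rewrite ephi; apply: gen_eigen_pullback.
    exact: isotypic_gen_eigen Hnu _ _ hi.
  have [|c Hc] := spanP P (isotypic_partP HP); first by rewrite -e ephi; exact: invF.
  by exists c; rewrite -Hc -e ephi.
(* The [p i] form a spanning family, possibly with relations; M is a chosen matrix expressing the
   action of F on them. The lower triangular form L makes the image of q i a combination of the q j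
   with j <= i. *)
have [c Hc] := choice FP; pose M : 'M[C]_r := \matrix_(i, j) c i j.
have [Q [L [uQ tL eQ]]] := triangularization M.
pose q (i : 'I_r) := \sum_j Q i j *: p j.
have isoq i : isotypic mu (q i).
  by apply: isotypic_sum => j; apply: isotypicZ; case: (hp j).
have FQ i : pullback (in_coords (q i)) F = \sum_j cstg (L i j) * in_coords (q j).
  have linc (a : 'I_r -> C) : in_coords (\sum_j a j *: p j) = \sum_j cstg (a j) * in_coords (p j).
    by rewrite in_coords_sum; apply: eq_bigr => j _; rewrite in_coordsZ.
  rewrite linc pullback_sum.
  have -> : \sum_j pullback (cstg (Q i j) * in_coords (p j)) F =
      \sum_k cstg ((Q *m M) i k) * in_coords (p k).
    under eq_bigr => j _ do rewrite pullbackM pullback_cst Hc linc mulr_sumr.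
    rewrite exchange_big /=; apply: eq_bigr => k _; rewrite mxE.
    rewrite (big_morph cstg (@cstgD R d) (@cstg0 R d)) mulr_suml; apply: eq_bigr => j _.
    by rewrite mxE cstgM mulrA.
  rewrite eQ; under [RHS]eq_bigr => j _ do rewrite linc mulr_sumr.
  rewrite exchange_big /=; apply: eq_bigr => k _; rewrite mxE.
  rewrite (big_morph cstg (@cstgD R d) (@cstg0 R d)) mulr_suml; apply: eq_bigr => j _.
  by rewrite cstgM mulrA.
pose s := [seq q i | i <- enum 'I_r].
have ss : size s = r by rewrite size_map size_enum_ord.
have sE (i : 'I_r) : s`_i = q i.
  by rewrite (nth_map i) ?size_enum_ord // nth_ord_enum.
have idm (S : set germ) (a : 'I_r -> C) (b : 'I_r -> germ) : (forall i, ideal_gen S (b i) \/ a i = 0) ->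
    ideal_gen S (\sum_i cstg (a i) * b i).
  move=> H; apply: is_ideal_sum; first exact: ideal_gen_ideal.
  move=> i _; case: (ideal_gen_ideal S) => S0 _ SM.
  by case: (H i) => [|->]; [exact: SM | rewrite cstg0 mul0r].
exists s; split.
- move=> _ /mapP[i _ ->]; split; first exact: isoq.
  rewrite in_coords_sum; apply: is_ideal_sum => // j _; rewrite in_coordsZ.
  by case: hI => _ _; apply; case: (hp j).
- move=> P isoP IP; have [a ->] := spanP P isoP IP.
  have hq k : ideal_gen (gens s) (in_coords (p k)).
    have -> : p k = \sum_i invmx Q k i *: q i.
      have := mulVmx uQ => /matrixP e.
      under eq_bigr => i _ do rewrite scaler_sumr.
      have E j : \sum_i invmx Q k i *: (Q i j *: p j) = (k == j)%:R *: p j.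
        under eq_bigr => i _ do rewrite scalerA.
        by rewrite -scaler_suml; have := e k j; rewrite !mxE => ->.
      rewrite exchange_big /= (eq_bigr _ (fun j _ => E j)) (bigD1 k) //= eqxx scale1r.
      by rewrite big1 ?addr0 // => j /negbTE jk; rewrite eq_sym jk scale0r.
    rewrite in_coords_sum; under eq_bigr do rewrite in_coordsZ.
    apply: (idm (gens s)) => i; left; apply: ideal_gen_sub; exists (q i) => //; apply: map_f; exact: mem_enum.
  rewrite in_coords_sum; under eq_bigr do rewrite in_coordsZ.
  by apply: (idm (gens s)) => i; left.
- move=> i; rewrite ss => ir; have -> : s`_i = q (Ordinal ir) by rewrite -sE.
  rewrite FQ; apply: (idm (gens (take i.+1 s))) => j; have [ji|ij] := leqP j i.
    left; apply: ideal_gen_sub; exists (q j) => //; rewrite -sE.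
    rewrite -(@nth_take i.+1 _ 0 j) // mem_nth // size_take.
    by case: ifP => _; rewrite ?ltnS // ss.
  by right; rewrite (is_trig_mxP tL).
Qed.

End TriangularGenerators.

Section WeightedHomogeneous.
Variables (R : realType) (d : nat).
Local Notation C := (CC R).

Lemma weighted_homogeneousP (w : 'I_d -> nat) (P : mpoly.mpoly d C) (n : nat) :
  (forall m : mpoly.multinom d, m \in mpoly.msupp P -> (\sum_i w i * m i)%N = n) ->
  weighted_homogeneous w P.
Proof.
move=> H; exists n => t x; rewrite !mevalE mulr_sumr big_seq [RHS]big_seq.
apply: eq_bigr => m hm; rewrite mulrCA; congr (_ * _).
rewrite -(H m hm) -prodrXr -big_split /=; apply: eq_bigr => i _.
by rewrite exprMn exprM.
Qed.

End WeightedHomogeneous.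

(** * Assembling the generators of the ideal and their weights *)

Theorem theorem4p1 (R : realType) (d : nat) (F : automorphism R d)
    (I : set (germ R d)) :
  contracting F -> is_ideal I -> invariant_under F I ->
  exists (Phi : automorphism R d) (w : 'I_d -> nat)
         (r : nat) (P : 'I_r -> mpoly.mpoly d (CC R)),
    [/\ forall i, (0 < w i)%N,
        forall j, weighted_homogeneous w (P j),
        I = ideal_gen [set pullback (germ_mpoly (P j)) Phi | j in [set: 'I_r]]
      & forall i : 'I_r, invariant_under F
          (ideal_gen [set pullback (germ_mpoly (P j)) Phi
                     | j in [set j : 'I_r | (j <= i)%N]])].
Proof.
move=> cF hI invF.
have [N [G [r0 [GF r00 HG]]]] := contracting_half cF.
have [Phi [nu Hnu]] := linearization r00 HG.
have invG := invariant_iter GF invF.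
have clI g : (forall k, exists u, I u /\ ordg k (g - u)) -> I g.
  have [s [sI Hs]] := ideal_closed_fg hI => /Hs; exact: ideal_gen_min.
pose S := [set u | exists mu P, [/\ mu != 0, isotypic nu mu P, u = in_coords Phi P & I u]].
have [s [sS Is]] : exists s : seq (germ R d), (forall u, u \in s -> S u) /\
    I `<=` ideal_gen [set u | u \in s].
  (* Closedness is used here for the ideal generated by S: an element of I is known only as a limit
     of sums of members of S. *)
  have [t [tS Ht]] := ideal_closed_fg (ideal_gen_ideal S).
  have IS : I `<=` ideal_gen [set u | u \in t].
    move=> f If; apply: Ht => k; have [phi ephi] := pullback_surj Phi f.
    have HP mu : exists P, mu != 0 -> isotypic_part nu mu phi P.
      have [->|mu0] := eqVneq mu 0; first by exists 0.
      by have [P HP] := isotypic_part_exists Hnu phi mu0; exists P.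
    have [P HP'] := choice HP; have [l [l0 Hl]] := isotypic_expansion Hnu k HP'.
    exists (\sum_(mu <- l) in_coords Phi (P mu)); split; last by rewrite -ephi.
    rewrite big_seq; apply: is_ideal_sum; first exact: ideal_gen_ideal.
    move=> mu /l0 mu0; apply: ideal_gen_sub; exists mu, (P mu); split => //.
      exact: isotypic_partP (HP' _ mu0).
    by apply: (isotypic_part_mem Hnu hI invG clI _ (HP' _ mu0)); rewrite ephi.
  (* The members of t lie in the ideal generated by S but need not be isotypic; each is replaced by
     the finitely many members of S that it involves. *)
  have fin u : exists l : seq (germ R d), u \in t ->
      (forall v, v \in l -> S v) /\ ideal_gen [set v | v \in l] u.
    have [ut|_] := boolP (u \in t); last by exists [::].
    by have [l Hl] := ideal_gen_finite (tS u ut); exists l.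
  have [l Hl] := choice fin; exists (flatten [seq l u | u <- t]); split.
    move=> u /flattenP[_ /mapP[v vt ->] ul]; have [h _] := Hl v vt; exact: h.
  move=> f /IS; apply: ideal_gen_min; first exact: ideal_gen_ideal.
  move=> u /= ut; have [_] := Hl u ut; apply: ideal_gen_le => v /= vl.
  by apply/flattenP; exists (l u) => //; exact: map_f.
have [T [T1 T2 T3]] : exists T : seq (mpoly.mpoly d (CC R)), [/\
    forall P, P \in T -> (exists2 mu, mu != 0 & isotypic nu mu P) /\ I (in_coords Phi P),
    forall u, u \in s -> ideal_gen (gens Phi T) u &
    forall i, (i < size T)%N -> ideal_gen (gens Phi (take i.+1 T)) (pullback (in_coords Phi T`_i) F)].
  elim: s sS {Is} => [|u s IH] sS; first by exists [::].
  have [|T [T1 T2 T3]] := IH; first by move=> v vs; apply: sS; rewrite inE vs orbT.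
  have [mu [P [mu0 isoP eu Iu]]] : S u by apply: sS; rewrite inE eqxx.
  have [T' [T1' T2' T3']] := triangular_generators Hnu GF hI invF mu0.
  (* The invariance condition places the pull-back of a generator in the ideal of the generators up
     to it, and so survives when others are prepended. An eigenvalue met twice merely contributes
     its family again. *)
  exists (T' ++ T); split.
  - move=> Q; rewrite mem_cat => /orP[/T1'[h1 h2]|/T1//]; by split => //; exists mu.
  - move=> v; rewrite inE => /orP[/eqP ->|/T2].
      have := T2' P isoP; rewrite -eu => /(_ Iu); apply: gens_sub => Q; rewrite mem_cat => ->.
      by [].
    by apply: gens_sub => Q; rewrite mem_cat orbC => ->.
  - move=> i; rewrite size_cat nth_cat => hi; have [iT|Ti] := ltnP i (size T').
      have := T3' i iT; apply: gens_sub => Q; rewrite take_cat; case: ltnP => // h.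
      by rewrite mem_cat take_oversize // => ->.
    have := T3 (i - size T')%N; rewrite ltn_subLR // => /(_ hi); apply: gens_sub => Q.
    by rewrite take_cat ltnNge leqW //= subSn // mem_cat orbC => ->.
pose om i := - ln (cabs (nu i)).
have om0 i : 0 < om i.
  by have [h1 h2 _] := Hnu i; rewrite oppr_gt0 ln_lt0 // cabs_gt0 h1 h2.
pose M := (\max_(P <- T) \max_(m <- mpoly.msupp P) mpoly.mdeg m)%N.
have [w [w0 Hw]] := integer_weights M om0.
have TM P m : P \in T -> m \in mpoly.msupp P -> (\sum_i m i <= M)%N.
  move=> hP hm; rewrite -mdegE; apply: (@leq_trans (\max_(m <- mpoly.msupp P) mpoly.mdeg m)%N).
    exact: leq_bigmax_seq.
  exact: (@leq_bigmax_seq _ _ predT (fun P => \max_(m <- mpoly.msupp P) mpoly.mdeg m)%N).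
have om_sum (m : mpoly.multinom d) : \sum_i om i * (m i)%:R = - ln (cabs (monval nu m)).
  rewrite /monval cabs_prod.
  have [_ ->] : 0 < \prod_i cabs (nu i ^+ m i) /\
      ln (\prod_i cabs (nu i ^+ m i)) = \sum_i ln (cabs (nu i)) * (m i)%:R.
    elim/big_rec2: _ => [|i x y _ [y0 ey]]; first by rewrite ln1.
    have n0 : 0 < cabs (nu i) by rewrite cabs_gt0; case: (Hnu i).
    rewrite cabsX; have n1 : 0 < cabs (nu i) ^+ m i by rewrite exprn_gt0.
    by split; [rewrite mulr_gt0 | rewrite lnM ?posrE // ey lnXn // mulr_natr].
  by rewrite -sumrN; apply: eq_bigr => i _; rewrite mulNr.
have genE (k : nat) : (k <= size T)%N ->
    [set pullback (germ_mpoly T`_j) Phi | j in [set j : 'I_(size T) | (j < k)%N]] = gens Phi (take k T).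
  move=> kT; apply/seteqP; split=> [_ [j /= jk <-]|u [P /(nthP 0)[j]]].
    exists T`_j => //; rewrite -(@nth_take k _ 0 j) // mem_nth // size_take.
    by case: ifP => // _; exact: ltn_ord.
  rewrite size_takel // => jk; rewrite nth_take // => <- ->.
  by exists (Ordinal (leq_trans jk kT)).
exists Phi, w, (size T), (fun j => T`_j); split => //.
- move=> j; have jT : T`_j \in T by exact: mem_nth.
  have [[mu mu0 isoP] _] := T1 _ jT.
  (* The weighted degree is read off any monomial; the zero polynomial has none and is given degree
     0. *)
  have [e|[m0 hm0]] : mpoly.msupp T`_j = [::] \/ exists m0, m0 \in mpoly.msupp T`_j.
  + by case: (mpoly.msupp _) => [|m0 l]; [left | right; exists m0; rewrite inE eqxx].
  + by apply: (@weighted_homogeneousP _ _ _ _ 0) => m; rewrite e.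
  apply: (@weighted_homogeneousP _ _ _ _ (\sum_i w i * m0 i)%N) => m hm.
  apply: Hw; rewrite ?(TM _ _ jT) //.
  by rewrite !om_sum !isoP // -mcoeff_msupp.
- have -> : [set pullback (germ_mpoly T`_j) Phi | j in [set: 'I_(size T)]] = gens Phi T.
    rewrite -[in RHS](take_size T) -genE //.
    by congr image; apply/seteqP; split => j //=.
  apply/seteqP; split=> [f /Is|].
    apply: ideal_gen_min; first exact: ideal_gen_ideal.
    by move=> u /= us; exact: T2.
  by apply: ideal_gen_min => // _ [P /T1[_ IP] ->].
- move=> i; have -> : [set j : 'I_(size T) | (j <= i)%N] = [set j : 'I_(size T) | (j < i.+1)%N].
    by apply/seteqP; split => j; rewrite /= ltnS.
  rewrite genE //; set J := ideal_gen _.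
  (* Pull-back is a ring morphism, so invariance of J need only be checked on its generators. *)
  have hJ : is_ideal [set f | J (pullback f F)].
    have [J0 JD JM] := ideal_gen_ideal (gens Phi (take i.+1 T)).
    split=> [|u v hu hv|a u hu] /=; rewrite ?pullback0 ?pullbackD ?pullbackM //.
      exact: JD.
    exact: JM.
  move=> f; apply: (ideal_gen_min hJ) => u [P /(nthP 0)[j]].
  rewrite size_takel // => ji; rewrite nth_take // => <- -> /=.
  have jT : (j < size T)%N by apply: leq_trans ji _.
  apply: gens_sub (T3 j jT) => Q; rewrite -(@take_takel _ j.+1 i.+1) //.
  exact: mem_take.
Qed.
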